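(* Let $\mathbb{H}$ be the upper half-plane. For $\tau\in\mathbb{H}$ and $s>0$ let $$X_\tau(s)=\left\{\frac{1}{(m\tau+n)^2\,|m\tau+n|^s}\ :\ m,n\in\mathbb{Z},\ \gcd(m,n)=1\right\},\qquad \widehat{A}(X_\tau(s);t)=\prod_{x\in X_\tau(s)}Q_{\widehat A}(xt),\qquad Q_{\widehat A}(w)=\frac{\frac12\sqrt{w}}{\sinh(\frac12\sqrt{w})}.$$ Then, as functions of $(z,\tau)\in\mathbb{C}\times\mathbb{H}$ (with $z$ not a nonzero element of the lattice $\mathbb{Z}\tau+\mathbb{Z}$), $$\lim_{s\to0^+}\widehat{A}\big(X_\tau(s);(2\pi i z)^2\big)=2\pi i z\cdot\widetilde{\Theta}(z;\tau)^{-1},$$ where $\widetilde{\Theta}$ is the modified Jacobi theta function $$\widetilde{\Theta}(z;\tau)=\exp\left(\frac{\pi}{2}\cdot\frac{z^2}{\operatorname{Im}(\tau)}\right)\cdot u^{1/2}q^{1/8}\cdot\frac{\theta\left(z+\frac{\tau}{2}+\frac12;\tau\right)}{\eta(\tau)^3}.$$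
   Context: Notation: $u=e^{2\pi i z}$, $q=e^{2\pi i\tau}$, $u^{1/2}=e^{\pi i z}$, and $q^{a}=e^{2\pi i a\tau}$ for rational $a$. The Jacobi theta function is $\theta(z;\tau)=\sum_{n\in\mathbb{Z}}u^nq^{n^2/2}$ and the Dedekind eta function is $\eta(\tau)=q^{1/24}\prod_{n\ge1}(1-q^n)$. $Q_{\widehat A}(w)=1-\frac{w}{24}+\frac{7w^2}{5760}-\cdots$ is an even function of $\sqrt w$, hence a well-defined meromorphic function of $w\in\mathbb{C}$. $X_\tau(s)$ is a set: the coprime pairs $(m,n)$ and $(-m,-n)$ give the same element, which is counted once in the product. At $z=0$ the right-hand side is understood as its removable-singularity value. *)

(* Defs.v *)
From HB Require Import structures.
From mathcomp Require Import all_boot all_order all_algebra.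
From mathcomp Require Import finmap complex.
From mathcomp Require Import all_classical all_reals all_analysis.
From mathcomp Require Import summability.

Set Implicit Arguments.
Unset Strict Implicit.
Unset Printing Implicit Defensive.

Import Order.TTheory GRing.Theory Num.Theory.
Import numFieldNormedType.Exports.

Local Open Scope classical_set_scope.
Local Open Scope ring_scope.
Local Open Scope complex_scope.

(* The normed topology is only declared on the regular algebra R[i]^o;
   transport it to R[i] itself. *)
HB.instance Definition _ (R : rcfType) := GRing.ComAlgebra.copy R[i] R[i]^o.
HB.instance Definition _ (R : rcfType) := Vector.copy R[i] R[i]^o.
HB.instance Definition _ (R : rcfType) := NormedModule.copy R[i] R[i]^o.

Section UnorderedProducts.
Variables (I : choiceType) (R : realType).
Implicit Type f : I -> R[i].

Definition partial_prod f (A : {fset I}) : R[i] := \prod_(i <- A) f i.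

(* Unordered (unconditional) products, the multiplicative analogues of
   [summability.sum]: limits along the finite subsets of [I]. *)
Definition multipliable f : Prop := cvg (partial_prod f @ totally).

Definition infprod f : R[i] := lim (partial_prod f @ totally).

End UnorderedProducts.

Section Theta.
Variable R : realType.
Implicit Types (z w t tau : R[i]) (s a : R).

Definition cexp z : R[i] :=
  (expR (complex.Re z))%:C * (cos (complex.Im z) +i* sin (complex.Im z)).

Definition csinh z : R[i] := (cexp z - cexp (- z)) / 2.

Definition pii : R[i] := pi%:C * 'i%C.

(* q^a = exp (2 pi i a tau); with a = 1 this is also u = exp (2 pi i z). *)
Definition qpow tau a : R[i] := cexp (2 * pii * a%:C * tau).

Definition lattice tau : set R[i] :=
  [set w | exists m n : int, w = m%:~R * tau + n%:~R].

(* A set of values, so (m, n) and (- m, - n) contribute a single element. *)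
Definition Xset tau s : set R[i] :=
  [set x | exists m n : int, coprimez m n /\
    x = ((m%:~R * tau + n%:~R) ^+ 2 *
         (ComplexField.Normc.normc (m%:~R * tau + n%:~R) `^ s)%:C)^-1].

(* r / sinh r is even in r, so the choice of square root is irrelevant; the
   singularity at w = 0 is removable, with value 1. *)
Definition QA w : R[i] :=
  let r := sqrtc w / 2 in if w == 0 then 1 else r / csinh r.

(* At a pole, [QA] takes the junk value r / 0 = 0. *)
Definition QA_pole w : Prop := w != 0 /\ csinh (sqrtc w / 2) = 0.

Definition Ahat (S : set R[i]) t : R[i] :=
  infprod (fun x : set_type S => QA (val x * t)).

Definition Ahat_converges (S : set R[i]) t : Prop :=
  multipliable (fun x : set_type S => QA (val x * t)).

Definition jacobi_theta z tau : R[i] :=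
  summability.sum (fun n : int => qpow z 1 ^ n * qpow tau (n%:~R ^+ 2 / 2)).

Definition dedekind_eta tau : R[i] :=
  qpow tau (24%:R^-1) *
  lim ((\prod_(1 <= n < N.+1) (1 - qpow tau n%:R)) @[N --> \oo]).

Definition modified_theta z tau : R[i] :=
  cexp ((pi / 2)%:C * (z ^+ 2 / (complex.Im tau)%:C)) *
  (cexp (pii * z) * qpow tau (8%:R^-1)) *
  (jacobi_theta (z + tau / 2 + 1 / 2) tau / dedekind_eta tau ^+ 3).

Definition theta_quotient z tau : R[i] := 2 * pii * z / modified_theta z tau.

Definition theta_quotient_ext z tau : R[i] :=
  if z == 0 then lim (theta_quotient w tau @[w --> 0^'])
  else theta_quotient z tau.

End Theta.

(* Main.v *)
Require Import Defs.
From HB Require Import structures.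
From mathcomp Require Import all_boot all_order all_algebra.
From mathcomp Require Import finmap complex ring lra zify.
From mathcomp Require Import all_classical all_reals all_analysis.
From mathcomp Require Import summability.
Set Implicit Arguments.
Unset Strict Implicit.
Unset Printing Implicit Defensive.
Import Order.TTheory GRing.Theory Num.Theory.
Import numFieldNormedType.Exports.
Local Open Scope classical_set_scope.
Local Open Scope ring_scope.
Local Open Scope complex_scope.

(** Write omega for a primitive vector m tau + n of the lattice. The characteristic
    power series at t / (omega^2 |omega|^s), t = (2 pi i z)^2, is the inverse of
    sin (pi zeta) / (pi zeta) with zeta = z / (omega |omega|^(s/2)), and Euler's product
    ([has_prod_sinpi]) spreads it over the multiples k omega, k > 0. Opposite
    primitive vectors give the same element of the set and no others do, so the
    inverse of the A-hat product is the product of 1 - y_lambda, with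
    y_lambda = z^2 / (lambda^2 |omega|^s), over one half of the nonzero lattice vectors
    lambda = k omega ([has_prod_prim_shc], [has_prod_Ahat]).

    At s = 0 this product would converge only conditionally. Split each factor
    as (1 - y) exp y times exp (- y). The elementary factors deviate from 1 by
    O(1 / |lambda|^4), uniformly in s, and dominated convergence ([tannery_prod])
    gives the Weierstrass product of the lattice. What remains is the exponential
    of minus the sum of the y_lambda, and grouping by primitive vectors this sum is
    z^2 zeta(2) / zeta(2 + s) times the sum of 1 / (lambda^2 |lambda|^s)
    ([has_sum_ypow], [wsum_zetas]).

    The limit of the last sum is found by Hecke's method ([hecke_limit]). With
    phi(x) = 1 / (x |x|^s), the term (1 + s/2) / (x^2 |x|^s) is
    phi(x) - phi(x + 1), whose sum over a row vanishes, plus an error O(1 / |x|^3)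
    uniform in s ([nc_hecke_err]), minus (s/2) / |x|^(2+s). The error yields the
    Eisenstein series of weight two summed row by row, and the last term yields
    - pi / (2 Im tau), by the residue of the Epstein zeta function, which is
    computed by comparing row sums with the arctangent ([epstein_residue]).

    Summed row by row the Weierstrass product becomes explicit: the row m = 0 is a
    sine and, by Euler's product once more, the row m > 0 is
    (1 - q^m u) (1 - q^m / u) / (1 - q^m)^2 ([has_prod_theta_row]). The triple product
    identity ([triple_product]), obtained as a limit of the q-binomial theorem,
    turns the product of all rows into theta over eta^3. The extra
    exp (pi z^2 / (2 Im tau)) is exactly the exponential factor of the modified
    theta function ([modified_theta_product]). *)

(** * Limits along finite subsets of an index set *)

(* Lets near and squeeze arguments apply to limits along finite subsets. *)
#[local] Existing Instance totally_filter.

Section UnorderedBig.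
Variables (T : uniformType) (idx : T) (op : Monoid.com_law idx).
Hypothesis T_hausdorff : hausdorff_space T.
Hypothesis op_continuous : continuous (fun x : T * T => op x.1 x.2).

(** Sums and products are the two cases of one theory: a continuous commutative
    law on a Hausdorff uniform space, iterated over larger and larger finite
    subsets of an arbitrary index type. *)
Definition has_big (I : choiceType) (f : I -> T) (L : T) : Prop :=
  \big[op/idx]_(i <- (A : {fset I})) f i @[A --> totally] --> L.

Lemma has_big_unique (I : choiceType) (f : I -> T) L M :
  has_big f L -> has_big f M -> L = M.
Proof. by move=> fL fM; apply: (cvg_unique T_hausdorff fL fM). Qed.

(** Off [a] and [b] the families are trivial, so a bijection between these two
    parts suffices. Taking [e] and [e'] total, inverse to each other only
    there, lets partial families over different types be compared without
    passing to subtypes. *)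
Lemma has_big_reindex (I J : choiceType) (a : pred I) (b : pred J)
    (e : I -> J) (e' : J -> I) (f : I -> T) (g : J -> T) L :
  (forall i, a i -> b (e i) /\ e' (e i) = i) ->
  (forall j, b j -> a (e' j) /\ e (e' j) = j) ->
  (forall i, ~~ a i -> f i = idx) -> (forall j, ~~ b j -> g j = idx) ->
  (forall i, a i -> f i = g (e i)) ->
  has_big f L -> has_big g L.
Proof.
move=> eP e'P fN gN fg fL U /fL [A0 _ A0P].
exists [fset e i | i in A0 & a i]%fset => // B /= subB.
pose A := (A0 `|` [fset e' j | j in B & b j])%fset.
have := A0P A (fsubsetUl _ _); rewrite /=.
suff -> : \big[op/idx]_(i <- A) f i = \big[op/idx]_(j <- B) g j by [].
have -> : \big[op/idx]_(j <- B) g j = \big[op/idx]_(j <- B | b j) g j.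
  rewrite [RHS]big_mkcond; apply: eq_bigr => j _.
  by case: ifPn => // /gN.
have -> : \big[op/idx]_(i <- A) f i = \big[op/idx]_(i <- A | a i) f i.
  rewrite [RHS]big_mkcond; apply: eq_bigr => i _.
  by case: ifPn => // /fN.
transitivity (\big[op/idx]_(i <- [seq e' j | j <- B & b j]) f i); last first.
  rewrite big_map big_filter; apply: eq_bigr => j bj.
  by have [aj ej] := e'P j bj; rewrite fg // ej.
rewrite -big_filter; apply: perm_big; apply: uniq_perm.
- exact/filter_uniq/fset_uniq.
- rewrite map_inj_in_uniq; first exact/filter_uniq/fset_uniq.
  move=> j k; rewrite !mem_filter => /andP[bj _] /andP[bk _] jk.
  by rewrite -(e'P j bj).2 -(e'P k bk).2 jk.
move=> i; rewrite mem_filter !inE; apply/andP/mapP.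
- move=> [ai /orP[iA|/imfsetP[j /= ]]].
    exists (e i); last by rewrite (eP i ai).2.
    rewrite mem_filter (eP i ai).1 /=; apply: (fsubsetP subB).
    by apply/imfsetP; exists i => //=; rewrite inE iA.
  by rewrite !inE => /andP[jB bj] ->; exists j => //; rewrite mem_filter bj.
- move=> [j]; rewrite mem_filter => /andP[bj jB] ->; split.
    exact: (e'P j bj).1.
  by apply/orP; right; apply/imfsetP; exists j => //=; rewrite inE jB.
Qed.

(** A finite product of row products is a limit of products over rectangles,
    and these are close to [L] as soon as they contain a suitable finite set.
    Regularity of the uniform space carries the closeness over to the limit. *)
Lemma has_big_fubini (I J : choiceType) (f : I * J -> T) (r : I -> T) L :
  has_big f L -> (forall i, has_big (fun j => f (i, j)) (r i)) ->
  has_big r L.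
Proof.
move=> fL rP U /uniform_regular [V VL VU].
have [F0 _ F0P] := fL V VL.
exists [fset p.1 | p in F0]%fset => // A /= F0A; apply: VU.
have cvgA : \big[op/idx]_(i <- A) \big[op/idx]_(j <- B) f (i, j)
    @[B --> totally] --> \big[op/idx]_(i <- A) r i.
  by apply: cvg_big => // i _; exact: rP.
move=> W /cvgA [B0 _ B0P].
pose B := (B0 `|` [fset p.2 | p in F0])%fset.
exists (\big[op/idx]_(p <- (A `*` B)%fset) f p); split.
- apply: F0P => /=; apply/fsubsetP => p pF0; rewrite inE; apply/andP; split.
    by apply: (fsubsetP F0A); apply/imfsetP; exists p.
  by rewrite inE; apply/orP; right; apply/imfsetP; exists p.
- suff -> : \big[op/idx]_(p <- (A `*` B)%fset) f p =
    \big[op/idx]_(i <- A) \big[op/idx]_(j <- B) f (i, j).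
    exact: (B0P B (fsubsetUl _ _)).
  rewrite -(@big_allpairs T idx op I J A B f).
  apply/esym/perm_big/uniq_perm; last 2 first.
  - exact: fset_uniq.
  - move=> [i j]; rewrite in_fsetM /=.
    by apply/allpairsP/andP => [[[i' j'] /= [? ? [-> ->]]]|[? ?]] //; exists (i, j).
  by apply: allpairs_uniq => // -[? ?] [? ?].
Qed.

Lemma has_big_mul (I : choiceType) (f g : I -> T) L M :
  has_big f L -> has_big g M -> has_big (fun i => op (f i) (g i)) (op L M).
Proof.
move=> fL gM; rewrite /has_big.
under eq_cvg do rewrite big_split.
apply: (@cvg_comp _ _ _ (fun A : {fset I} => (\big[op/idx]_(i <- A) f i,
  \big[op/idx]_(i <- A) g i)) (fun x => op x.1 x.2) _ (nbhs (L, M)) (nbhs (op L M))).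
  exact: cvg_pair.
by move=> U; apply: (op_continuous (x := (L, M))).
Qed.

(** Any exhaustion by finite sets computes the unordered value; this is how
    intervals and symmetric intervals of integers are used below. *)
Lemma has_big_sub (I : choiceType) (X : Type) (F : set_system X)
    (G : X -> {fset I}) (f : I -> T) L :
  Filter F -> (forall A, \forall x \near F, (A `<=` G x)%fset) ->
  has_big f L -> \big[op/idx]_(i <- G x) f i @[x --> F] --> L.
Proof.
move=> FF GF fL U /fL [A _ AP].
by apply: filterS (GF A) => x; exact: AP.
Qed.

Lemma has_big_fin (I : choiceType) (f : I -> T) (A : {fset I}) :
  (forall i, i \notin A -> f i = idx) -> has_big f (\big[op/idx]_(i <- A) f i).
Proof.
move=> f1 U HU; exists A => // B /= AB.
suff -> : \big[op/idx]_(i <- B) f i = \big[op/idx]_(i <- A) f i.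
  exact: nbhs_singleton HU.
rewrite (bigID (mem A)) /= [X in op _ X]big1 ?Monoid.mulm1 //.
rewrite -big_filter; apply/perm_big/uniq_perm.
- by rewrite filter_uniq ?fset_uniq.
- exact: fset_uniq.
move=> i; rewrite mem_filter; case: (boolP (i \in A)) => //= iA.
exact: (fsubsetP AB).
Qed.

Lemma has_big_nat (f : nat -> T) L : has_big f L ->
  \big[op/idx]_(0 <= i < n) f i @[n --> \oo] --> L.
Proof.
move=> fL.
have := @has_big_sub _ _ \oo (fun n => [fset i in index_iota 0 n]%fset) f L _ _ fL.
rewrite /=.
have E n : \big[op/idx]_(i <- [fset i in index_iota 0 n]%fset) f i =
   \big[op/idx]_(0 <= i < n) f i.
  apply: perm_big; apply: uniq_perm.
  - exact: fset_uniq.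
  - exact: iota_uniq.
  - by move=> i; rewrite !inE.
under eq_cvg do rewrite E.
apply => A.
exists (\max_(i <- A) i).+1 => // n /= An.
apply/fsubsetP => i iA; rewrite !inE mem_index_iota /=.
by apply: leq_trans An; rewrite ltnS; apply: leq_bigmax_seq.
Qed.
End UnorderedBig.

(** * Complex limits and bounded families of reals *)

Section ComplexAnalysis.
Variable R : realType.
Local Notation C := R[i].
Local Notation nc := ComplexField.Normc.normc.

Lemma ncE (x : C) : `|x| = (nc x)%:C.
Proof. by []. Qed.

Lemma nc_ge0 (x : C) : 0 <= nc x.
Proof. by case: x => a b; exact: sqrtr_ge0. Qed.

Lemma ncM (x y : C) : nc (x * y) = nc x * nc y.
Proof. exact: ComplexField.Normc.normcM. Qed.

Lemma ncV (x : C) : nc x^-1 = (nc x)^-1.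
Proof. exact: ComplexField.Normc.normcV. Qed.

Lemma nc0 : nc (0 : C) = 0.
Proof. exact: ComplexField.Normc.normc0. Qed.

Lemma nc1 : nc (1 : C) = 1.
Proof. exact: ComplexField.Normc.normc1. Qed.

Lemma ncX (x : C) n : nc (x ^+ n) = nc x ^+ n.
Proof. by elim: n => [|n IH]; rewrite ?nc1 // !exprS ncM IH. Qed.

Lemma ncN (x : C) : nc (- x) = nc x.
Proof. by apply: complexI; rewrite -!ncE normrN. Qed.

Lemma ncD (x y : C) : nc (x + y) <= nc x + nc y.
Proof. by rewrite -lecR rmorphD -!ncE ler_normD. Qed.

Lemma ncB (x y : C) : nc (x - y) <= nc x + nc y.
Proof. by rewrite -(ncN y) ncD. Qed.

Lemma nc_eq0 (x : C) : (nc x == 0) = (x == 0).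
Proof.
by apply/eqP/eqP => [/ComplexField.Normc.eq0_normc|->]; rewrite ?nc0.
Qed.

Lemma nc_gt0 (x : C) : (0 < nc x) = (x != 0).
Proof. by rewrite lt_neqAle nc_ge0 andbT eq_sym nc_eq0. Qed.

Lemma nc_real (x : R) : nc x%:C = `|x|.
Proof. by rewrite /= expr0n addr0 sqrtr_sqr. Qed.

Lemma nc_sum (I : Type) (s : seq I) (f : I -> C) :
  nc (\sum_(i <- s) f i) <= \sum_(i <- s) nc (f i).
Proof.
elim: s => [|i s IH]; rewrite ?big_nil ?nc0 // !big_cons.
by apply: le_trans (ncD _ _) _; rewrite lerD2l.
Qed.

Lemma nc_Re (x : C) : `|complex.Re x| <= nc x.
Proof. by rewrite -lecR -ncE normc_ge_Re. Qed.

Lemma nc_Im (x : C) : `|complex.Im x| <= nc x.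
Proof.
by case: x => a b /=; rewrite -sqrtr_sqr ler_wsqrtr // lerDr sqr_ge0.
Qed.

Lemma nc_ReIm (x : C) : nc x <= `|complex.Re x| + `|complex.Im x|.
Proof.
have i1 : nc ('i : C) = 1 by rewrite /= expr0n add0r expr1n sqrtr1.
rewrite [x in nc x]complexE; apply: le_trans (ncD _ _) _.
by rewrite ncM (nc_real (complex.Re x)) (nc_real (complex.Im x)) i1 mul1r.
Qed.

Lemma cvgCP (X : Type) (F : set_system X) {FF : Filter F} (f : X -> C) (l : C) :
  f @ F --> l <-> forall e : R, 0 < e -> \forall x \near F, nc (f x - l) < e.
Proof.
rewrite cvgrPdist_lt; split => H.
  move=> e e0.
  have /H : 0 < e%:C by rewrite ltcR.
  by apply: filterS => x; rewrite distrC /Num.norm /= ltcR.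
move=> e e0; have ee : e = (complex.Re e)%:C by rewrite RRe_real // gtr0_real.
have /H : 0 < complex.Re e by rewrite -ltcR -ee.
by apply: filterS => x; rewrite distrC /Num.norm /= ee ltcR.
Qed.

Lemma cvg_ReIm (X : Type) (F : set_system X) {FF : Filter F} (f : X -> C)
    (a b : R) :
  complex.Re (f x) @[x --> F] --> a -> complex.Im (f x) @[x --> F] --> b ->
  f @ F --> a +i* b.
Proof.
move=> /cvgrPdist_lt fa /cvgrPdist_lt fb; apply/cvgCP => e e0.
have e20 : 0 < e / 2 by rewrite divr_gt0.
near=> x; apply: le_lt_trans (nc_ReIm _) _.
rewrite [e]splitr ltrD //.
- rewrite raddfB /= distrC; near: x; exact: fa.
- rewrite raddfB /= distrC; near: x; exact: fb.
Unshelve. all: by end_near. Qed.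

Lemma cvg_Re (X : Type) (F : set_system X) {FF : Filter F} (f : X -> C) (l : C) :
  f @ F --> l -> complex.Re (f x) @[x --> F] --> complex.Re l.
Proof.
move=> /cvgCP fl; apply/cvgrPdist_lt => e /fl; apply: filterS => x.
by apply: le_lt_trans; rewrite distrC -raddfB nc_Re.
Qed.

Lemma cvg_Im (X : Type) (F : set_system X) {FF : Filter F} (f : X -> C) (l : C) :
  f @ F --> l -> complex.Im (f x) @[x --> F] --> complex.Im l.
Proof.
move=> /cvgCP fl; apply/cvgrPdist_lt => e /fl; apply: filterS => x.
by apply: le_lt_trans; rewrite distrC -raddfB nc_Im.
Qed.

Lemma cvg_realC (X : Type) (F : set_system X) {FF : Filter F} (f : X -> R) (l : R) :
  f @ F --> l -> (f x)%:C @[x --> F] --> l%:C.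
Proof. by move=> fl; apply: cvg_ReIm => //; exact: cvg_cst. Qed.

Lemma cvgC_squeeze (X : Type) (F : set_system X) {FF : Filter F} (f : X -> C)
    (g : X -> R) (l : C) :
  (\forall x \near F, nc (f x - l) <= g x) -> g @ F --> (0 : R) -> f @ F --> l.
Proof.
move=> fg /cvgrPdist_lt g0; apply/cvgCP => e e0; near=> x.
have : `|0 - g x| < e by near: x; exact: g0.
rewrite sub0r normrN; apply: le_lt_trans; apply: le_trans (ler_norm _).
by near: x.
Unshelve. all: by end_near. Qed.

Lemma cvg_nc0 (X : Type) (F : set_system X) {FF : Filter F} (f : X -> C) :
  f @ F --> (0 : C) -> nc (f x) @[x --> F] --> (0 : R).
Proof.
move=> /cvgCP f0; apply/cvgrPdist_lt => e /f0; apply: filterS => x.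
by rewrite subr0 sub0r normrN ger0_norm ?nc_ge0.
Qed.

Lemma cvgC_neq0 (X : Type) (F : set_system X) {FF : Filter F} (f : X -> C) (l : C) :
  l != 0 -> f @ F --> l -> \forall x \near F, f x != 0.
Proof.
rewrite -nc_gt0 => l0 /cvgCP /(_ _ l0); apply: filterS => x.
by apply: contraTneq => ->; rewrite sub0r ncN ltxx.
Qed.

Lemma hausdorffC : hausdorff_space C.
Proof. exact: norm_hausdorff. Qed.

Lemma cvgC_lim (X : Type) (F : set_system X) {FF : ProperFilter F} (f : X -> C)
  (l : C) : f @ F --> l -> lim (f @ F) = l.
Proof. by move=> fl; apply: cvg_lim => //; exact: hausdorffC. Qed.

Lemma cvgC_unique (X : Type) (F : set_system X) {FF : ProperFilter F} (f : X -> C)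
  (l m : C) : f @ F --> l -> f @ F --> m -> l = m.
Proof. by move=> fl fm; apply: (cvg_unique hausdorffC fl fm). Qed.

Lemma addC_continuous : continuous (fun x : C * C => x.1 + x.2).
Proof. exact: add_continuous. Qed.

Lemma mulC_continuous : continuous (fun x : C * C => x.1 * x.2).
Proof. by move=> [x y]; apply: cvgM; [exact: cvg_fst|exact: cvg_snd]. Qed.

(** Completeness in the form in which it is used: a family that eventually stays
    within any given distance of some point converges. It reduces to
    completeness of the reals by taking real and imaginary parts. *)
Lemma cauchyC (X : Type) (F : set_system X) {FF : ProperFilter F} (f : X -> C) :
  (forall e : R, 0 < e -> exists l : C, \forall x \near F, nc (f x - l) < e) ->
  exists l : C, f @ F --> l.
Proof.
move=> H.
have cre : cvg (complex.Re (f x) @[x --> F]).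
  apply/cauchy_cvgP/cauchy_exP => e /= /H [l Fl]; exists (complex.Re l).
  near=> x; rewrite /ball /= distrC -raddfB; apply: le_lt_trans (nc_Re _) _.
  by near: x.
have cim : cvg (complex.Im (f x) @[x --> F]).
  apply/cauchy_cvgP/cauchy_exP => e /= /H [l Fl]; exists (complex.Im l).
  near=> x; rewrite /ball /= distrC -raddfB; apply: le_lt_trans (nc_Im _) _.
  by near: x.
by eexists; apply: cvg_ReIm; [exact: cre|exact: cim].
Unshelve. all: by end_near. Qed.

Lemma big_fset_split (T : Type) (idx : T) (op : Monoid.com_law idx)
    (I : choiceType) (A B : {fset I}) (f : I -> T) : (A `<=` B)%fset ->
  \big[op/idx]_(i <- B) f i =
  op (\big[op/idx]_(i <- A) f i) (\big[op/idx]_(i <- (B `\` A)%fset) f i).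
Proof.
move=> AB; rewrite -big_cat /=; apply: perm_big; apply: uniq_perm.
- exact: fset_uniq.
- rewrite cat_uniq !fset_uniq andbT /=; apply/hasPn => i.
  by rewrite inE => /andP[].
move=> i; rewrite mem_cat in_fsetD; case: (boolP (i \in A)) => //= iA.
by rewrite (fsubsetP AB).
Qed.

(** For nonnegative [g] this is summability; domination arguments need no more
    than the existence of a bound. *)
Definition bsum (I : choiceType) (g : I -> R) : Prop :=
  exists M, forall A : {fset I}, \sum_(i <- A) g i <= M.

(** A finite set whose sum is nearly the supremum of all finite sums leaves only
    a small sum to the indices outside it. *)
Lemma bsum_tail (I : choiceType) (g : I -> R) : (forall i, 0 <= g i) ->
  bsum g -> forall e : R, 0 < e -> exists A0 : {fset I},
    forall A : {fset I}, (A0 `<=` A)%fset ->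
      \sum_(i <- (A `\` A0)%fset) g i < e.
Proof.
move=> g0 [M gM] e e0.
pose S := [set x | exists A : {fset I}, x = \sum_(i <- A) g i].
have hS : has_sup S.
  split; first by exists (\sum_(i <- fset0) g i); exists fset0.
  by exists M => _ [A ->].
have [_ [A0 ->] A0P] := sup_adherent e0 hS.
exists A0 => A AA0.
have : \sum_(i <- A) g i <= sup S by apply: (sup_upper_bound hS); exists A.
by rewrite (big_fset_split _ _ AA0) /=; lra.
Qed.

Lemma bsum_le (I : choiceType) (f g : I -> R) :
  (forall i, f i <= g i) -> bsum g -> bsum f.
Proof.
move=> fg [M gM]; exists M => A; apply: le_trans (gM A).
by apply: ler_sum => i _; exact: fg.
Qed.

Lemma bsumZ (I : choiceType) (g : I -> R) (c : R) :
  0 <= c -> bsum g -> bsum (fun i => c * g i).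
Proof.
by move=> c0 [M gM]; exists (c * M) => A; rewrite -mulr_sumr ler_wpM2l.
Qed.

Lemma bsumD (I : choiceType) (f g : I -> R) :
  bsum f -> bsum g -> bsum (fun i => f i + g i).
Proof.
by move=> [M fM] [N gN]; exists (M + N) => A; rewrite big_split lerD.
Qed.

Lemma big_fset_uniq (T : Type) (idx : T) (op : Monoid.com_law idx)
    (I : choiceType) (s : seq I) (f : I -> T) : uniq s ->
  \big[op/idx]_(i <- [fset i in s]%fset) f i = \big[op/idx]_(i <- s) f i.
Proof.
move=> us; apply/perm_big/uniq_perm => //.
by move=> i; rewrite !inE.
Qed.

Lemma ler_sum_sub (I : choiceType) (g : I -> R) (s t : seq I) :
  (forall i, 0 <= g i) -> uniq s -> uniq t -> {subset s <= t} ->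
  \sum_(i <- s) g i <= \sum_(i <- t) g i.
Proof.
move=> g0 us ut st; rewrite -(big_fset_uniq _ _ us) -(big_fset_uniq _ _ ut).
have AB : ([fset i in s] `<=` [fset i in t])%fset.
  by apply/fsubsetP => i; rewrite !inE => /st.
by rewrite (big_fset_split _ _ AB) /= lerDl sumr_ge0.
Qed.

Lemma bsum_reindex (I J : choiceType) (b : pred J) (e : J -> I)
    (f : I -> R) (g : J -> R) : 
  {in b &, injective e} -> (forall j, ~~ b j -> g j <= 0) ->
  (forall j, b j -> g j <= f (e j)) -> bsum f -> bsum g.
Proof.
move=> inje gN gf [M fM]; exists M => B.
rewrite (bigID b) /=; apply: (@le_trans _ _ (\sum_(j <- B | b j) f (e j))).
  rewrite -[leRHS]addr0 lerD //; first exact: ler_sum.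
  by apply: sumr_le0 => j /gN.
rewrite -big_filter -(big_map e xpredT) -big_fset_uniq //.
rewrite map_inj_in_uniq ?filter_uniq ?fset_uniq // => j k.
by rewrite !mem_filter => /andP[bj _] /andP[bk _]; exact: inje.
Qed.

Lemma bsum_prod (I J : choiceType) (f : I -> R) (g : J -> R) :
  (forall i, 0 <= f i) -> (forall j, 0 <= g j) -> bsum f -> bsum g ->
  bsum (fun p : I * J => f p.1 * g p.2).
Proof.
move=> f0 g0 [M fM] [N gN]; exists (M * N) => A.
pose A1 := [fset p.1 | p in A]%fset; pose A2 := [fset p.2 | p in A]%fset.
apply: (@le_trans _ _ ((\sum_(i <- A1) f i) * (\sum_(j <- A2) g j))); last first.
  by apply: ler_pM => //; apply: sumr_ge0.
rewrite big_distrlr /= -(@big_allpairs R 0 +%R I J A1 A2 (fun p => f p.1 * g p.2)).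
apply: ler_sum_sub.
- by move=> p; rewrite mulr_ge0.
- exact: fset_uniq.
- by apply: allpairs_uniq => // -[? ?] [? ?].
- move=> [i j] ijA; apply/allpairsP; exists (i, j); split => //.
    by apply/imfsetP; exists (i, j).
  by apply/imfsetP; exists (i, j).
Qed.

Lemma bsum_nat (g : nat -> R) M : (forall n, 0 <= g n) ->
  (forall n, \sum_(0 <= k < n) g k <= M) -> bsum g.
Proof.
move=> g0 gM; exists M => A; apply: le_trans (gM (\max_(i <- A) i).+1).
apply: ler_sum_sub => // [|i iA]; first exact: iota_uniq.
by rewrite mem_index_iota /= ltnS; apply: leq_bigmax_seq.
Qed.
End ComplexAnalysis.

(** * Unconditional sums and products of complex numbers *)

Section Unconditional.
Variable R : realType.
Local Notation C := R[i].
Local Notation nc := ComplexField.Normc.normc.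

Definition has_sum (I : choiceType) (f : I -> C) (L : C) : Prop :=
  has_big (T := C) +%R f L.
Definition has_prod (I : choiceType) (f : I -> C) (L : C) : Prop :=
  has_big (T := C) *%R f L.

Lemma expRB1_leM (t : R) : expR t - 1 <= t * expR t.
Proof.
have := expR_ge1Dx (- t); rewrite expRN => H.
have e0 := expR_gt0 t.
by have := ler_wpM2r (ltW e0) H; rewrite mulVf ?gt_eqF // mulrDl; lra.
Qed.

Lemma nc_prod_le (I : Type) (s : seq I) (a : I -> C) :
  nc (\prod_(i <- s) (1 + a i)) <= expR (\sum_(i <- s) nc (a i)).
Proof.
elim: s => [|i s IH]; first by rewrite !big_nil nc1 expR0.
rewrite !big_cons ncM expRD ler_pM ?nc_ge0 //.
by apply: le_trans (ncD _ _) _; rewrite nc1 expR_ge1Dx.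
Qed.

Lemma nc_prodB1_le (I : Type) (s : seq I) (a : I -> C) :
  nc (\prod_(i <- s) (1 + a i) - 1) <= expR (\sum_(i <- s) nc (a i)) - 1.
Proof.
elim: s => [|i s IH]; first by rewrite !big_nil subrr nc0 expR0 subrr.
rewrite !big_cons.
set P := \prod_(_ <- _) _ in IH *; set S := \sum_(_ <- _) _ in IH *.
have -> : (1 + a i) * P - 1 = (P - 1) + a i * P by ring.
apply: le_trans (ncD _ _) _; rewrite ncM.
have := nc_prod_le s a; rewrite -/P -/S => PS.
have := ler_wpM2l (nc_ge0 (a i)) PS.
rewrite expRD; have := ler_wpM2r (ltW (expR_gt0 S)) (expR_ge1Dx (nc (a i))).
by rewrite mulrDl mul1r; lra.
Qed.

(** A product of factors near 1 stays away from 0 as soon as the total deviation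
    is less than 1, by the Weierstrass inequality. *)
Lemma nc_prod_ge (I : Type) (s : seq I) (a : I -> C) :
  1 - \sum_(i <- s) nc (a i) <= nc (\prod_(i <- s) (1 + a i)).
Proof.
have S0 t : 0 <= \sum_(i <- t) nc (a i) by apply: sumr_ge0 => i _; exact: nc_ge0.
elim: s => [|i s IH]; first by rewrite !big_nil nc1 subr0.
rewrite !big_cons ncM.
have [big|small] := lerP 1 (nc (a i) + \sum_(i <- s) nc (a i)).
  by apply: (@le_trans _ _ 0); [lra|rewrite mulr_ge0 ?nc_ge0].
have Sp := S0 s; have a0 := nc_ge0 (a i).
have a1 : 1 - nc (a i) <= nc (1 + a i).
  have := ncB (1 + a i) (a i); rewrite addrK nc1; lra.
apply: le_trans (ler_pM _ _ a1 IH); [|lra|lra].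
set S := \sum_(_ <- _) _ in Sp *; have : 0 <= nc (a i) * S by rewrite mulr_ge0.
lra.
Qed.

Lemma cvg_nc_le (X : Type) (F : set_system X) {FF : ProperFilter F} (f : X -> C)
    (l c : C) (M : R) :
  f @ F --> l -> (\forall x \near F, nc (f x - c) <= M) -> nc (l - c) <= M.
Proof.
move=> /cvgCP fl fM; apply/ler_addgt0Pr => e e0.
have [x [xM xl]] : exists x, nc (f x - c) <= M /\ nc (f x - l) < e.
  exact: (@filter_ex _ F FF _ (filterI fM (fl e e0))).
have -> : l - c = (f x - c) - (f x - l) by ring.
by apply: le_trans (ncB _ _) _; rewrite lerD // ltW.
Qed.

Lemma bsum_has_sum (I : choiceType) (f : I -> C) :
  bsum (fun i => nc (f i)) -> exists L, has_sum f L.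
Proof.
move=> bf; apply: cauchyC => e e0.
have [A0 A0P] := bsum_tail (fun i => nc_ge0 (f i)) bf e0.
exists (\sum_(i <- A0) f i); exists A0 => // A /= A0A.
rewrite (big_fset_split _ _ A0A) /= addrAC subrr add0r.
exact: le_lt_trans (nc_sum _ _) (A0P _ A0A).
Qed.

Lemma has_prod_bound (I : choiceType) (a : I -> C) L M :
  has_prod (fun i => 1 + a i) L ->
  (forall A : {fset I}, \sum_(i <- A) nc (a i) <= M) ->
  nc (L - 1) <= M * expR M.
Proof.
move=> fL fM; apply: cvg_nc_le fL _.
apply: nearW => A; apply: le_trans (nc_prodB1_le _ _) _.
apply: le_trans (expRB1_leM M); rewrite lerD2r ler_expR; exact: fM.
Qed.

(** The Cauchy estimate for products: [A0] depends on the majorant [g] only, hence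
    serves all families dominated by [g] at once. This uniformity is what makes
    the dominated convergence theorem for products work. *)
Lemma prod_tail (I : choiceType) (g : I -> R) : (forall i, 0 <= g i) ->
  bsum g -> forall e : R, 0 < e -> exists A0 : {fset I},
    forall (a : I -> C) (A : {fset I}), (forall i, nc (a i) <= g i) ->
     (A0 `<=` A)%fset ->
      nc (\prod_(i <- A) (1 + a i) - \prod_(i <- A0) (1 + a i)) < e.
Proof.
move=> g0 bg e e0; have [M gM] := bg.
have M0 : 0 <= M by have := gM fset0; rewrite big_seq_fset0.
have E0 := expR_gt0 M.
have d0 : 0 < e / (expR M * expR M) by rewrite divr_gt0 // mulr_gt0.
have [A0 A0P] := bsum_tail g0 bg d0.
exists A0 => a A ag A0A.
rewrite (big_fset_split _ _ A0A) /= -[X in _ - X]mulr1 -mulrBr ncM.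
set D := (A `\` A0)%fset in A0P *.
have le1 (B : {fset I}) : \sum_(i <- B) nc (a i) <= \sum_(i <- B) g i.
  by apply: ler_sum => i _; exact: ag.
apply: le_lt_trans (ler_pM (nc_ge0 _) (nc_ge0 _) (nc_prod_le _ _) (nc_prodB1_le _ _)) _.
set S := \sum_(i <- D) _.
have SD : S <= \sum_(i <- D) g i by exact: le1.
have SM : S <= M by apply: le_trans SD (gM _).
have St := le_lt_trans SD (A0P _ A0A).
have S0 : 0 <= S by apply: sumr_ge0 => i _; exact: nc_ge0.
apply: (@le_lt_trans _ _ (expR M * (S * expR M))); last first.
  by rewrite mulrCA mulrC -ltr_pdivlMl ?mulr_gt0 // mulrC.
apply: ler_pM.
- exact: ltW (expR_gt0 _).
- by rewrite subr_ge0 -expR0 ler_expR.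
- by rewrite ler_expR; apply: le_trans (le1 _) (gM _).
- apply: le_trans (expRB1_leM S) _.
  by rewrite ler_wpM2l // ler_expR.
Qed.

Lemma bsum_has_prod (I : choiceType) (f : I -> C) :
  bsum (fun i => nc (f i - 1)) -> exists L, has_prod f L.
Proof.
move=> bf; apply: cauchyC => e e0.
have [A0 A0P] := prod_tail (fun i => nc_ge0 (f i - 1)) bf e0.
exists (\prod_(i <- A0) f i); exists A0 => // A /= A0A.
have E (B : {fset I}) : \prod_(i <- B) f i = \prod_(i <- B) (1 + (f i - 1)).
  by apply: eq_bigr => i _; rewrite addrC subrK.
by rewrite (E A) (E A0); apply: A0P.
Qed.

(** Outside a finite set the deviations from 1 add up to at most 1/2, so the
    remaining product has modulus at least 1/2; the finite part has no zero. *)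
Lemma has_prod_neq0 (I : choiceType) (f : I -> C) L :
  bsum (fun i => nc (f i - 1)) -> (forall i, f i != 0) -> has_prod f L -> L != 0.
Proof.
move=> bf f0 fL.
have e0 : (0 : R) < 1 / 2 by lra.
have [A0 A0P] := bsum_tail (fun i => nc_ge0 (f i - 1)) bf e0.
pose P0 := \prod_(i <- A0) f i.
have P0n : 0 < nc P0 by rewrite nc_gt0 prodf_seq_neq0; apply/allP => i _ /=.
have e1 : 0 < nc P0 / 4 by rewrite divr_gt0.
apply/eqP => L0; move: fL; rewrite L0 => /cvgCP /(_ _ e1) [A1 _ A1P].
have := A1P (A0 `|` A1)%fset (fsubsetUr _ _); rewrite subr0 /=.
rewrite (big_fset_split _ _ (fsubsetUl A0 A1)) /= -/P0 ncM.
have := A0P _ (fsubsetUl A0 A1).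
set D := ((A0 `|` A1) `\` A0)%fset => HD.
have := nc_prod_ge D (fun i => f i - 1).
have -> : \prod_(i <- D) (1 + (f i - 1)) = \prod_(i <- D) f i.
  by apply: eq_bigr => i _; rewrite addrC subrK.
move=> H; have : nc P0 * (1/2) <= nc P0 * nc (\prod_(i <- D) f i).
  by rewrite ler_pM2l //; lra.
lra.
Qed.

Lemma has_sum_fin (I : choiceType) (f : I -> C) (A : {fset I}) :
  (forall i, i \notin A -> f i = 0) -> has_sum f (\sum_(i <- A) f i).
Proof. exact: (@has_big_fin C 0 +%R). Qed.

Lemma has_prod_fin (I : choiceType) (f : I -> C) (A : {fset I}) :
  (forall i, i \notin A -> f i = 1) -> has_prod f (\prod_(i <- A) f i).
Proof. exact: (@has_big_fin C 1 *%R). Qed.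

Lemma has_prodV (I : choiceType) (f : I -> C) L :
  L != 0 -> has_prod f L -> has_prod (fun i => (f i)^-1) L^-1.
Proof.
move=> L0 fL; rewrite /has_prod /has_big.
under eq_cvg do rewrite /= prodfV.
exact: cvgV.
Qed.

Lemma has_sumZ (I : choiceType) (f : I -> C) L c :
  has_sum f L -> has_sum (fun i => c * f i) (c * L).
Proof.
move=> fL; rewrite /has_sum /has_big.
under eq_cvg do rewrite /= -mulr_sumr.
by apply: cvgM fL; exact: cvg_cst.
Qed.

Lemma has_sumD (I : choiceType) (f g : I -> C) L M :
  has_sum f L -> has_sum g M -> has_sum (fun i => f i + g i) (L + M).
Proof. exact: (@has_big_mul C 0 +%R (@addC_continuous R)). Qed.

Lemma has_prodM (I : choiceType) (f g : I -> C) L M :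
  has_prod f L -> has_prod g M -> has_prod (fun i => f i * g i) (L * M).
Proof. exact: (@has_big_mul C 1 *%R (@mulC_continuous R)). Qed.

Lemma eq_has_sum (I : choiceType) (f g : I -> C) L :
  f =1 g -> has_sum f L -> has_sum g L.
Proof. by move=> /funext ->. Qed.

Lemma eq_has_prod (I : choiceType) (f g : I -> C) L :
  f =1 g -> has_prod f L -> has_prod g L.
Proof. by move=> /funext ->. Qed.

Lemma has_sum_unique (I : choiceType) (f : I -> C) L M :
  has_sum f L -> has_sum f M -> L = M.
Proof. exact: (@has_big_unique C 0 +%R (@hausdorffC R)). Qed.

Lemma has_prod_unique (I : choiceType) (f : I -> C) L M :
  has_prod f L -> has_prod f M -> L = M.
Proof. exact: (@has_big_unique C 1 *%R (@hausdorffC R)). Qed.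

Lemma has_prod_one (I : choiceType) (f : I -> C) :
  (forall i, f i = 1) -> has_prod f 1.
Proof.
move=> f1; have E : \prod_(i <- (fset0 : {fset I})) f i = 1 by rewrite big_seq_fset0.
by rewrite -[X in has_prod _ X]E; apply: has_prod_fin => i _; exact: f1.
Qed.

Lemma has_prod_zero (I : choiceType) (f : I -> C) L i :
  f i = 0 -> has_prod f L -> L = 0.
Proof.
move=> fi fL; apply: (has_prod_unique fL).
move=> U U0; exists [fset i]%fset => // A /= iA.
suff -> : \prod_(j <- A) f j = 0 by exact: (nbhs_singleton U0).
apply/eqP; rewrite prodf_seq_eq0; apply/hasP; exists i; last by rewrite /= fi.
by apply: (fsubsetP iA); rewrite inE.
Qed.

Lemma has_sum_fubini (I J : choiceType) (f : I * J -> C) (r : I -> C) L :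
  has_sum f L -> (forall i, has_sum (fun j => f (i, j)) (r i)) -> has_sum r L.
Proof. exact: (@has_big_fubini C 0 +%R (@addC_continuous R)). Qed.

Lemma has_prod_fubini (I J : choiceType) (f : I * J -> C) (r : I -> C) L :
  has_prod f L -> (forall i, has_prod (fun j => f (i, j)) (r i)) -> has_prod r L.
Proof. exact: (@has_big_fubini C 1 *%R (@mulC_continuous R)). Qed.

(** The double family is summable by domination, and Fubini evaluates its sum. *)
Lemma has_sum_mul (I J : choiceType) (f : I -> C) (g : J -> C) L M :
  bsum (fun i => nc (f i)) -> bsum (fun j => nc (g j)) ->
  has_sum f L -> has_sum g M -> has_sum (fun p : I * J => f p.1 * g p.2) (L * M).
Proof.
move=> bf bg fL gM.
have [S fgS] : exists S, has_sum (fun p : I * J => f p.1 * g p.2) S.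
  apply: bsum_has_sum; apply: bsum_le (bsum_prod _ _ bf bg).
  - by move=> p; rewrite ncM.
  - by move=> i; exact: nc_ge0.
  - by move=> i; exact: nc_ge0.
have H : has_sum (fun i => f i * M) S.
  by apply: has_sum_fubini fgS _ => i /=; exact: has_sumZ.
have H' : has_sum (fun i => f i * M) (L * M).
  rewrite [L * M]mulrC; apply: (eq_has_sum _ (has_sumZ (c := M) fL)) => i.
  exact: mulrC.
by rewrite (has_sum_unique H' H).
Qed.

Section Tannery.
Context {X : Type} {F : set_system X} {FF : ProperFilter F} {I : choiceType}.
Variables (f : X -> I -> C) (f0 : I -> C).
Hypothesis f_cvg : forall i, f x i @[x --> F] --> f0 i.

(** Dominated convergence for sums and products at the same time: if finitely
    many indices determine the value up to [e], uniformly in the parameter,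
    then the termwise limit passes through. The tail condition is supplied
    by [bsum_tail] for sums and by [prod_tail] for products. *)
Lemma tannery (op : C -> C -> C) (idx : C) (L : X -> C) (L0 : C) :
  continuous (fun x : C * C => op x.1 x.2) ->
  (forall e : R, 0 < e -> exists A0 : {fset I}, \forall x \near F,
     forall A : {fset I}, (A0 `<=` A)%fset ->
     nc (\big[op/idx]_(i <- A) f x i - \big[op/idx]_(i <- A0) f x i) < e) ->
  (\forall x \near F, \big[op/idx]_(i <- (A : {fset I})) f x i @[A --> totally] --> L x) ->
  \big[op/idx]_(i <- (A : {fset I})) f0 i @[A --> totally] --> L0 ->
  L @ F --> L0.
Proof.
move=> opc tail fL /cvgCP f0L; apply/cvgCP => e e0.
have e5 : 0 < e / 5 by rewrite divr_gt0.
have [A0 A0P] := tail _ e5.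
have [A1' _ A1P] := f0L _ e5.
pose A1 := (A0 `|` A1')%fset.
have A01 : (A0 `<=` A1)%fset by exact: fsubsetUl.
have fin : \big[op/idx]_(i <- A1) f x i @[x --> F] --> \big[op/idx]_(i <- A1) f0 i.
  by apply: cvg_big.
have {}fin := (cvgCP _ _).1 fin _ e5.
near=> x.
have fx : \big[op/idx]_(i <- (A : {fset I})) f x i @[A --> totally] --> L x.
  by near: x.
have Lx : nc (L x - \big[op/idx]_(i <- A0) f x i) <= e / 5.
  apply: cvg_nc_le fx _; exists A0 => // A /= A0A; apply: ltW.
  by move: A A0A; near: x.
have H1 : nc (\big[op/idx]_(i <- A1) f x i - \big[op/idx]_(i <- A0) f x i) < e / 5.
  by move: (A1) A01; near: x.
have H2 : nc (\big[op/idx]_(i <- A1) f x i - \big[op/idx]_(i <- A1) f0 i) < e / 5.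
  by near: x; exact: fin.
have H3 : nc (\big[op/idx]_(i <- A1) f0 i - L0) < e / 5.
  by apply: A1P; exact: fsubsetUr.
have -> : L x - L0 = (L x - \big[op/idx]_(i <- A0) f x i)
   - (\big[op/idx]_(i <- A1) f x i - \big[op/idx]_(i <- A0) f x i)
   + (\big[op/idx]_(i <- A1) f x i - \big[op/idx]_(i <- A1) f0 i)
   + (\big[op/idx]_(i <- A1) f0 i - L0) by ring.
apply: le_lt_trans (ncD _ _) _.
have := ncD (L x - \big[op/idx]_(i <- A0) f x i
   - (\big[op/idx]_(i <- A1) f x i - \big[op/idx]_(i <- A0) f x i))
    (\big[op/idx]_(i <- A1) f x i - \big[op/idx]_(i <- A1) f0 i).
have := ncB (L x - \big[op/idx]_(i <- A0) f x i)
   (\big[op/idx]_(i <- A1) f x i - \big[op/idx]_(i <- A0) f x i).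
lra.
Unshelve. all: by end_near. Qed.

Variable g : I -> R.
Hypothesis g0 : forall i, 0 <= g i.
Hypothesis bg : bsum g.

Lemma tannery_sum (L : X -> C) (L0 : C) :
  (\forall x \near F, forall i, nc (f x i) <= g i) ->
  (\forall x \near F, has_sum (f x) (L x)) -> has_sum f0 L0 ->
  L @ F --> L0.
Proof.
move=> fg; apply: tannery; first exact: addC_continuous.
move=> e e0; have [A0 A0P] := bsum_tail g0 bg e0.
exists A0; near=> x => A A0A.
rewrite (big_fset_split _ _ A0A) /= addrAC subrr add0r.
apply: le_lt_trans (nc_sum _ _) _; apply: le_lt_trans (A0P _ A0A).
by apply: ler_sum => i _; move: i; near: x.
Unshelve. all: by end_near. Qed.

Lemma tannery_prod (L : X -> C) (L0 : C) :
  (\forall x \near F, forall i, nc (f x i - 1) <= g i) ->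
  (\forall x \near F, has_prod (f x) (L x)) -> has_prod f0 L0 ->
  L @ F --> L0.
Proof.
move=> fg; apply: tannery; first exact: mulC_continuous.
move=> e e0; have [A0 A0P] := prod_tail g0 bg e0.
exists A0; near=> x => A A0A.
have E (B : {fset I}) : \prod_(i <- B) f x i = \prod_(i <- B) (1 + (f x i - 1)).
  by apply: eq_bigr => i _; rewrite addrC subrK.
rewrite (E A) (E A0); apply: A0P A0A.
by near: x.
Unshelve. all: by end_near. Qed.
End Tannery.
End Unconditional.

(** * The complex exponential *)

Section ComplexExp.
Variable R : realType.
Local Notation C := R[i].
Local Notation nc := ComplexField.Normc.normc.

(** Mean value theorem between 0 and [x] without a hypothesis on the sign of [x],
    so that the estimates below need no case distinction. *)
Lemma mvt_global (f df : R -> R) (x : R) :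
  (forall t, is_derive t (1 : R) f (df t)) ->
  exists c, [/\ `|c| <= `|x|, 0 <= c * x & f x - f 0 = df c * x].
Proof.
move=> fd.
have fc (A : set R) : {within A, continuous f}.
  apply: continuous_subspaceT => t; apply: differentiable_continuous.
  by apply/derivable1_diffP; have [] := fd t.
have [x0|x0] := lerP 0 x.
  have [c] := MVT_segment x0 (fun t _ => fd t) (fc _).
  rewrite in_itv /= subr0 => /andP[c0 cx] E; exists c; split => //.
    by rewrite !ger0_norm.
  by rewrite mulr_ge0.
have [c] := MVT_segment (ltW x0) (fun t _ => fd t) (fc _).
rewrite in_itv /= sub0r => /andP[xc c0] E; exists c; split => //.
- by rewrite !ler0_norm ?lerN2 // ltW.
- by rewrite mulr_le0 // ltW.
- by rewrite -opprB E mulrN opprK.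
Qed.

Lemma sin_le_norm (x : R) : `|sin x| <= `|x|.
Proof.
have [c [_ _]] := mvt_global x (@is_derive_sin R).
rewrite sin0 subr0 => ->; rewrite normrM -[leRHS]mul1r.
by rewrite ler_wpM2r // cos_max.
Qed.

Lemma cosB1_sin (x : R) : cos x - 1 = - (sin (x / 2) ^+ 2 *+ 2).
Proof.
have {1}-> : x = x / 2 *+ 2 by rewrite -mulr_natr divfK // pnatr_eq0.
have := cos2Dsin2 (x / 2); rewrite cos_mulr2n => H.
lra.
Qed.

Lemma cosB1_le_norm (x : R) : `|cos x - 1| <= `|x|.
Proof.
rewrite cosB1_sin normrN normrMn normrX.
have := sin_le_norm (x / 2); have := sin_max (x / 2).
rewrite normrM (ger0_norm (_ : 0 <= 2^-1)) //.
have := normr_ge0 (sin (x / 2)); set s := `|sin _|; rewrite expr2.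
move=> s0 s1 sx; have : 0 <= s * (1 - s) by rewrite mulr_ge0 // subr_ge0.
lra.
Qed.

Lemma cosB1_le_sqr (x : R) : `|cos x - 1| <= `|x| ^+ 2.
Proof.
rewrite cosB1_sin normrN normrMn normrX.
have := sin_le_norm (x / 2).
rewrite normrM (ger0_norm (_ : 0 <= 2^-1)) //.
have := normr_ge0 (sin (x / 2)); set s := `|sin _|; rewrite !expr2.
move=> s0 sx; have := ler_pM s0 s0 sx sx; have := sqr_ge0 `|x|; rewrite expr2; lra.
Qed.

Lemma sinB_le_sqr (x : R) : `|sin x - x| <= `|x| ^+ 2.
Proof.
have [c [cx _]] := mvt_global x (@is_derive_sin R).
rewrite sin0 subr0 => ->.
have -> : cos c * x - x = (cos c - 1) * x by ring.
rewrite normrM expr2 ler_wpM2r //.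
exact: le_trans (cosB1_le_norm _) cx.
Qed.

(** A weak form of Jordan's inequality. Halving the angle brings it into a range
    where both cosines in sin x = 2 sin (x/2) cos (x/2), after the mean value
    theorem, have square at least 1/2. *)
Lemma sin_ge_half (x : R) : 0 <= x <= pi / 2 -> x / 2 <= sin x.
Proof.
move=> /andP[x0 xpi]; set y := x / 2.
have xy : x = y *+ 2 by rewrite /y -mulr_natr divfK // pnatr_eq0.
have y0 : 0 <= y by rewrite divr_ge0.
have y4 : y <= pi / 4 by rewrite /y; lra.
have p0 := pi_ge0 R.
have cosP (t : R) : 0 <= t <= y -> 0 <= cos t /\ 1 / 2 <= cos t ^+ 2.
  move=> /andP[t0 ty]; split.
    by apply: cos_ge0_pihalf; apply/andP; split; lra.
  have : 0 <= cos (t *+ 2).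
    by apply: cos_ge0_pihalf; apply/andP; split; lra.
  by rewrite cos_mulr2n; lra.
have [c [cy cy0 sy]] := mvt_global y (@is_derive_sin R).
rewrite sin0 subr0 in sy.
have sc : cos c * cos y * 2 * y = sin x.
  by rewrite xy sin_mulr2n sy mulr2n; ring.
have [Hy1 Hy2] := cosP y (introT andP (conj y0 (lexx y))).
have [Hc1 Hc2] : 0 <= cos c /\ 1 / 2 <= cos c ^+ 2.
  have -> : cos c = cos `|c| by case: (ler0P c); rewrite ?cosN.
  by apply: cosP; rewrite normr_ge0 -[leRHS]ger0_norm.
have H : 1 / 2 <= cos c * cos y.
  have p0' : 0 <= cos c * cos y by rewrite mulr_ge0.
  have : 0 <= (cos c ^+ 2 - 1 / 2) * cos y ^+ 2.
    by rewrite mulr_ge0 ?sqr_ge0 // subr_ge0.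
  rewrite mulrBl -exprMn => p2; rewrite leNgt; apply/negP => p1.
  by have : (cos c * cos y) ^+ 2 < 1 / 4; [rewrite expr2; nra|lra].
rewrite -sc; have : 0 <= (cos c * cos y - 1 / 2) * y by rewrite mulr_ge0 // subr_ge0.
lra.
Qed.

Lemma cexpD (x y : C) : cexp (x + y) = cexp x * cexp y.
Proof.
case: x y => [a b] [c d]; rewrite /cexp /= expRD cosD sinD.
by apply/eqP; rewrite eq_complex /=; apply/andP; split; apply/eqP; ring.
Qed.

Lemma cexp0 : cexp (0 : C) = 1.
Proof.
by rewrite /cexp /= expR0 cos0 sin0 mul1r.
Qed.

Lemma nc_cexp (x : C) : nc (cexp x) = expR (complex.Re x).
Proof.
rewrite /cexp ncM nc_real ger0_norm ?expR_ge0 //=.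
by rewrite cos2Dsin2 sqrtr1 mulr1.
Qed.

Lemma cexp_neq0 (x : C) : cexp x != 0.
Proof. by rewrite -nc_gt0 nc_cexp expR_gt0. Qed.

Lemma cexpN (x : C) : cexp (- x) = (cexp x)^-1.
Proof.
by apply: (mulfI (cexp_neq0 x)); rewrite -cexpD subrr cexp0 divff ?cexp_neq0.
Qed.

Lemma cexpMn (x : C) n : cexp (n%:R * x) = cexp x ^+ n.
Proof.
elim: n => [|n IH]; first by rewrite mul0r cexp0.
by rewrite -natr1 mulrDl mul1r cexpD IH exprSr.
Qed.

Lemma cexpMz (x : C) (n : int) : cexp (n%:~R * x) = cexp x ^ n.
Proof.
case: n => n; first exact: cexpMn.
rewrite [in LHS]NegzE mulrNz mulNr cexpN; congr _^-1; exact: cexpMn.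
Qed.

Lemma cexp_sum (I : Type) (s : seq I) (f : I -> C) :
  cexp (\sum_(i <- s) f i) = \prod_(i <- s) cexp (f i).
Proof.
elim: s => [|i s IH]; first by rewrite !big_nil cexp0.
by rewrite !big_cons cexpD IH.
Qed.

Lemma expRB1_le (x : R) : `|expR x - 1| <= `|x| * expR `|x|.
Proof.
have H := expRB1_leM x; have H2 := expR_ge1Dx x.
have H3 : expR x <= expR `|x| by rewrite ler_expR ler_norm.
have H4 : 1 <= expR `|x| by rewrite -expR0 ler_expR.
have [x0|x0] := lerP 0 x.
  rewrite (ger0_norm x0) ger0_norm //; lra.
rewrite ltr0_norm // in H4 *; rewrite ler0_norm; last by rewrite subr_le0 -expR0 ler_expR ltW.
by nra.
Qed.

Lemma expRB1B_le (x : R) : `|expR x - 1 - x| <= `|x| ^+ 2 * expR `|x|.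
Proof.
have H := expRB1_leM x; have H2 := expR_ge1Dx x.
have H5 := expRB1_le x.
rewrite ger0_norm; last by lra.
apply: (@le_trans _ _ (x * (expR x - 1))); first by rewrite mulrBr; lra.
apply: le_trans (ler_norm _) _; rewrite normrM expr2 -mulrA.
by rewrite ler_wpM2l.
Qed.

Lemma nc_cexpB1B_le (y : C) :
  nc (cexp y - 1 - y) <= 4 * nc y ^+ 2 * expR (nc y).
Proof.
case: y => [x v]; set r := nc (x +i* v).
have xr : `|x| <= r := nc_Re (x +i* v).
have vr : `|v| <= r := nc_Im (x +i* v).
have r0 : 0 <= r := nc_ge0 _.
have Ex : expR `|x| <= expR r by rewrite ler_expR.
have E0 := expR_gt0 `|x|.
have E1 : expR x <= expR r by rewrite ler_expR (le_trans (ler_norm x)).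
have E2 : 1 <= expR r by rewrite -expR0 ler_expR.
have Ep := expR_gt0 x.
have sq : `|x| ^+ 2 <= r ^+ 2 by rewrite lerXn2r ?nnegrE.
have sqv : `|v| ^+ 2 <= r ^+ 2 by rewrite lerXn2r ?nnegrE.
have xv : `|x| * `|v| <= r ^+ 2 by rewrite expr2 ler_pM.
have r2 : 0 <= r ^+ 2 by rewrite exprn_ge0.
apply: le_trans (nc_ReIm _) _; rewrite /cexp /= !mul0r subr0 addr0 !subr0.
have -> : expR x * cos v - 1 - x = (expR x - 1 - x) + expR x * (cos v - 1) by ring.
have -> : expR x * sin v - v = expR x * (sin v - v) + (expR x - 1) * v by ring.
have H1 : `|expR x - 1 - x| <= r ^+ 2 * expR r.
  by apply: le_trans (expRB1B_le x) _; rewrite ler_pM // ?exprn_ge0 // ltW.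
have H2 : `|expR x * (cos v - 1)| <= r ^+ 2 * expR r.
  rewrite normrM mulrC ler_pM // ?(le_trans (cosB1_le_sqr v)) //.
  by rewrite ger0_norm // ltW.
have H3 : `|expR x * (sin v - v)| <= r ^+ 2 * expR r.
  rewrite normrM mulrC ler_pM // ?(le_trans (sinB_le_sqr v)) //.
  by rewrite ger0_norm // ltW.
have H4 : `|(expR x - 1) * v| <= r ^+ 2 * expR r.
  rewrite normrM; apply: le_trans (ler_wpM2r (normr_ge0 v) (expRB1_le x)) _.
  by rewrite mulrAC ler_pM // ?mulr_ge0 // ltW.
have := ler_normD (expR x - 1 - x) (expR x * (cos v - 1)).
have := ler_normD (expR x * (sin v - v)) ((expR x - 1) * v).
move: H1 H2 H3 H4; lra.
Qed.

Lemma nc_cexpB1_le (y : C) :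
  nc (cexp y - 1) <= nc y * (1 + 4 * nc y * expR (nc y)).
Proof.
have -> : cexp y - 1 = (cexp y - 1 - y) + y by ring.
apply: le_trans (ncD _ _) _.
have -> : nc y * (1 + 4 * nc y * expR (nc y)) = 4 * nc y ^+ 2 * expR (nc y) + nc y by ring.
by rewrite lerD2r nc_cexpB1B_le.
Qed.

Lemma cvg_cexp (X : Type) (F : set_system X) {FF : Filter F} (f : X -> C) (l : C) :
  f @ F --> l -> cexp (f x) @[x --> F] --> cexp l.
Proof.
move=> fl; rewrite /cexp.
have fre : complex.Re (f x) @[x --> F] --> complex.Re l by exact: cvg_Re.
have fim : complex.Im (f x) @[x --> F] --> complex.Im l by exact: cvg_Im.
apply: cvgM.
  by apply: cvg_realC; apply: (cvg_comp _ _ fre); exact: continuous_expR.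
apply: cvg_ReIm => /=.
  by apply: (cvg_comp _ _ fim); exact: continuous_cos.
by apply: (cvg_comp _ _ fim); exact: continuous_sin.
Qed.

Lemma has_prod_cexp (I : choiceType) (f : I -> C) L :
  has_sum f L -> has_prod (fun i => cexp (f i)) (cexp L).
Proof.
move=> fL; rewrite /has_prod /has_big.
under eq_cvg do rewrite /= -cexp_sum.
exact: cvg_cexp.
Qed.
End ComplexExp.

(** * Euler's product for the sine *)

Section SineProduct.
Variable R : realType.
Local Notation C := R[i].
Local Notation nc := ComplexField.Normc.normc.

Definition ccosh (v : C) : C := (cexp v + cexp (- v)) / 2.
(** sinh v / v, with its removable singularity filled in; at w = 4 v^2 its
    inverse is the characteristic power series of the A-hat genus. *)
Definition shc (v : C) : C := if v == 0 then 1 else csinh v / v.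

Lemma csinhE (v : C) : csinh v = v * shc v.
Proof.
rewrite /shc; case: eqVneq => [->|v0]; last by rewrite mulrC divfK.
by rewrite /csinh oppr0 subrr !mul0r.
Qed.

Lemma csinhN (v : C) : csinh (- v) = - csinh v.
Proof. by rewrite /csinh opprK; field. Qed.

Lemma csinh2 (v : C) : csinh (2 * v) = 2 * csinh v * ccosh v.
Proof.
rewrite /csinh /ccosh -(mulrN 2 v) !cexpMn !cexpN; have := cexp_neq0 v.
by move: (cexp v) => E E0; field.
Qed.

Lemma ccosh2 (v : C) : ccosh (2 * v) = 1 + 2 * csinh v ^+ 2.
Proof.
rewrite /csinh /ccosh -(mulrN 2 v) !cexpMn !cexpN; have := cexp_neq0 v.
by move: (cexp v) => E E0; field.
Qed.

Lemma csinh2_sqr (v : C) :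
  csinh (2 * v) ^+ 2 = 4 * csinh v ^+ 2 * (1 + csinh v ^+ 2).
Proof.
rewrite /csinh -(mulrN 2 v) !cexpMn !cexpN; have := cexp_neq0 v.
by move: (cexp v) => E E0; field.
Qed.

Let sn2 (k n : nat) : R := sin (k%:R * pi / n%:R) ^+ 2.

Lemma sin_pi_gt0 (k n : nat) : (0 < k < n)%N -> 0 < sin (k%:R * pi / n%:R : R).
Proof.
move=> /andP[k0 kn]; apply: sin_gt0_pi.
have n0 : (0 : R) < n%:R by rewrite ltr0n (leq_trans _ kn).
have p0 := pi_gt0 R.
apply/andP; split; first by apply: divr_gt0 => //; apply: mulr_gt0 => //; rewrite ltr0n.
by rewrite ltr_pdivrMr // mulrC ltr_pM2l // ltr_nat.
Qed.

(** As a function of S = sinh^2 v, sinh (n v) / (n sinh v cosh v) is for even n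
    the polynomial with constant term 1 and roots - sin^2 (k pi / n),
    0 < k < n / 2. For n a power of 2 this needs no theory of Chebyshev
    polynomials, only induction on the exponent by the duplication formulas:
    doubling n, the factors with indices k and n - k, whose squared sines add
    up to 1, combine into the old factor of index k evaluated at 2 v. *)
Lemma sinh_prod_dyadic (j : nat) (v : C) :
  csinh ((2 ^ j.+1)%:R * v) = (2 ^ j.+1)%:R * csinh v * ccosh v *
   \prod_(1 <= k < 2 ^ j) (1 + csinh v ^+ 2 / (sn2 k (2 ^ j.+1))%:C).
Proof.
elim: j v => [|j IH] v.
  by rewrite expn0 expn1 big_geq // mulr1 csinh2.
have -> : (2 ^ j.+2)%:R * v = (2 ^ j.+1)%:R * (2 * v) :> C.
  by rewrite (expnS 2 j.+1) natrM mulrA (mulrC 2).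
rewrite IH ccosh2; set X := csinh (2 * v) ^+ 2; rewrite csinh2.
set N := (2 ^ j)%N; set S := csinh v ^+ 2.
have N0 : (0 < N)%N by rewrite expn_gt0.
have E1 : (2 ^ j.+1 = 2 * N)%N by rewrite expnS.
have E2 : (2 ^ j.+2 = 4 * N)%N by rewrite !expnS mulnA.
pose s k : C := (sn2 k (4 * N))%:C.
have NR : (N%:R : R) != 0 by rewrite pnatr_eq0 -lt0n.
have s_n0 k : (0 < k < 4 * N)%N -> s k != 0.
  move=> H; rewrite /s /sn2 rmorphXn /= expf_neq0 //.
  by rewrite (inj_eq (@complexI R)) gt_eqF // sin_pi_gt0.
have s_rev k : (k <= 2 * N)%N -> s (2 * N - k)%N = 1 - s k.
  move=> kN; rewrite /s /sn2 natrB //.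
  have -> : ((2 * N)%:R - k%:R) * pi / (4 * N)%:R =
     - (k%:R * pi / (4 * N)%:R - pi / 2) :> R.
    by rewrite !natrM; field.
  rewrite sinN sqrrN sinBpihalf sqrrN.
  set t := _ / _; have -> : cos t ^+ 2 = 1 - sin t ^+ 2.
    by have := cos2Dsin2 t; lra.
  by rewrite rmorphB /= rmorph1.
have s_dbl k : (sn2 k (2 * N))%:C = 4 * s k * (1 - s k).
  rewrite /s /sn2.
  have -> : k%:R * pi / (2 * N)%:R = (k%:R * pi / (4 * N)%:R) *+ 2 :> R.
    by rewrite !natrM -mulr_natr; field.
  rewrite sin_mulr2n; set t := _ / _.
  have c2 : cos t ^+ 2 = 1 - sin t ^+ 2 by have := cos2Dsin2 t; lra.
  have -> : ((cos t * sin t) *+ 2) ^+ 2 = 4 * sin t ^+ 2 * cos t ^+ 2 :> R by ring.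
  by rewrite c2 rmorphM rmorphM rmorphB rmorph1 rmorph_nat.
rewrite E1 E2.
transitivity ((4 * N)%:R * csinh v * ccosh v * ((1 + 2 * S) *
   \prod_(1 <= k < N) (1 + X / (sn2 k (2 * N))%:C))).
  by rewrite !natrM; ring.
congr (_ * _).
have N2 : (N <= 2 * N)%N by rewrite leq_pmull.
rewrite (big_cat_nat N0 N2) /= (big_ltn (m := N)); last by rewrite mul2n -addnn -addn1 leq_add2l.
have -> : \prod_(N.+1 <= k < 2 * N) (1 + S / s k) =
          \prod_(1 <= k < N) (1 + S / (1 - s k)).
  rewrite big_nat_rev -{1}(add1n N) big_addn.
  have -> : (2 * N - N = N)%N by lia.
  apply: eq_big_nat => k /andP[k1 kN].
  have -> : (N.+1 + 2 * N - (k + N).+1 = 2 * N - k)%N.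
    by lia.
  by rewrite s_rev //; lia.
have sN : s N = 1 / 2.
  have := s_rev N N2; have -> : (2 * N - N = N)%N by lia.
  move=> H; apply: (canRL (mulfK _)); first by rewrite pnatr_eq0.
  by rewrite mulr_natr mulr2n {1}H subrK.
rewrite -/(s N) sN [RHS]mulrCA; congr (_ * _); first by field.
rewrite -big_split /=; apply: eq_big_nat => k /andP[k1 kN].
rewrite s_dbl /X csinh2_sqr -/S -/(s k).
have k4 : (k < 4 * N)%N by rewrite (leq_trans kN) // leq_pmull.
have k2 : (k <= 2 * N)%N by rewrite (leq_trans (ltnW kN)).
have sk0 : s k != 0 by apply: s_n0; rewrite k1.
have sk1 : 1 - s k != 0.
  rewrite -s_rev //; apply: s_n0; rewrite subn_gt0 (leq_trans kN) //=.
  by rewrite (leq_ltn_trans (leq_subr _ _)) // ltn_pmul2r.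
by field; rewrite sk0 sk1.
Qed.

Lemma nc_csinh_le (v : C) : nc (csinh v) <= nc v * (1 + 4 * nc v * expR (nc v)).
Proof.
have -> : csinh v = ((cexp v - 1) - (cexp (- v) - 1)) / 2.
  by rewrite /csinh; congr (_ / _); ring.
rewrite ncM ncV; have -> : nc (2 : C) = 2.
  by rewrite -(rmorph_nat (real_complex R) 2) nc_real ger0_norm.
rewrite ler_pdivrMr //.
apply: le_trans (ncB _ _) _.
have := nc_cexpB1_le v; have := nc_cexpB1_le (- v); rewrite ncN; lra.
Qed.

Lemma nc_csinhB_le (v : C) : nc (csinh v - v) <= 4 * nc v ^+ 2 * expR (nc v).
Proof.
have -> : csinh v - v = ((cexp v - 1 - v) - (cexp (- v) - 1 - (- v))) / 2.
  by rewrite /csinh; field.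
rewrite ncM ncV; have -> : nc (2 : C) = 2.
  by rewrite -(rmorph_nat (real_complex R) 2) nc_real ger0_norm.
rewrite ler_pdivrMr //.
apply: le_trans (ncB _ _) _.
have := nc_cexpB1B_le v; have := nc_cexpB1B_le (- v); rewrite ncN; lra.
Qed.

(** Comparison with the telescoping series of 2 / (k + 1) - 2 / (k + 2). *)
Lemma bsum_inv_sqr : bsum (fun k : nat => (k.+1%:R ^+ 2)^-1 : R).
Proof.
apply: (@bsum_nat _ _ 2) => n; first by rewrite invr_ge0 sqr_ge0.
apply: (@le_trans _ _ (2 - 2 / n.+1%:R)); last by rewrite gerBl divr_ge0.
elim: n => [|n IH]; first by rewrite big_geq // divr1 subrr.
rewrite big_nat_recr //=; apply: le_trans (lerD IH (lexx _)) _.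
have n0 : (0 : R) <= n%:R by [].
rewrite -[n.+2%:R]natr1 -[n.+1%:R]natr1; move: (n%:R : R) n0 => x x0.
rewrite -subr_ge0.
have -> : 2 - 2 / (x + 1 + 1) - (2 - 2 / (x + 1) + ((x + 1) ^+ 2)^-1) =
   x / ((x + 1) ^+ 2 * (x + 2)) 
  by field; do ?[apply/andP; split]; rewrite gt_eqF //; lra.
by rewrite divr_ge0 // mulr_ge0 ?sqr_ge0 //; lra.
Qed.
End SineProduct.

Section SineProductLimit.
Variable R : realType.
Local Notation C := R[i].
Local Notation nc := ComplexField.Normc.normc.

Lemma nc_nat (n : nat) : nc (n%:R : C) = n%:R.
Proof.
by rewrite -(rmorph_nat (real_complex R) n) nc_real ger0_norm.
Qed.

Lemma cvg_half_pow (c : R) : c / (2 ^ j.+1)%:R @[j --> \oo] --> (0 : R).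
Proof.
rewrite -(mulr0 c); apply: cvgM; first exact: cvg_cst.
apply: (@squeeze_cvgr _ _ _ _ (fun=> 0) (@harmonic R)).
- apply: nearW => j; rewrite invr_ge0 ler0n /= lef_pV2 ?posrE ?ltr0n ?expn_gt0 //.
  by rewrite ler_nat ltnW // ltn_expl.
- exact: cvg_cst.
- exact: cvg_harmonic.
Qed.

Lemma cvg_sqr (K : numFieldType) (X : Type) (F : set_system X) {FF : Filter F}
    (f : X -> K) (l : K) : f @ F --> l -> f x ^+ 2 @[x --> F] --> l ^+ 2.
Proof.
move=> fl; rewrite expr2; under eq_cvg do rewrite expr2.
exact: cvgM.
Qed.

Section Limit.
Variable w : C.
Let n (j : nat) : nat := (2 ^ j.+1)%N.

Let n_gt0 j : (0 : R) < (n j)%:R.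
Proof. by rewrite ltr0n expn_gt0. Qed.

Let nC j : (n j)%:R != 0 :> C.
Proof. by rewrite pnatr_eq0 -lt0n expn_gt0. Qed.

Let nc_wn j : nc (w / (n j)%:R) = nc w / (n j)%:R.
Proof. by rewrite ncM ncV nc_nat. Qed.

Let nc_wn_le j : nc (w / (n j)%:R) <= nc w.
Proof.
rewrite nc_wn ler_pdivrMr // ler_peMr ?nc_ge0 //.
by rewrite ler1n expn_gt0.
Qed.

Let cvg_wn : w / (n j)%:R @[j --> \oo] --> (0 : C).
Proof.
apply: (@cvgC_squeeze _ _ _ _ _ (fun j => nc w / (n j)%:R)).
  by apply: nearW => j; rewrite subr0 nc_wn.
exact: cvg_half_pow.
Qed.

Let cvg_nsinh : (n j)%:R * csinh (w / (n j)%:R) @[j --> \oo] --> w.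
Proof.
apply: (@cvgC_squeeze _ _ _ _ _
  (fun j => (4 * nc w ^+ 2 * expR (nc w)) / (n j)%:R)); last exact: cvg_half_pow.
apply: nearW => j.
have -> : (n j)%:R * csinh (w / (n j)%:R) - w =
   (n j)%:R * (csinh (w / (n j)%:R) - w / (n j)%:R) by field.
rewrite ncM nc_nat ler_pdivlMr // mulrAC.
apply: le_trans (ler_wpM2l _ (nc_csinhB_le _)) _; first by rewrite mulr_ge0.
rewrite nc_wn.
have -> : (n j)%:R * (n j)%:R * (4 * (nc w / (n j)%:R) ^+ 2 * expR (nc w / (n j)%:R))
   = 4 * nc w ^+ 2 * expR (nc w / (n j)%:R) by field; rewrite gt_eqF.
apply: ler_wpM2l; first by rewrite mulr_ge0 ?sqr_ge0.
by rewrite ler_expR -nc_wn nc_wn_le.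
Qed.

Let cvg_cosh : ccosh (w / (n j)%:R) @[j --> \oo] --> (1 : C).
Proof.
have H1 : cexp (w / (n j)%:R) @[j --> \oo] --> cexp (0 : C).
  by apply: cvg_cexp; exact: cvg_wn.
have H2 : cexp (- (w / (n j)%:R)) @[j --> \oo] --> cexp (- 0 : C).
  by apply: cvg_cexp; apply: cvgN; exact: cvg_wn.
rewrite ?oppr0 cexp0 in H1 H2.
have : ccosh (w / (n j)%:R) @[j --> \oo] --> ((1 + 1) / 2 : C).
  by apply: cvgM; [exact: cvgD|exact: cvg_cst].
by rewrite divff ?pnatr_eq0.
Qed.

Let cvg_nsin (t : R) : (n j)%:R * sin (t / (n j)%:R) @[j --> \oo] --> t.
Proof.
have H := cvg_half_pow (`|t| ^+ 2).
apply/cvgrPdist_le => e e0; near=> j.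
have Hj : `|0 - `|t| ^+ 2 / (n j)%:R| <= e.
  by near: j; move/cvgrPdist_le : H; exact.
apply: le_trans Hj; rewrite distrC sub0r normrN.
have nj := n_gt0 j.
have -> : (n j)%:R * sin (t / (n j)%:R) - t =
   (n j)%:R * (sin (t / (n j)%:R) - t / (n j)%:R) by field; rewrite gt_eqF.
rewrite normrM ger0_norm //.
apply: le_trans (ler_wpM2l _ (sinB_le_sqr _)) _ => //.
rewrite normrM (@ger0_norm _ (n j)%:R^-1) ?invr_ge0 //.
rewrite [leRHS]ger0_norm ?divr_ge0 ?sqr_ge0 //.
by rewrite le_eqVlt; apply/orP; left; apply/eqP; field; rewrite gt_eqF.
Unshelve. all: by end_near. Qed.

Let sq (k j : nat) : R := sin (k.+1%:R * pi / (n j)%:R) ^+ 2.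
(* The factors of the finite product at w / n, with n a power of 2, padded by 1. *)
Let term (j k : nat) : C :=
  if (k.+1 < 2 ^ j)%N then 1 + csinh (w / (n j)%:R) ^+ 2 / (sq k j)%:C else 1.
Let term0 (k : nat) : C := 1 + w ^+ 2 / ((k.+1%:R * pi) ^+ 2)%:C.

Let kpi_gt0 k : 0 < k.+1%:R * pi :> R.
Proof. by rewrite mulr_gt0 ?ltr0n // pi_gt0. Qed.

Let term_cvg k : term j k @[j --> \oo] --> term0 k.
Proof.
have num : ((n j)%:R * csinh (w / (n j)%:R)) ^+ 2 @[j --> \oo] --> w ^+ 2.
  exact: cvg_sqr cvg_nsinh.
have den : ((n j)%:R * sin (k.+1%:R * pi / (n j)%:R)) ^+ 2 @[j --> \oo] -->
    (k.+1%:R * pi : R) ^+ 2 by apply: cvg_sqr; exact: cvg_nsin.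
have d0 : ((k.+1%:R * pi : R) ^+ 2)%:C != 0.
  by rewrite (inj_eq (@complexI R)) expf_neq0 // gt_eqF.
have fin : 1 + ((n j)%:R * csinh (w / (n j)%:R)) ^+ 2 /
   (((n j)%:R * sin (k.+1%:R * pi / (n j)%:R)) ^+ 2)%:C @[j --> \oo] --> term0 k.
  apply: cvgD; first exact: cvg_cst.
  apply: cvgM; first exact: num.
  exact: (cvgV d0 (cvg_realC den)).
apply: cvg_trans fin; apply: near_eq_cvg; near=> j.
have kj : (k.+1 < 2 ^ j)%N.
  have : (k.+1 <= j)%N by near: j; exact: nbhs_infty_ge.
  by move=> kj; apply: leq_ltn_trans kj _; exact: ltn_expl.
rewrite /term kj /sq; congr (1 + _).
have s0 : sin (k.+1%:R * pi / (n j)%:R) != 0 :> R.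
  by rewrite gt_eqF // sin_pi_gt0 //= (ltn_trans kj) // ltn_exp2l.
rewrite !exprMn rmorphM !rmorphXn /= rmorph_nat.
rewrite -(inj_eq (@complexI R)) in s0.
by field; rewrite nC s0.
Unshelve. all: by end_near. Qed.

Let K : R := nc w * (1 + 4 * nc w * expR (nc w)).

(** Jordan's inequality bounds the sine below by (k + 1) / n, and sinh (w / n) is
    at most a constant over n, so n cancels and the bound is uniform in j. *)
Let term_bound j k : nc (term j k - 1) <= 4 * K ^+ 2 * (k.+1%:R ^+ 2)^-1.
Proof.
have K0 : 0 <= K by rewrite mulr_ge0 ?nc_ge0 // addr_ge0 // !mulr_ge0 ?nc_ge0 ?expR_ge0.
rewrite /term; case: ifPn => kj; last first.
  rewrite subrr nc0; apply: mulr_ge0; last by rewrite invr_ge0 sqr_ge0.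
  by rewrite mulr_ge0 ?sqr_ge0.
rewrite addrC addKr ncM ncV ncX nc_real ger0_norm ?sqr_ge0 //.
set N : R := (n j)%:R.
have N0 : 0 < N := n_gt0 j.
have csb : nc (csinh (w / (n j)%:R)) <= K / N.
  apply: le_trans (nc_csinh_le _) _.
  have xN := nc_wn_le j; rewrite nc_wn -/N in xN *.
  have x0 : 0 <= nc w / N by rewrite divr_ge0 ?nc_ge0 // ltW.
  rewrite /K [leRHS]mulrAC; apply: ler_wpM2l => //; rewrite lerD2l; apply: ler_pM.
  - by rewrite mulr_ge0.
  - exact: expR_ge0.
  - by rewrite ler_wpM2l.
  - by rewrite ler_expR.
have snb : k.+1%:R / N <= sin (k.+1%:R * pi / N).
  have := @sin_ge_half R (k.+1%:R * pi / N) _.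
  have p2 := pi_ge2 R.
  have k0 : 0 <= k.+1%:R / N by rewrite divr_ge0 // ltW.
  move=> H; apply: le_trans (H _).
    have : 0 <= k.+1%:R / N * (pi - 2) by rewrite mulr_ge0 // subr_ge0.
    lra.
  apply/andP; split; first by rewrite divr_ge0 ?(ltW N0) // mulr_ge0 // pi_ge0.
  have kN : k.+1%:R * 2 <= N.
    by rewrite -natrM ler_nat /n expnS mulnC leq_pmul2l // ltnW.
  have : 0 <= pi * (N - k.+1%:R * 2) by rewrite mulr_ge0 ?pi_ge0 // subr_ge0.
  rewrite ler_pdivrMr //; lra.
have s0 : 0 < k.+1%:R / N by rewrite divr_gt0.
apply: (@le_trans _ _ ((K / N) ^+ 2 / (k.+1%:R / N) ^+ 2)).
  apply: ler_pM; rewrite ?invr_ge0 ?sqr_ge0 //.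
    by rewrite lerXn2r ?nnegrE ?nc_ge0 // divr_ge0 // ltW.
  rewrite lef_pV2 ?posrE ?exprn_gt0 //; last exact: lt_le_trans snb.
  by rewrite lerXn2r ?nnegrE ?(ltW s0) // (le_trans (ltW s0)).
have -> : (K / N) ^+ 2 / (k.+1%:R / N) ^+ 2 = K ^+ 2 * (k.+1%:R ^+ 2)^-1.
  have x0 : (k.+1%:R : R) != 0 by rewrite pnatr_eq0.
  have N1 : N != 0 by rewrite gt_eqF.
  by move: (k.+1%:R : R) x0 => x x0; field; rewrite x0 N1.
rewrite ler_wpM2r ?invr_ge0 ?sqr_ge0 //.
by have := sqr_ge0 K; lra.
Qed.

(** Apply the finite product at w / n and let n run through the powers of 2: the
    factors converge one by one and are dominated by a multiple of 1 / k^2. *)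
Lemma has_prod_shc : has_prod
  (fun k : nat => 1 + w ^+ 2 / ((k.+1%:R * pi) ^+ 2)%:C) (shc w).
Proof.
rewrite -/term0.
have [L L0] : exists L, has_prod term0 L.
  have B0 : 0 <= 4 * K ^+ 2 by rewrite mulr_ge0 ?sqr_ge0.
  apply: bsum_has_prod; apply: bsum_le (bsumZ B0 (bsum_inv_sqr R)) => k /=.
  apply: (cvg_nc_le (@term_cvg k)); apply: nearW => j.
  exact: term_bound.
pose P j := \prod_(1 <= k < 2 ^ j) (1 + csinh (w / (n j)%:R) ^+ 2 /
   (sin (k%:R * pi / (n j)%:R : R) ^+ 2)%:C).
have PL : P @ \oo --> L.
  apply: (tannery_prod term_cvg (g := fun k => 4 * K ^+ 2 * (k.+1%:R ^+ 2)^-1) _ _ _ _ L0).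
  - move=> k; apply: mulr_ge0; last by rewrite invr_ge0 sqr_ge0.
    by rewrite mulr_ge0 ?sqr_ge0.
  - by apply: bsumZ (bsum_inv_sqr R); rewrite mulr_ge0 ?sqr_ge0.
  - by apply: nearW => j k; exact: term_bound.
  apply: nearW => j.
  have -> : P j = \prod_(k <- [fset k in index_iota 0 (2 ^ j).-1]%fset) term j k.
    rewrite big_fset_uniq ?iota_uniq // /P big_add1 /=.
    by apply: eq_big_nat => k /andP[_ kj]; rewrite /term ifT //; lia.
  apply: has_prod_fin => k; rewrite !inE mem_index_iota /= /term => kj.
  by rewrite ifN //; apply: contra kj; lia.
have : csinh w = w * L.
  have E j : csinh w = (n j)%:R * csinh (w / (n j)%:R) * ccosh (w / (n j)%:R) * P j.
    by rewrite -sinh_prod_dyadic mulrC divfK.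
  have H : (fun=> csinh w) @ \oo --> w * 1 * L.
    have -> : (fun=> csinh w) = (fun j => (n j)%:R * csinh (w / (n j)%:R) *
       ccosh (w / (n j)%:R) * P j) by apply/funext => j; rewrite -E.
    exact: (cvgM (cvgM cvg_nsinh cvg_cosh) PL).
  by rewrite mulr1 in H; apply: cvgC_unique H; exact: cvg_cst.
have [w0 _|w0] := eqVneq w 0; last first.
  by rewrite csinhE => /(mulfI w0) ->.
rewrite /shc w0 eqxx.
apply: has_prod_one => k.
by rewrite /term0 w0 expr0n mul0r addr0.
Qed.
End Limit.

Lemma has_prod_sinpi (x : C) :
  has_prod (fun k : nat => 1 - x ^+ 2 / k.+1%:R ^+ 2) (shc (pii R * x)).
Proof.
apply: (eq_has_prod _ (@has_prod_shc (pii R * x))) => k; congr (1 + _).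
have -> : ((k.+1%:R * pi : R) ^+ 2)%:C = k.+1%:R ^+ 2 * pi%:C ^+ 2.
  by rewrite rmorphXn rmorphM rmorph_nat exprMn.
rewrite /pii !exprMn sqr_i.
have pn0 : (pi : R)%:C != 0 by rewrite (inj_eq (@complexI R)) gt_eqF // pi_gt0.
have k0 : (k.+1%:R : C) != 0 by rewrite pnatr_eq0.
by move: (pi%:C) pn0 (k.+1%:R : C) k0 => p p0 y y0; field; rewrite y0.
Qed.
End SineProductLimit.

(** * The Jacobi triple product *)

Section TripleProduct.
Variable R : realType.
Local Notation C := R[i].
Local Notation nc := ComplexField.Normc.normc.
Variable q : C.
Hypothesis q1 : nc q < 1.
Hypothesis q0 : q != 0.

(** The Pochhammer symbol (q; q)_n. *)
Definition qfac (n : nat) : C := \prod_(0 <= k < n) (1 - q ^+ k.+1).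

Lemma nc_qpow_lt1 k : nc (q ^+ k.+1) < 1.
Proof. by rewrite ncX exprn_ilt1 // nc_ge0. Qed.

Lemma qfac_factor_neq0 k : 1 - q ^+ k.+1 != 0.
Proof.
rewrite subr_eq0; apply/eqP => E; have := nc_qpow_lt1 k.
by rewrite -E nc1 ltxx.
Qed.

Lemma qfac_neq0 n : qfac n != 0.
Proof. by rewrite prodf_seq_neq0; apply/allP => k _; exact: qfac_factor_neq0. Qed.

Lemma qfacS n : qfac n.+1 = qfac n * (1 - q ^+ n.+1).
Proof. by rewrite /qfac big_nat_recr. Qed.

(** Gaussian binomial coefficient. *)
Definition qbin (m j : nat) : C := qfac m / (qfac j * qfac (m - j)).

Lemma qbin0 m : qbin m 0 = 1.
Proof.
by rewrite /qbin subn0 {2}/qfac big_geq // mul1r divff // qfac_neq0.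
Qed.

Lemma qbinn m : qbin m m = 1.
Proof.
by rewrite /qbin subnn {3}/qfac big_geq // mulr1 divff // qfac_neq0.
Qed.

Lemma qbinS m j : (j < m)%N ->
  qbin m.+1 j.+1 = qbin m j.+1 + q ^+ (m - j) * qbin m j.
Proof.
move=> jm; rewrite /qbin subSS.
have -> : (m - j = (m - j.+1).+1)%N by lia.
rewrite !qfacS.
have -> : q ^+ m.+1 = q ^+ (m - j.+1).+1 * q ^+ j.+1.
  by rewrite -exprD; congr (_ ^+ _); lia.
have := qfac_factor_neq0 j; have := qfac_factor_neq0 (m - j.+1).
have := qfac_neq0 j; have := qfac_neq0 (m - j.+1).
move: (qfac j) (qfac m) (qfac _) (q ^+ _) (q ^+ _) => a b c d e *.
by field; do ?[apply/andP; split].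
Qed.

Lemma q_binomial (x : C) m :
  \prod_(0 <= k < m) (1 + x * q ^+ k) =
  \sum_(0 <= j < m.+1) (\prod_(0 <= i < j) (x * q ^+ i)) * qbin m j.
Proof.
elim: m => [|m IH].
  by rewrite big_geq // big_nat1 big_geq // mul1r qbin0.
rewrite big_nat_recr //= IH mulrDr mulr1.
pose c j := \prod_(0 <= i < j) (x * q ^+ i).
rewrite -/c [RHS]big_nat_recl // [in RHS]big_nat_recr //=.
rewrite !qbinn !qbin0.
rewrite [X in X + _]big_nat_recl // qbin0 [X in _ + X]mulr_suml.
rewrite [X in _ + X]big_nat_recr //= qbinn.
have -> : \sum_(0 <= i < m) c i.+1 * qbin m.+1 i.+1 =
   \sum_(0 <= i < m) c i.+1 * qbin m i.+1 +
   \sum_(0 <= i < m) c i * qbin m i * (x * q ^+ m).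
  rewrite -big_split /=; apply: eq_big_nat => i /andP[_ im].
  rewrite qbinS // mulrDr; congr (_ + _).
  rewrite /c big_nat_recr //=.
  have -> : q ^+ m = q ^+ i * q ^+ (m - i) by rewrite -exprD subnKC // ltnW.
  by ring.
by rewrite /c big_nat_recr //=; ring.
Qed.

Lemma bsum_geom (r : R) : 0 <= r < 1 -> bsum (fun k : nat => r ^+ k.+1).
Proof.
move=> /andP[r0 r1]; apply: (@bsum_nat _ _ (1 - r)^-1) => [n|n].
  by rewrite exprn_ge0.
have r10 : 1 - r != 0 by rewrite subr_eq0 gt_eqF.
have -> : \sum_(0 <= k < n) r ^+ k.+1 = (r - r ^+ n.+1) / (1 - r).
  elim: n => [|n IH]; first by rewrite big_geq // expr1 subrr mul0r.
  by rewrite big_nat_recr //= IH [r ^+ n.+2]exprS; field.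
rewrite ler_pdivrMr ?mulVf ?subr_gt0 //.
by have := exprn_ge0 n.+1 r0; lra.
Qed.

Lemma bsum_qpow : bsum (fun k : nat => nc (q ^+ k.+1)).
Proof.
apply: bsum_le (bsum_geom (r := nc q) _); first by move=> k; rewrite ncX.
by rewrite nc_ge0.
Qed.

Lemma euler_product : exists2 Q, Q != 0 & has_prod (fun k : nat => 1 - q ^+ k.+1) Q.
Proof.
have b : bsum (fun k : nat => nc (1 - q ^+ k.+1 - 1)).
  by apply: bsum_le bsum_qpow => k; rewrite addrAC subrr add0r ncN.
have [Q HQ] := bsum_has_prod b; exists Q => //.
by apply: has_prod_neq0 HQ => // k; exact: qfac_factor_neq0.
Qed.

(** The inverse factors 1 / (1 - q^k) are 1 + O(q^k), so their products are bounded
    like those of the factors themselves. *)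
Lemma qfac_bounded : exists2 K, 0 <= K &
  forall n, nc (qfac n) <= K /\ nc (qfac n)^-1 <= K.
Proof.
have [M HM] := bsum_qpow.
have M0 : 0 <= M by have := HM fset0; rewrite big_seq_fset0.
have rq : 0 < 1 - nc q by rewrite subr_gt0.
have M'0 : 0 <= M / (1 - nc q) by rewrite divr_ge0 // ltW.
have sM n : \sum_(0 <= k < n) nc (q ^+ k.+1) <= M.
  by rewrite -big_fset_uniq ?iota_uniq.
exists (expR M + expR (M / (1 - nc q))); first by rewrite addr_ge0 ?expR_ge0.
move=> n; split.
  apply: (@le_trans _ _ (expR M)); last by rewrite lerDl expR_ge0.
  apply: le_trans (nc_prod_le (index_iota 0 n) (fun k => - q ^+ k.+1)) _.
  by rewrite ler_expR; under eq_bigr do rewrite ncN.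
apply: (@le_trans _ _ (expR (M / (1 - nc q)))); last by rewrite lerDr expR_ge0.
rewrite /qfac -prodfV.
have -> : \prod_(0 <= k < n) (1 - q ^+ k.+1)^-1 =
  \prod_(0 <= k < n) (1 + q ^+ k.+1 / (1 - q ^+ k.+1)).
  by apply: eq_bigr => k _; have := qfac_factor_neq0 k; move: (q ^+ _) => y y0; field.
apply: le_trans (nc_prod_le _ _) _; rewrite ler_expR.
apply: (@le_trans _ _ (\sum_(0 <= k < n) nc (q ^+ k.+1) / (1 - nc q))).
  apply: ler_sum => k _; rewrite ncM ncV ler_wpM2l ?nc_ge0 //.
  have d0 : 0 < nc (1 - q ^+ k.+1) by rewrite nc_gt0 qfac_factor_neq0.
  rewrite lef_pV2 ?posrE //.
  have : nc (q ^+ k.+1) <= nc q.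
    by rewrite ncX exprS ler_piMr ?nc_ge0 // exprn_ile1 ?nc_ge0 // ltW.
  have := ncB (1 - q ^+ k.+1) (- q ^+ k.+1); rewrite ncN opprK subrK nc1; lra.
by rewrite -mulr_suml ler_wpM2r // invr_ge0 ltW.
Qed.

Lemma cvg_qfac Q : has_prod (fun k : nat => 1 - q ^+ k.+1) Q ->
  qfac @ \oo --> Q.
Proof. exact: (@has_big_nat C 1 *%R). Qed.

Variable u : C.
Hypothesis u0 : u != 0.
Variable t : int -> C.
Hypothesis t0 : t 0 = 1.
Hypothesis tS : forall n, t (n + 1) = - u * q ^ (n + 1) * t n.

(** The recursion for [t], read upwards from 0 to N and then downwards j times,
    multiplies exactly the monomials that the q-binomial theorem produces. *)
Lemma theta_coef (N j : nat) :
  (\prod_(0 <= i < N) (- (q ^+ i.+1 * u))) *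
  (\prod_(0 <= i < j) (- (u^-1 * q^-1 ^+ N) * q ^+ i)) = t (N%:Z - j%:Z).
Proof.
elim: j => [|j IH].
  rewrite [X in _ * X]big_geq // mulr1 subr0.
  elim: N => [|N IH]; first by rewrite big_geq.
  rewrite big_nat_recr //= IH -addn1 PoszD tS mulrC.
  by congr (_ * _); rewrite -PoszD addn1 mulrC mulNr.
rewrite [X in _ * X]big_nat_recr // mulrA IH.
have := tS (N%:Z - j.+1%:Z).
have -> : N%:Z - j.+1%:Z + 1 = N%:Z - j%:Z by rewrite -addn1 PoszD; ring.
move=> ->; rewrite expfzDr // exprVn -exprVn.
have -> : q ^ (- j%:Z) = (q ^+ j)^-1 by rewrite -exprnN.
have qN : q ^+ N != 0 by rewrite expf_neq0.
have qj : q ^+ j != 0 by rewrite expf_neq0.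
have -> : q ^ N%:Z = q ^+ N by [].
rewrite exprVn; move: (t _) (q ^+ N) (q ^+ j) qN qj => a b c b0 c0.
by field; rewrite b0 c0 u0.
Qed.

(** The q-binomial theorem with 2 N + 1 factors at x = - u^-1 q^-N: half of the
    factors become 1 - q^k / u, the other half are, up to the monomials collected
    in [t N], the factors 1 - q^k u. *)
Lemma finite_triple_product (N : nat) :
  (1 - u^-1) * \prod_(0 <= k < N) ((1 - q ^+ k.+1 * u) * (1 - q ^+ k.+1 / u)) =
  \sum_(0 <= j < N.*2.+2) t (N%:Z - j%:Z) * qbin N.*2.+1 j.
Proof.
under [RHS]eq_bigr do rewrite -theta_coef -mulrA.
rewrite -mulr_sumr -q_binomial.
have -> : (N.*2.+1 = N + N.+1)%N by lia.
rewrite (big_cat_nat (leq0n N) (leq_addr N.+1 N)) /=.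
rewrite -{5}(add0n N) big_addn addKn big_nat_recl //= mulrA.
have uq i : (u^-1 * q^-1 ^+ N) * q ^+ (i + N) = q ^+ i / u.
  rewrite exprVn exprD; have := expf_neq0 N q0.
  by move: (q ^+ N) (q ^+ i) => a b a0; field; rewrite a0 u0.
have -> : 1 + - (u^-1 * q^-1 ^+ N) * q ^+ (0 + N) = 1 - u^-1.
  by rewrite mulNr uq expr0 mul1r.
have -> : \prod_(0 <= i < N) (1 + - (u^-1 * q^-1 ^+ N) * q ^+ (i.+1 + N)) =
   \prod_(0 <= i < N) (1 - q ^+ i.+1 / u).
  by apply: eq_bigr => i _; rewrite mulNr uq.
rewrite big_split /=.
have <- : \prod_(0 <= i < N) - (q ^+ i.+1 * u) *
   \prod_(0 <= i < N) (1 + - (u^-1 * q^-1 ^+ N) * q ^+ i) =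
   \prod_(0 <= i < N) (1 - q ^+ i.+1 * u); last by ring.
rewrite [X in _ * X]big_nat_rev -big_split /=.
apply: eq_big_nat => i /andP[_ iN].
rewrite add0n.
have qN : q ^+ N = q ^+ i.+1 * q ^+ (N - i.+1) by rewrite -exprD subnKC.
rewrite exprVn qN.
have q1' : q ^+ i.+1 != 0 by rewrite expf_neq0.
have q2' : q ^+ (N - i.+1) != 0 by rewrite expf_neq0.
move: (q ^+ i.+1) (q ^+ (N - i.+1)) q1' q2' => a b a0 b0.
by field; rewrite a0 b0 u0.
Qed.

Lemma cvg_qfac_sub (Q : C) (c : nat) (g : nat -> nat) :
  has_prod (fun k : nat => 1 - q ^+ k.+1) Q -> (forall N, N <= g N + c)%N ->
  qfac (g N) @[N --> \oo] --> Q.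
Proof.
move=> HQ gc; apply: (cvg_comp g qfac _ (cvg_qfac HQ)).
move=> A [M _ MP]; exists (M + c)%N => // N /= MN; apply: MP => /=.
by have := gc N; lia.
Qed.

(** Let N tend to infinity in the finite identity. The Gaussian binomials tend to
    1 / Q and are bounded, so the series converges dominatedly. The theta
    coefficients enter only through the recursion they satisfy, which spares
    half-integral powers of [q]. *)
Lemma triple_product (Q S : C) : Q != 0 ->
  has_prod (fun k : nat => 1 - q ^+ k.+1) Q -> bsum (fun n => nc (t n)) ->
  has_sum t S ->
  (1 - u^-1) * \prod_(0 <= k < N) ((1 - q ^+ k.+1 * u) * (1 - q ^+ k.+1 / u))
    @[N --> \oo] --> S / Q.
Proof.
move=> Q0 HQ bt tS'.
have [K K0 KP] := qfac_bounded.
pose f (N : nat) (n : int) : C :=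
  if (- N%:Z - 1 <= n <= N%:Z)%R then t n * qbin N.*2.+1 `|N%:Z - n|%N else 0.
have fcvg n : f N n @[N --> \oo] --> Q^-1 * t n.
  have H : t n * qbin N.*2.+1 `|N%:Z - n|%N @[N --> \oo] --> t n * (Q / (Q * Q)).
    apply: cvgM; first exact: cvg_cst.
    apply: cvgM; first by apply: (@cvg_qfac_sub Q 0) => // N; lia.
    apply: cvgV; first by rewrite mulf_neq0.
    by apply: cvgM; apply: (@cvg_qfac_sub Q `|n|%N) => // N; lia.
  have E : t n * (Q / (Q * Q)) = Q^-1 * t n by field.
  rewrite E in H; apply: cvg_trans H; apply: near_eq_cvg; near=> N.
  have nN : (`|n|%N <= N)%N by near: N; exact: nbhs_infty_ge.
  by rewrite /f ifT //; lia.
have -> : S / Q = Q^-1 * S by rewrite mulrC.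
apply: (tannery_sum fcvg (g := fun n => (K * (K * K)) * nc (t n))).
- by move=> n; rewrite !mulr_ge0 ?nc_ge0.
- by apply: bsumZ bt; rewrite !mulr_ge0.
- apply: nearW => N n; rewrite /f; case: ifP => _; last first.
    by rewrite nc0 !mulr_ge0 ?nc_ge0.
  rewrite ncM mulrC ler_wpM2r ?nc_ge0 // /qbin ncM ncV ncM invfM -!ncV.
  by rewrite !ler_pM ?mulr_ge0 ?nc_ge0 ?(KP _).1 ?(KP _).2.
- apply: nearW => N; rewrite finite_triple_product.
  pose s := [seq N%:Z - j%:Z | j <- index_iota 0 N.*2.+2].
  have us : uniq s by rewrite map_inj_uniq ?iota_uniq // => i j E; lia.
  have -> : \sum_(0 <= j < N.*2.+2) t (N%:Z - j%:Z) * qbin N.*2.+1 j =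
    \sum_(n <- [fset n in s]%fset) f N n.
    rewrite (big_fset_uniq _ _ us) big_map.
    apply: eq_big_nat => j /andP[_ jN]; rewrite /f ifT; last by lia.
    by congr (_ * qbin _ _); lia.
  apply: has_sum_fin => n; apply: contraNeq; rewrite /f.
  case: ifP => [nN _|_]; last by rewrite eqxx.
  have -> : (n \in [fset n in s]%fset) = (n \in s) by move: (s) => s'; rewrite !inE.
  apply/mapP; exists `|N%:Z - n|%N; last by lia.
  by rewrite mem_index_iota /=; lia.
- exact: has_sumZ.
Unshelve. all: by end_near. Qed.
End TripleProduct.

(** * Real powers *)

Section RealPowers.
Variable R : realType.
Implicit Types (x y s a : R).

Lemma powRE x a : 0 < x -> x `^ a = expR (a * ln x).
Proof. by move=> x0; rewrite /powR gt_eqF. Qed.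

Lemma powRDp x a b : 0 < x -> x `^ (a + b) = x `^ a * x `^ b.
Proof. by move=> x0; rewrite !powRE // mulrDl expRD. Qed.

Lemma powRN2 x : 0 <= x -> x `^ (- 2) = x ^- 2.
Proof. by move=> x0; rewrite powRN (powR_mulrn 2). Qed.

Lemma powR_ge_tangent x s : 0 < x -> 0 <= s -> 1 - s * (x - 1) <= x `^ (- s).
Proof.
move=> x0 s0; rewrite powRE //.
apply: le_trans (expR_ge1Dx _); rewrite lerD2l mulNr lerN2 ler_wpM2l //.
have := @le_ln1Dx R (x - 1).
have -> : 1 + (x - 1) = x by ring.
apply; lra.
Qed.

Lemma powR_le_tangent x s : 0 < x -> 0 <= s <= 1 -> x `^ s <= 1 + s * (x - 1).
Proof.
move=> x0 /andP[s0 s1]; rewrite powRE //; set L := ln x; set y := expR _.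
have y0 : 0 <= y by exact: expR_ge0.
have tan t : y * (1 + t - s * L) <= expR t.
  have := ler_wpM2l y0 (expR_ge1Dx (t - s * L)).
  have -> : y * expR (t - s * L) = expR t by rewrite /y -expRD; congr expR; ring.
  by rewrite addrA.
have := ler_wpM2l s0 (tan L); rewrite lnK ?posrE //.
have s1' : 0 <= 1 - s by rewrite subr_ge0.
have := ler_wpM2l s1' (tan 0); rewrite expR0; lra.
Qed.

(** Concavity of x^(1-s) bounds x^(-s) = x^(1-s) / x from above, convexity of
    x^(-s) from below. The factor [s] in the error is essential: the error is
    used for s tending to 0. *)
Lemma powR_tangent_error x s : 0 < x -> 0 <= s <= 1 ->
  `|x `^ (- s) - 1 + s * (x - 1)| <= s * (x - 1) ^+ 2 / x.
Proof.
move=> x0 /andP[s0 s1].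
have lo := powR_ge_tangent x0 s0.
rewrite ger0_norm; last by lra.
have hi : x `^ (1 - s) <= 1 + (1 - s) * (x - 1).
  by apply: powR_le_tangent => //; apply/andP; split; lra.
have E : x `^ (- s) = x `^ (1 - s) / x.
  by rewrite powRDp // powRr1 ?ltW // mulrAC divff ?mul1r // gt_eqF.
rewrite E ler_pdivlMr //.
have -> : (x `^ (1 - s) / x - 1 + s * (x - 1)) * x =
   x `^ (1 - s) - x + s * (x - 1) * x by field; rewrite gt_eqF.
rewrite expr2; lra.
Qed.

(** Tangent bounds for t^(-s) at the two ends of [k + 1, k + 2]; summed over k they
    show that s zeta(1 + s) tends to 1. *)
Lemma powR_telescope (k : nat) s : 0 <= s ->
  s * k.+2%:R `^ (-1 - s) <= k.+1%:R `^ (- s) - k.+2%:R `^ (- s) <=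
  s * k.+1%:R `^ (-1 - s).
Proof.
move=> s0.
have step x y : 0 < x -> 0 < y ->
   x `^ (- s) - y `^ (- s) <= s * (y - x) * x `^ (-1 - s).
  move=> x0 y0.
  have yx : 0 < y / x by rewrite divr_gt0.
  have H := powR_ge_tangent yx s0.
  have E : y `^ (- s) = x `^ (- s) * (y / x) `^ (- s).
    by rewrite -powRM ?ltW // mulrCA divff ?mulr1 // gt_eqF.
  have E2 : x `^ (-1 - s) = x `^ (- s) / x.
    have -> : -1 - s = - s + -1 by ring.
    by rewrite powRDp // powR_inv1 // ltW.
  rewrite E E2.
  have := ler_wpM2l (powR_ge0 x (- s)) H.
  have -> : s * (y - x) * (x `^ (- s) / x) = x `^ (- s) * (s * (y / x - 1)).
    by field; rewrite gt_eqF.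
  by rewrite mulrBr mulr1; lra.
have k1 : (0 : R) < k.+1%:R by rewrite ltr0n.
have k2 : (0 : R) < k.+2%:R by rewrite ltr0n.
have kk : k.+2%:R = k.+1%:R + 1 :> R by rewrite natr1.
apply/andP; split.
  have := step _ _ k2 k1; rewrite {2}kk opprD addrA subrr sub0r mulrN1 mulNr; lra.
by have := step _ _ k1 k2; rewrite {2}kk addrAC subrr add0r mulr1.
Qed.

Lemma sum_powR_ge (n : nat) s : 0 <= s ->
  1 - n.+1%:R `^ (- s) <= s * \sum_(0 <= k < n) k.+1%:R `^ (-1 - s).
Proof.
move=> s0; elim: n => [|n IH].
  by rewrite powR1 subrr big_geq // mulr0.
rewrite big_nat_recr //= mulrDr.
by have /andP[_] := powR_telescope n s0; lra.
Qed.

Lemma sum_powR_le (n : nat) s : 0 <= s ->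
  s * \sum_(0 <= k < n) k.+1%:R `^ (-1 - s) <= 1 + s.
Proof.
move=> s0; case: n => [|n]; first by rewrite big_geq // mulr0; lra.
suff : s * \sum_(0 <= k < n.+1) k.+1%:R `^ (-1 - s) <= 1 + s - n.+1%:R `^ (- s).
  by have := powR_ge0 n.+1%:R (- s); lra.
elim: n => [|n IH]; first by rewrite big_nat1 !powR1; lra.
rewrite big_nat_recr //= mulrDr.
by have /andP[] := powR_telescope n s0; lra.
Qed.

Lemma bsum_powR a : 1 < a -> bsum (fun k : nat => k.+1%:R `^ (- a) : R).
Proof.
move=> a1; have s0 : 0 < a - 1 by rewrite subr_gt0.
apply: (@bsum_nat _ _ ((1 + (a - 1)) / (a - 1))) => n; first exact: powR_ge0.
rewrite ler_pdivlMr // mulrC; have := sum_powR_le n (ltW s0).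
by under eq_bigr do have -> : -1 - (a - 1) = - a by ring.
Qed.

(** Splitting off the negative integers reduces to families over the naturals. *)
Lemma bsum_int (g : int -> R) : bsum (fun k : nat => g k%:Z) ->
  bsum (fun k : nat => g (- k.+1%:Z)) -> bsum g.
Proof.
move=> bp bn.
apply: bsum_le (bsumD (f := fun n : int => if 0 <= n then g n else 0)
   (g := fun n : int => if n < 0 then g n else 0) _ _).
- by move=> n; case: (lerP 0 n) => _; rewrite ?addr0 ?add0r.
- apply: (@bsum_reindex _ _ _ (fun n : int => 0 <= n) (fun n => `|n|%N)) bp.
  + by move=> m n /= m0 n0 mn; rewrite -topredE /= in m0 n0; lia.
  + by move=> n /negbTE ->.
  + by move=> n n0; rewrite n0; have -> : `|n|%N%:Z = n by lia.
- apply: (@bsum_reindex _ _ _ (fun n : int => n < 0) (fun n => `|n|.-1)) bn.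
  + by move=> m n /= m0 n0 mn; rewrite -topredE /= in m0 n0; lia.
  + by move=> n /negbTE ->.
  + by move=> n n0; rewrite n0; have -> : - (`|n|.-1.+1%:Z) = n by lia.
Qed.

Lemma bsum_int_powR a : 1 < a -> bsum (fun n : int => (1 + `|n|%N%:R) `^ (- a) : R).
Proof.
move=> a1; have b := bsum_powR a1; apply: bsum_int.
  by apply: bsum_le b => k; rewrite absz_nat nat1r.
apply: bsum_le b => k; rewrite abszN absz_nat nat1r.
rewrite !powRN lef_pV2 ?posrE ?powR_gt0 ?ltr0n //.
by rewrite ge0_ler_powR ?nnegrE ?ler0n ?ler_nat //; lra.
Qed.
End RealPowers.

(** * Half of the lattice *)

Section HalfLattice.
Variable R : realType.
Local Notation C := R[i].
Local Notation nc := ComplexField.Normc.normc.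
Variable tau : C.
Hypothesis tau_up : 0 < complex.Im tau.
Local Notation b := (complex.Im tau).

Definition lam (p : nat * int) : C := p.1%:R * tau + p.2%:~R.
(** One vector from each pair of opposite nonzero vectors: all of the rows m > 0,
    and the positive half of the row m = 0. *)
Definition half (p : nat * int) : bool := (0 < p.1)%N || (0 < p.2)%R.

Lemma nc_int (n : int) : nc (n%:~R : C) = `|n|%N%:R.
Proof.
case: n => n; first exact: nc_nat.
by rewrite NegzE mulrNz ncN abszN absz_nat; exact: nc_nat.
Qed.

Lemma Im_lam p : complex.Im (lam p) = p.1%:R * b.
Proof.
rewrite /lam raddfD /=.
have -> : (p.1%:R : C) = (p.1%:R : R)%:C by rewrite rmorph_nat.
have -> : (p.2%:~R : C) = (p.2%:~R : R)%:C by rewrite rmorph_int.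
by case: tau => x y /=; rewrite mul0r !addr0.
Qed.

Lemma Re_lam p : complex.Re (lam p) = p.1%:R * complex.Re tau + p.2%:~R.
Proof.
rewrite /lam raddfD /=.
have -> : (p.1%:R : C) = (p.1%:R : R)%:C by rewrite rmorph_nat.
have -> : (p.2%:~R : C) = (p.2%:~R : R)%:C by rewrite rmorph_int.
by case: tau => x y /=; rewrite mul0r subr0.
Qed.

Lemma nc_lam_Im p : p.1%:R * b <= nc (lam p).
Proof.
by rewrite -Im_lam; apply: le_trans (ler_norm _) (nc_Im _).
Qed.

(** The imaginary part controls m, and then n is controlled by the triangle
    inequality; all norms on the lattice are comparable. *)
Lemma nc_lam_ge : exists2 c : R, 0 < c <= 1 &
  forall p, c * (p.1%:R + `|p.2|%N%:R) <= nc (lam p).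
Proof.
have t0 := nc_ge0 tau.
set k := 1 + (1 + nc tau) / b.
have k1 : 1 <= k by rewrite /k lerDl divr_ge0 // ?ltW //; lra.
have k0 : 0 < k by lra.
exists k^-1; first by rewrite invr_gt0 k0 invf_le1.
move=> p; rewrite mulrC ler_pdivrMr // /k mulrDr mulr1.
have H1 := nc_lam_Im p.
have H2 : `|p.2|%N%:R <= nc (lam p) + p.1%:R * nc tau.
  rewrite -nc_int -nc_nat -ncM.
  have -> : (p.2%:~R : C) = lam p - p.1%:R * tau by rewrite /lam addrC addKr.
  exact: ncB.
have H3 : p.1%:R <= nc (lam p) / b by rewrite ler_pdivlMr.
have H4 : p.1%:R * nc tau <= nc (lam p) / b * nc tau by rewrite ler_wpM2r.
have -> : nc (lam p) * ((1 + nc tau) / b) = nc (lam p) / b + nc (lam p) / b * nc tau.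
  by field; rewrite gt_eqF.
lra.
Qed.

Lemma half_size p : half p -> (1 : R) <= p.1%:R + `|p.2|%N%:R.
Proof. by rewrite /half -natrD ler1n; lia. Qed.

Lemma nc_lam_half : exists2 c : R, 0 < c <= 1 & forall p, half p -> c <= nc (lam p).
Proof.
have [c c01 cP] := nc_lam_ge; exists c => // p /half_size hp.
apply: le_trans (cP p); rewrite ler_peMr //; by have /andP[/ltW] := c01.
Qed.

Lemma lam_neq0 p : half p -> lam p != 0.
Proof.
have [c /andP[c0 _] cP] := nc_lam_half => /cP cp.
by rewrite -nc_gt0 (lt_le_trans c0).
Qed.

Lemma le_powRN (x y a : R) : 0 < x -> x <= y -> 0 <= a -> y `^ (- a) <= x `^ (- a).
Proof.
move=> x0 xy a0; have y0 := lt_le_trans x0 xy.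
rewrite !powRN lef_pV2 ?posrE ?powR_gt0 //.
by rewrite ge0_ler_powR ?nnegrE // ltW.
Qed.

(** Up to a constant |m tau + n|^2 dominates (1 + m) (1 + |n|), so the double sum
    is bounded by a product of two simple sums. *)
Lemma bsum_half (a : R) : 1 < a ->
  bsum (fun p => if half p then nc (lam p) `^ (- (2 * a)) else 0).
Proof.
move=> a1; have [c /andP[c0 _] cP] := nc_lam_ge.
have a0 : 0 <= a by lra.
have c2 : 0 < (c / 2) ^+ 2 by rewrite exprn_gt0 // divr_gt0.
pose g (p : nat * int) : R := (p.1.+1%:R `^ (- a)) * (1 + `|p.2|%N%:R) `^ (- a).
have bg : bsum g.
  apply: bsum_prod (bsum_powR a1) (bsum_int_powR a1).
    by move=> k; exact: powR_ge0.
  by move=> k; exact: powR_ge0.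
apply: bsum_le (bsumZ (powR_ge0 ((c / 2) ^+ 2) (- a)) bg) => p.
case: ifPn => hp; last by rewrite !mulr_ge0 ?powR_ge0.
have l0 : 0 < nc (lam p) by rewrite nc_gt0 lam_neq0.
have s1 := half_size hp; set m : R := p.1%:R in s1; set n : R := `|p.2|%N%:R in s1.
have m0 : 0 <= m by rewrite /m.
have n0 : 0 <= n by rewrite /n.
have m1 : 0 < 1 + m by lra.
have n1 : 0 < 1 + n by lra.
have -> : nc (lam p) `^ (- (2 * a)) = (nc (lam p) ^+ 2) `^ (- a).
  by rewrite -powR_mulrn ?nc_ge0 // -powRrM mulrN.
have -> : g p = ((1 + m) * (1 + n)) `^ (- a).
  by rewrite powRM ?ltW // /g -nat1r.
have mn0 : 0 < (1 + m) * (1 + n) by rewrite mulr_gt0.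
rewrite -(powRM _ (ltW c2) (ltW mn0)).
apply: le_powRN => //; first by rewrite mulr_gt0.
have := cP p; rewrite -/m -/n => cl.
apply: (@le_trans _ _ ((c * (m + n)) ^+ 2)); last first.
  by rewrite lerXn2r // ?nnegrE ?nc_ge0 // mulr_ge0 ?ltW //; lra.
have : (1 + m) * (1 + n) <= 4 * (m + n) ^+ 2.
  have : 0 <= (m + n - 1) * (m + n) by rewrite mulr_ge0 //; lra.
  have := sqr_ge0 (m - n); rewrite !expr2; lra.
rewrite -(ler_pM2l c2) !expr2; lra.
Qed.

Lemma bsum_row (a : R) (m : nat) : 1 < a -> (0 < m)%N ->
  bsum (fun n : int => nc (lam (m, n)) `^ (- a)).
Proof.
move=> a1 m0; have [c /andP[c0 _] cP] := nc_lam_ge.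
apply: bsum_le (bsumZ (powR_ge0 c (- a)) (bsum_int_powR a1)) => n.
have n0 : (0 : R) <= `|n|%N%:R by [].
have n1 : (0 : R) < 1 + `|n|%N%:R by lra.
rewrite -(powRM _ (ltW c0) (ltW n1)).
apply: le_powRN; [by rewrite mulr_gt0| |lra].
apply: le_trans (cP (m, n)) => /=; rewrite ler_pM2l // lerD2r.
by rewrite ler1n.
Qed.
End HalfLattice.

(** * A telescoping approximation of the Eisenstein terms *)

Section SecondDifference.
Variable R : realType.
Local Notation C := R[i].
Local Notation nc := ComplexField.Normc.normc.

(** Plays the role of a primitive along rows of the Eisenstein terms; its
    differences between neighbours telescope. *)
Definition ipow (s : R) (x : C) : C := (x * (nc x `^ s)%:C)^-1.
(** At primitive vectors these are the elements of the set that defines the A-hat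
    product, over the whole half lattice the terms of Hecke's regularization of
    the Eisenstein series of weight two. *)
Definition ipow2 (s : R) (x : C) : C := (x ^+ 2 * (nc x `^ s)%:C)^-1.
Definition apow (s : R) (x : C) : C := (nc x `^ (- (2 + s)))%:C.
(** The derivative of 1 / (x |x|^s) along the real direction is
    - (1 + s/2) / (x^2 |x|^s) - (s/2) / |x|^(2+s), so replacing the derivative by
    a difference leaves an error one order smaller. *)
Definition hecke_err (s : R) (x : C) : C :=
  (1 + s / 2)%:C * ipow2 s x + (s / 2)%:C * apow s x - (ipow s x - ipow s (x + 1)).

Lemma sqr_nc (x : C) : (nc x ^+ 2)%:C = x * x^*%C.
Proof. by rewrite rmorphXn -sqr_normc. Qed.

Section Estimate.
Variables (s : R) (x : C).
Hypothesis s01 : 0 <= s <= 1.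
Hypothesis x0 : x != 0.
Hypothesis x1 : x + 1 != 0.
Let A := nc x.
Let B := nc (x + 1).
(* eps is the relative change of |x|^2 from x to x + 1, and kappa the second
   order error of (1 + eps)^(-s/2). *)
Let eps : R := B ^+ 2 / A ^+ 2 - 1.
Let kappa : R := (B ^+ 2 / A ^+ 2) `^ (- (s / 2)) - 1 + s / 2 * eps.

Let A_gt0 : 0 < A. Proof. by rewrite nc_gt0. Qed.
Let B_gt0 : 0 < B. Proof. by rewrite nc_gt0. Qed.

(* Expand |x + 1|^(-s) around |x|^(-s) and use |x|^2 eps = x + conj x + 1. *)
Let hecke_errE : hecke_err s x = (A `^ (- s))%:C *
  ((x ^+ 2 * (x + 1))^-1 +
   (s / 2)%:C * (eps%:C / (x * (x + 1)) - ((A ^+ 2)%:C * x)^-1) +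
   kappa%:C / (x + 1)).
Proof.
have AN : (A `^ (- s))%:C = ((A `^ s)%:C)^-1 by rewrite powRN fmorphV.
have As0 : (A `^ s)%:C != 0 by rewrite fmorph_eq0 gt_eqF // powR_gt0.
have xc0 : x^*%C != 0 by rewrite conjc_eq0.
have epsE : eps%:C = (x + x^*%C + 1) / (x * x^*%C).
  rewrite /eps rmorphB rmorph1 fmorph_div /= /A /B !sqr_nc rmorphD rmorph1.
  by field; rewrite x0 xc0.
have BE : ((B `^ s)%:C)^-1 = ((A `^ s)%:C)^-1 * (1 - (s / 2)%:C * eps%:C + kappa%:C).
  rewrite -!fmorphV -!powRN.
  have -> : 1 - (s / 2)%:C * eps%:C + kappa%:C =
     ((B ^+ 2 / A ^+ 2) `^ (- (s / 2)))%:C.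
    by rewrite -rmorphM -(rmorph1 (real_complex R)) -rmorphB -rmorphD; congr (_%:C); rewrite /kappa; ring.
  rewrite -rmorphM; congr (_%:C).
  have BA : 0 < B / A by rewrite divr_gt0.
  rewrite -expr_div_n -(powR_mulrn 2) ?ltW // -powRrM.
  have -> : 2%:R * - (s / 2) = - s by field.
  rewrite -powRM ?ltW //; congr (_ `^ _); field; by rewrite gt_eqF.
have apE : apow s x = ((A `^ s)%:C)^-1 / (x * x^*%C).
  rewrite /apow opprD addrC powRDp // rmorphM -sqr_nc; congr (_ * _) => //.
  by rewrite powRN (powR_mulrn 2) ?ltW // fmorphV.
rewrite /hecke_err apE /ipow2 /ipow -/A -/B.
rewrite !invfM BE AN.
have -> : (1 + s / 2)%:C = 1 + (s / 2)%:C by rewrite rmorphD rmorph1.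
rewrite sqr_nc epsE; move: ((s / 2)%:C) (kappa%:C) ((A `^ s)%:C) As0 => S k a a0.
move: (x^*%C) xc0 => xc xc0.
by field; rewrite x0 xc0 a0 x1.
Qed.

Variable beta : R.
Hypothesis beta01 : 0 < beta <= 1.
Hypothesis betaA : beta <= A.
Hypothesis betaB : beta <= B.

Let K : R := 2 / beta + 6 / beta ^+ 2 + 1 + 72 / beta ^+ 5.

(** With |x| and |x + 1| bounded below by [beta] they are comparable, so each term
    of the expansion is a multiple of |x|^(-3) uniformly for s in [0, 1]. The
    constant collects the four terms in order. *)
Lemma nc_hecke_err : nc (hecke_err s x) <= K / beta * A `^ (- 3).
Proof.
have /andP[b0 b1] := beta01; have /andP[s0 s1] := s01.
have AB : A <= B + 1.
  have := ncB (x + 1) 1; rewrite addrK nc1; exact.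
have BA : B <= A + 1 by have := ncD x 1; rewrite nc1; exact.
have bi : 1 <= beta^-1 by rewrite invf_ge1.
have bi0 : 0 < beta^-1 by rewrite invr_gt0.
have Ai : 1 <= A / beta by rewrite ler_pdivlMr // mul1r.
have Bi : 1 <= B / beta by rewrite ler_pdivlMr // mul1r.
have i0 : 0 < A^-1 by rewrite invr_gt0.
have epsb : `|eps| <= 3 / beta * A^-1.
  have -> : eps = (B - A) * (B + A) / A * A^-1 by rewrite /eps; field; rewrite gt_eqF.
  rewrite normrM (gtr0_norm i0) ler_wpM2r ?(ltW i0) // normrM (gtr0_norm i0).
  rewrite ler_pdivrMr // normrM (ger0_norm (_ : 0 <= B + A)); last by rewrite addr_ge0 ?ltW.
  have d1 : `|B - A| <= 1 by rewrite ler_norml; apply/andP; split; lra.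
  have BA0 : 0 <= B + A by rewrite addr_ge0 ?ltW.
  apply: le_trans (ler_wpM2r BA0 d1) _; rewrite mul1r.
  have : 0 <= A * (beta^-1 - 1) by apply: mulr_ge0; [exact: ltW|rewrite subr_ge0].
  lra.
have Bib : B^-1 <= 2 / beta * A^-1.
  rewrite -[B^-1]mul1r ler_pdivrMr // mulrAC ler_pdivlMr // mul1r.
  have : 0 <= B * (beta^-1 - 1) by apply: mulr_ge0; [exact: ltW|rewrite subr_ge0].
  lra.
have Xb : 0 < B ^+ 2 / A ^+ 2 by rewrite divr_gt0 // exprn_gt0.
have Xib : (B ^+ 2 / A ^+ 2)^-1 <= 4 / beta ^+ 2.
  rewrite invf_div.
  have -> : A ^+ 2 / B ^+ 2 = (A * B^-1) ^+ 2 by rewrite expr_div_n.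
  have -> : 4 / beta ^+ 2 = (2 / beta) ^+ 2 by field; rewrite gt_eqF.
  rewrite lerXn2r ?nnegrE ?mulr_ge0 ?invr_ge0 ?(ltW A_gt0) ?(ltW B_gt0) ?(ltW b0) //.
  by have := ler_wpM2l (ltW A_gt0) Bib; rewrite mulrCA divff ?mulr1 // gt_eqF.
have kapb : `|kappa| <= 36 / beta ^+ 4 * A^-1 ^+ 2.
  have s2 : 0 <= s / 2 <= 1 by apply/andP; split; lra.
  apply: le_trans (powR_tangent_error Xb s2) _; rewrite -/eps.
  have e2 : eps ^+ 2 <= (3 / beta * A^-1) ^+ 2.
    by rewrite -real_normK ?num_real // lerXn2r ?nnegrE // !mulr_ge0 // ltW.
  have e0 := sqr_ge0 eps.
  have X0 : 0 <= (B ^+ 2 / A ^+ 2)^-1 by rewrite invr_ge0 ltW.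
  have h1 : s / 2 * eps ^+ 2 <= eps ^+ 2 by rewrite ler_piMl //; lra.
  apply: le_trans (ler_wpM2r X0 (le_trans h1 e2)) _.
  apply: le_trans (ler_wpM2l (sqr_ge0 _) Xib) _.
  by rewrite le_eqVlt; apply/orP; left; apply/eqP; field; rewrite !gt_eqF.
have Asb : A `^ (- s) <= beta^-1.
  apply: (@le_trans _ _ (beta `^ (- s))); first exact: le_powRN.
  rewrite -(powR_inv1 (ltW b0)); apply: ger_powR; [exact: beta01|lra].
have A3 : A `^ (- 3) = A^-1 ^+ 3 by rewrite powRN (powR_mulrn 3) ?ltW // exprVn.
rewrite hecke_errE ncM nc_real ger0_norm ?powR_ge0 // A3.
have -> : K / beta * A^-1 ^+ 3 = beta^-1 * (K * A^-1 ^+ 3) by ring.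
apply: ler_pM => //; [exact: powR_ge0|exact: nc_ge0|].
set i := A^-1 in i0 epsb Bib kapb *.
have i30 : 0 <= i ^+ 3 by rewrite exprn_ge0 // ltW.
have Bi0 : 0 <= B^-1 by rewrite invr_ge0 ltW.
have ncx : nc x^-1 = i by rewrite ncV.
have t1 : nc ((x ^+ 2 * (x + 1))^-1) <= 2 / beta * i ^+ 3.
  rewrite ncV ncM ncX -/A -/B invfM -exprVn -/i.
  have -> : 2 / beta * i ^+ 3 = i ^+ 2 * (2 / beta * i) by ring.
  by rewrite ler_wpM2l ?sqr_ge0.
have t2 : nc (eps%:C / (x * (x + 1))) <= 6 / beta ^+ 2 * i ^+ 3.
  rewrite ncM nc_real ncV ncM -/A -/B invfM -/i.
  have -> : 6 / beta ^+ 2 * i ^+ 3 = (3 / beta * i) * (i * (2 / beta * i)).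
    by field; rewrite gt_eqF.
  by apply: ler_pM => //; [rewrite mulr_ge0 // ltW|rewrite ler_wpM2l // ltW].
have t3 : nc (((A ^+ 2)%:C * x)^-1) = i ^+ 3.
  rewrite ncV ncM nc_real ger0_norm ?sqr_ge0 // -/A invfM -exprVn -/i; ring.
have t4 : nc (kappa%:C / (x + 1)) <= 72 / beta ^+ 5 * i ^+ 3.
  rewrite ncM nc_real ncV -/B.
  have -> : 72 / beta ^+ 5 * i ^+ 3 = (36 / beta ^+ 4 * i ^+ 2) * (2 / beta * i).
    by field; rewrite gt_eqF.
  exact: ler_pM.
have t23 : nc ((s / 2)%:C * (eps%:C / (x * (x + 1)) - ((A ^+ 2)%:C * x)^-1)) <=
    6 / beta ^+ 2 * i ^+ 3 + i ^+ 3.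
  rewrite ncM nc_real ger0_norm ?divr_ge0 //.
  apply: (@le_trans _ _ (nc (eps%:C / (x * (x + 1)) - ((A ^+ 2)%:C * x)^-1))).
    by rewrite ler_piMl ?nc_ge0 //; lra.
  by apply: le_trans (ncB _ _) _; rewrite t3 lerD2r.
apply: le_trans (ncD _ _) _; apply: le_trans (lerD (ncD _ _) (lexx _)) _.
apply: le_trans (lerD (lerD t1 t23) t4) _.
by rewrite le_eqVlt; apply/orP; left; apply/eqP; rewrite /K; ring.
Qed.
End Estimate.
End SecondDifference.

(** * The residue of the Epstein zeta function *)

Section EpsteinResidue.
Variable R : realType.
Local Notation C := R[i].
Local Notation nc := ComplexField.Normc.normc.
Variable tau : C.
Hypothesis tau_up : 0 < complex.Im tau.
Local Notation a := (complex.Re tau).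
Local Notation b := (complex.Im tau).

Lemma sum_inv_sqr_le (N : nat) : \sum_(0 <= k < N) (k.+1%:R ^+ 2)^-1 <= 2 :> R.
Proof.
have := sum_powR_le N (ler01 : (0 : R) <= 1); rewrite mul1r.
have E k : k.+1%:R `^ (-1 - 1) = (k.+1%:R ^+ 2)^-1 :> R.
  by rewrite -opprD powRN (powR_mulrn 2).
by under eq_bigr do rewrite E.
Qed.

(** The relative variation of 1 + x^2, hence of the derivative of atan, over a step
    of length at most [d]. *)
Lemma sqr1D_step (x c d : R) : 0 <= d -> `|c - x| <= d ->
  1 + c ^+ 2 <= (1 + x ^+ 2) * (1 + (d + d ^+ 2)).
Proof.
move=> d0; rewrite ler_norml => /andP[h1 h2].
set e := c - x in h1 h2; have -> : c = x + e by rewrite /e; ring.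
have e2 : e ^+ 2 <= d ^+ 2.
  by rewrite -real_normK ?num_real // lerXn2r ?nnegrE // ler_norml h1.
have x2 := sqr_ge0 x; have d2 := sqr_ge0 d.
have : 2 * x * e <= d * (1 + x ^+ 2).
  have [xp|xn] := lerP 0 x.
    have : 0 <= x * (d - e) by rewrite mulr_ge0 // subr_ge0.
    have : 0 <= d * (x - 1) ^+ 2 by rewrite mulr_ge0 // sqr_ge0.
    rewrite !expr2; lra.
  have : 0 <= - x * (d + e) by rewrite mulr_ge0 //; lra.
  have : 0 <= d * (x + 1) ^+ 2 by rewrite mulr_ge0 // sqr_ge0.
  rewrite !expr2; lra.
have : 0 <= x ^+ 2 * d ^+ 2 by rewrite mulr_ge0.
have -> : (x + e) ^+ 2 = x ^+ 2 + 2 * x * e + e ^+ 2 by ring.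
lra.
Qed.

Lemma atan_step (x d : R) : 0 < d ->
  (d / (1 + x ^+ 2)) <= (1 + (d + d ^+ 2)) * (atan (x + d) - atan x) /\
  (atan (x + d) - atan x) <= (1 + (d + d ^+ 2)) * (d / (1 + x ^+ 2)).
Proof.
move=> d0; have xd : x <= x + d by rewrite lerDl ltW.
have ac (A : set R) : {within A, continuous (@atan R)}.
  apply: continuous_subspaceT => t; apply: differentiable_continuous.
  by apply/derivable1_diffP; have [] := is_derive1_atan t.
have [c] := MVT_segment xd (fun t _ => is_derive1_atan t) (ac _).
rewrite in_itv /= => /andP[xc cx] ->.
have cd : `|c - x| <= d by rewrite ger0_norm; lra.
have H1 := sqr1D_step (ltW d0) cd.
have cd' : `|x - c| <= d by rewrite distrC.
have H2 := sqr1D_step (ltW d0) cd'.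
have p1 : 0 < 1 + x ^+ 2 by have := sqr_ge0 x; lra.
have p2 : 0 < 1 + c ^+ 2 by have := sqr_ge0 c; lra.
have -> : x + d - x = d by ring.
set k := 1 + (d + d ^+ 2) in H1 H2 *; set u := 1 + x ^+ 2 in p1 H1 H2 *.
set v := 1 + c ^+ 2 in p2 H1 H2 *.
have h1 : u^-1 <= k / v.
  by rewrite -[u^-1]mul1r ler_pdivrMr // mulrAC ler_pdivlMr // mul1r mulrC.
have h2 : v^-1 <= k / u.
  by rewrite -[v^-1]mul1r ler_pdivrMr // mulrAC ler_pdivlMr // mul1r mulrC.
have := ler_wpM2l (ltW d0) h1; have := ler_wpM2l (ltW d0) h2.
by split; lra.
Qed.

Lemma nc_sqrE (x : C) : nc x ^+ 2 = complex.Re x ^+ 2 + complex.Im x ^+ 2.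
Proof. by case: x => x y /=; rewrite sqr_sqrtr // addr_ge0 ?sqr_ge0. Qed.

(* (m b) / |m tau + n|^2 is the derivative of atan at xi m n, times the step
   1 / (m b) from xi m n to xi m (n + 1); kap m bounds the relative error. *)
Let xi (m : nat) (n : int) : R := (m%:R * a + n%:~R) / (m%:R * b).
Let kap (m : nat) : R := 1 + ((m%:R * b)^-1 + (m%:R * b)^-1 ^+ 2).

(** Each term of a row sum is an increment of the arctangent up to the factor
    [kap m]; the increments of a whole row add up to at most pi. *)
Lemma row_step (m : nat) (n : int) : (0 < m)%N ->
  m%:R * b * nc (lam tau (m, n)) ^- 2 <=
    kap m * (atan (xi m (n + 1)) - atan (xi m n)) /\
  atan (xi m (n + 1)) - atan (xi m n) <=
    kap m * (m%:R * b * nc (lam tau (m, n)) ^- 2).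
Proof.
move=> m0; have mb : 0 < m%:R * b by rewrite mulr_gt0 ?ltr0n.
have d0 : 0 < (m%:R * b)^-1 by rewrite invr_gt0.
have mn0 : m%:R * b != 0 by rewrite gt_eqF.
have -> : xi m (n + 1) = xi m n + (m%:R * b)^-1.
  by rewrite /xi intrD addrA mulrDl mul1r.
have -> : m%:R * b * nc (lam tau (m, n)) ^- 2 =
    (m%:R * b)^-1 / (1 + xi m n ^+ 2).
  rewrite nc_sqrE Re_lam Im_lam /= /xi.
  move: (m%:R * b) (m%:R * a + n%:~R) mn0 mb => y x y0 yp.
  have h : x ^+ 2 + y ^+ 2 != 0.
    by rewrite gt_eqF // ltr_wpDl ?sqr_ge0 // exprn_gt0.
  have -> : 1 + (x / y) ^+ 2 = (x ^+ 2 + y ^+ 2) / y ^+ 2 by field.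
  by field; rewrite y0 h.
exact: atan_step.
Qed.

Lemma row_telescope (m n : nat) (c : int) :
  \sum_(0 <= i < n) (atan (xi m (i%:Z + c + 1)) - atan (xi m (i%:Z + c))) =
  atan (xi m (n%:Z + c)) - atan (xi m c).
Proof.
elim: n => [|n IH]; first by rewrite big_geq // add0r subrr.
rewrite big_nat_recr //= IH.
have -> : n%:Z + c + 1 = n.+1%:Z + c by lia.
ring.
Qed.

Lemma row_upper (m : nat) (A : {fset int}) : (0 < m)%N ->
  \sum_(n <- A) nc (lam tau (m, n)) ^- 2 <= pi / (m%:R * b) * kap m.
Proof.
move=> m0; have mb : 0 < m%:R * b by rewrite mulr_gt0 ?ltr0n.
have kp : 0 < kap m.
  by rewrite /kap ltr_pwDl // addr_ge0 ?sqr_ge0 // invr_ge0 ltW.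
pose M := (\max_(n <- A) `|n|).+1%N.
apply: (@le_trans _ _ (\sum_(n <- [seq i%:Z - M%:Z | i <- index_iota 0 M.*2])
   nc (lam tau (m, n)) ^- 2)).
  apply: ler_sum_sub.
  - by move=> n; rewrite invr_ge0 sqr_ge0.
  - exact: fset_uniq.
  - by rewrite map_inj_uniq ?iota_uniq // => i j E; lia.
  move=> n nA; have nM : (`|n| < M)%N by rewrite ltnS; apply: leq_bigmax_seq.
  apply/mapP; exists (absz (n + M%:Z)); last by lia.
  by rewrite mem_index_iota /=; lia.
rewrite big_map -(ler_pM2l mb) mulr_sumr.
apply: (@le_trans _ _ (kap m * (atan (xi m (M.*2%:Z - M%:Z)) - atan (xi m (- M%:Z))))).
  rewrite -row_telescope mulr_sumr; apply: ler_sum => i _.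
  exact: (row_step (i%:Z - M%:Z) m0).1.
have -> : m%:R * b * (pi / (m%:R * b) * kap m) = kap m * pi.
  by field; rewrite gt_eqF //= gt_eqF // ltr0n.
rewrite ler_pM2l //.
have := atan_ltpi2 (xi m (M.*2%:Z - M%:Z)); have := atan_gtNpi2 (xi m (- M%:Z)).
lra.
Qed.

(* kap m is at most 1 + Ck / m. The excess contributes at most a multiple of
   the sum of 1 / m^2, which the factor s sends to 0. *)
Let Ck : R := b^-1 + b^-1 ^+ 2.

Let Ck_ge0 : 0 <= Ck.
Proof. by rewrite addr_ge0 ?sqr_ge0 // invr_ge0 ltW. Qed.

Lemma kap_le k : kap k.+1 <= 1 + Ck / k.+1%:R.
Proof.
rewrite /kap /Ck lerD2l mulrDl invfM; set x := k.+1%:R^-1; set y := b^-1.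
have y0 : 0 < y by rewrite invr_gt0.
have x1 : x <= 1 by rewrite invf_le1 ?ltr0n // ler1n.
have x0 : 0 < x by rewrite invr_gt0 ltr0n.
have : 0 <= y ^+ 2 * (x - x ^+ 2).
  by rewrite mulr_ge0 ?sqr_ge0 // subr_ge0 expr2 ler_piMl // ltW.
by rewrite exprMn; lra.
Qed.

Let esum_term (s : R) (p : nat * int) : R :=
  if (0 < p.1)%N then nc (lam tau p) `^ (- (2 + s)) else 0.

Lemma nc_lam_up_gt0 p : (0 < p.1)%N -> 0 < nc (lam tau p).
Proof.
move=> m0; apply: lt_le_trans (nc_lam_Im tau p).
by rewrite mulr_gt0 ?ltr0n.
Qed.

(** On the row m one has |m tau + n| >= m b, so |m tau + n|^(-s) is taken out at
    that value, and the rest of the row sum is at most pi / (m b), up to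
    [kap m]. *)
Lemma epstein_upper (s : R) (A : {fset nat * int}) : 0 < s ->
  s * \sum_(p <- A) esum_term s p <= b `^ (- s) * (pi / b) * (1 + s + 2 * Ck * s).
Proof.
move=> s0.
have st0 p : 0 <= esum_term s p by rewrite /esum_term; case: ifP => // _; exact: powR_ge0.
pose A1 := [fset p.1 | p in A]%fset; pose A2 := [fset p.2 | p in A]%fset.
pose N := (\max_(m <- A1) m)%N.
have H1 : \sum_(p <- A) esum_term s p <=
   \sum_(m <- 0%N :: [seq k.+1 | k <- index_iota 0 N]) \sum_(n <- A2) esum_term s (m, n).
  rewrite -(@big_allpairs R 0 +%R _ _ _ A2 (esum_term s)).
  apply: ler_sum_sub => //.
    apply: allpairs_uniq => //; last by move=> [? ?] [? ?].
    rewrite /= map_inj_uniq ?iota_uniq ?andbT; last by move=> i j [].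
    by apply/mapP => -[].
  move=> [m n] pA; apply/allpairsP; exists (m, n); split => //=.
    have mA1 : m \in A1 by apply/imfsetP; exists (m, n).
    case: m {pA} mA1 => [|m] mA1; first by rewrite inE.
    rewrite inE /=; apply: map_f; rewrite mem_index_iota /=.
    by have : (m.+1 <= N)%N by apply: leq_bigmax_seq.
  by apply/imfsetP; exists (m, n).
apply: le_trans (ler_wpM2l (ltW s0) H1) _.
rewrite big_cons [X in X + _]big1; last by move=> n _; rewrite /esum_term.
rewrite add0r big_map.
have bs0 : 0 <= b `^ (- s) * (pi / b).
  by rewrite mulr_ge0 ?powR_ge0 // divr_ge0 ?pi_ge0 // ltW.
apply: (@le_trans _ _ (s * \sum_(0 <= k < N)
   (b `^ (- s) * (pi / b) * (k.+1%:R `^ (-1 - s) + Ck * (k.+1%:R ^+ 2)^-1)))).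
  rewrite ler_wpM2l ?(ltW s0) //; apply: ler_sum => k _.
  apply: (@le_trans _ _ ((k.+1%:R * b) `^ (- s) * \sum_(n <- A2) nc (lam tau (k.+1, n)) ^- 2)).
    rewrite mulr_sumr; apply: ler_sum => n _; rewrite /esum_term /=.
    have l0 := nc_lam_up_gt0 (p := (k.+1, n)) isT.
    rewrite opprD powRDp // powRN2 ?(ltW l0) // mulrC.
    rewrite ler_wpM2r ?invr_ge0 ?sqr_ge0 //.
    by apply: le_powRN; [rewrite mulr_gt0 ?ltr0n|exact: (nc_lam_Im tau (k.+1, n))|exact: ltW].
  apply: le_trans (ler_wpM2l (powR_ge0 _ _) (row_upper A2 (ltn0Sn k))) _.
  have k0 : (0 : R) < k.+1%:R by rewrite ltr0n.
  rewrite powRM ?(ltW k0) ?(ltW tau_up) // powRDp // powR_inv1 ?(ltW k0) //.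
  have Q0 : 0 <= k.+1%:R `^ (- s) * b `^ (- s) * (pi / (k.+1%:R * b)).
    by rewrite !mulr_ge0 ?powR_ge0 // ?pi_ge0 // invr_ge0 mulr_ge0 // ltW.
  rewrite [leLHS]mulrA; apply: le_trans (ler_wpM2l Q0 (kap_le k)) _.
  have ks1 : k.+1%:R `^ (- s) <= 1.
    have e1 : (1 : R) `^ (- s) = 1 by rewrite powR1.
    rewrite -[leRHS]e1; apply: le_powRN => //; last exact: ltW.
    by rewrite ler1n.
  rewrite -subr_ge0.
  have -> : b `^ (- s) * (pi / b) * (k.+1%:R^-1 * k.+1%:R `^ (- s) + Ck * (k.+1%:R ^+ 2)^-1)
    - k.+1%:R `^ (- s) * b `^ (- s) * (pi / (k.+1%:R * b)) * (1 + Ck / k.+1%:R) =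
    b `^ (- s) * (pi / b) * (Ck * (k.+1%:R ^+ 2)^-1) * (1 - k.+1%:R `^ (- s)).
    by move: (k.+1%:R) k0 => y y0; field; rewrite !gt_eqF.
  rewrite mulr_ge0 ?subr_ge0 // mulr_ge0 // mulr_ge0 // invr_ge0 sqr_ge0 //.
rewrite -mulr_sumr mulrCA ler_wpM2l // big_split /= mulrDr -mulr_sumr.
rewrite lerD ?sum_powR_le ?(ltW s0) //.
have sq2 := sum_inv_sqr_le N.
have := ler_wpM2l (mulr_ge0 (ltW s0) Ck_ge0) sq2; lra.
Qed.

Lemma has_sum_real_ge (I : choiceType) (g : I -> R) (L : C) (t : seq I) :
  (forall i, 0 <= g i) -> uniq t -> has_sum (fun i => (g i)%:C) L ->
  \sum_(i <- t) g i <= complex.Re L.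
Proof.
move=> g0 ut gL; apply: (cvgr_to_ge (cvg_Re gL)).
exists [fset i in t]%fset => // A /= tA.
rewrite -(rmorph_sum (real_complex R)) /= -(big_fset_uniq _ _ ut).
by rewrite (big_fset_split _ _ tA) /= lerDl sumr_ge0.
Qed.

Lemma has_sum_real_le (I : choiceType) (g : I -> R) (L : C) (M : R) :
  (forall A : {fset I}, \sum_(i <- A) g i <= M) -> has_sum (fun i => (g i)%:C) L ->
  complex.Re L <= M.
Proof.
move=> gM gL; apply: (cvgr_to_le (cvg_Re gL)).
by apply: nearW => A /=; rewrite -(rmorph_sum (real_complex R)) /=.
Qed.

Lemma has_sum_real (I : choiceType) (g : I -> R) (L : C) :
  has_sum (fun i => (g i)%:C) L -> L = (complex.Re L)%:C.
Proof.
move=> gL; apply: (has_sum_unique gL).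
have E (A : {fset I}) : \sum_(i <- A) (g i)%:C =
    (complex.Re (\sum_(i <- A) (g i)%:C))%:C.
  by rewrite -(rmorph_sum (real_complex R)).
have H : complex.Re (\sum_(i <- (A : {fset I})) (g i)%:C) @[A --> totally] -->
    complex.Re L by exact: cvg_Re.
rewrite /has_sum /has_big; under eq_cvg do rewrite /= E.
exact: cvg_realC.
Qed.

(* For the lower bound only the sector |n| <= J m is kept. There |m tau + n| is at
   most m CJ, and theta, which tends to pi with J, is the arctangent increment
   over the sector. *)
Let CJ_ (J : nat) : R := nc tau + J%:R.
Let theta_ (J : nat) : R := atan ((a + J%:R) / b) - atan ((a - J%:R) / b).
Let idx_ (J N : nat) := [seq (k.+1, i%:Z - (J * k.+1)%:Z) |
   k <- index_iota 0 N, i <- index_iota 0 (J * k.+1).*2].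

Section Lower.
Variables (s : R) (J N : nat).
Hypothesis s0 : 0 < s.
Local Notation CJ := (CJ_ J).
Local Notation theta := (theta_ J).
Local Notation idx := (idx_ J N).

Lemma idx_uniq : uniq idx.
Proof.
apply: allpairs_uniq_dep; first exact: iota_uniq.
  by move=> k _; exact: iota_uniq.
move=> [k i] [l j] /= _ _ [kl ij]; rewrite -kl in ij *.
by have -> : i = j by lia.
Qed.

Lemma theta_ge0 : 0 <= theta.
Proof.
rewrite /theta_ subr_ge0; apply: le_atan; rewrite ler_pM2r ?invr_gt0 // lerD2l.
by have : (0 : R) <= J%:R by []; lra.
Qed.

Lemma CJ_gt0 : 0 < CJ.
Proof.
rewrite /CJ_ ltr_wpDr //; apply: lt_le_trans (nc_Im tau).
by rewrite gtr0_norm.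
Qed.

(** With c = Ck / (k + 1), the row sum is at least theta / (1 + c) by the arctangent
    comparison, and 1 - c <= 1 / (1 + c). *)
Lemma row_lower (k : nat) :
  (1 - Ck / k.+1%:R) * theta <= k.+1%:R * b *
   \sum_(0 <= i < (J * k.+1).*2) nc (lam tau (k.+1, i%:Z - (J * k.+1)%:Z)) ^- 2.
Proof.
have th0 := theta_ge0; set X := _ * \sum_(_ <= _ < _) _.
have k0 : (0 : R) < k.+1%:R by rewrite ltr0n.
have X0 : 0 <= X.
  rewrite mulr_ge0 ?mulr_ge0 ?(ltW tau_up) // sumr_ge0 // => i _.
  by rewrite invr_ge0 sqr_ge0.
have tX : theta <= kap k.+1 * X.
  have -> : theta = atan (xi k.+1 ((J * k.+1).*2%:Z + (- (J * k.+1)%:Z))) -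
     atan (xi k.+1 (- (J * k.+1)%:Z)).
    have -> : (J * k.+1).*2%:Z + (- (J * k.+1)%:Z) = (J * k.+1)%:Z by lia.
    rewrite /theta_ /xi rmorphN /=.
    have -> : ((J * k.+1)%:Z)%:~R = J%:R * k.+1%:R :> R by rewrite -natrM.
    congr (atan _ - atan _).
      by field; rewrite !gt_eqF.
    by field; rewrite !gt_eqF.
  rewrite -row_telescope /X !mulr_sumr; apply: ler_sum => i _.
  exact: (row_step _ _).2.
have c0 : 0 <= Ck / k.+1%:R by rewrite divr_ge0 // ltW.
have tX2 := le_trans tX (ler_wpM2r X0 (kap_le k)).
set c := Ck / _ in c0 tX2 *.
have [c1|c1] := lerP c 1.
  have : (1 - c) * theta <= (1 - c) * ((1 + c) * X) by rewrite ler_wpM2l // subr_ge0.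
  have : 0 <= c ^+ 2 * X by rewrite mulr_ge0 ?sqr_ge0.
  rewrite expr2; lra.
have : 0 <= (c - 1) * theta by rewrite mulr_ge0 // subr_ge0 ltW.
lra.
Qed.

Lemma epstein_lower :
  CJ `^ (- s) * (theta / b) * (1 - N.+1%:R `^ (- s) - 2 * Ck * s) <=
  s * \sum_(p <- idx) esum_term s p.
Proof.
have th0 := theta_ge0.
have D0 : 0 <= CJ `^ (- s) * (theta / b).
  by rewrite mulr_ge0 ?powR_ge0 // divr_ge0 // ltW.
rewrite /idx_ big_allpairs_dep /=.
apply: (@le_trans _ _ (s * \sum_(0 <= k < N)
   (CJ `^ (- s) * (theta / b) * (k.+1%:R `^ (-1 - s) - Ck * (k.+1%:R ^+ 2)^-1)))); last first.
  rewrite ler_wpM2l ?(ltW s0) //; apply: ler_sum => k _.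
  have k0 : (0 : R) < k.+1%:R by rewrite ltr0n.
  apply: (@le_trans _ _ ((k.+1%:R * CJ) `^ (- s) *
    \sum_(0 <= i < (J * k.+1).*2) nc (lam tau (k.+1, i%:Z - (J * k.+1)%:Z)) ^- 2)); last first.
    rewrite mulr_sumr; apply: ler_sum_nat => i /andP[_ iJ]; rewrite /esum_term /=.
    set p := (_, _); have l0 := nc_lam_up_gt0 (p := p) isT.
    rewrite opprD powRDp // powRN2 ?(ltW l0) // mulrC.
    rewrite ler_wpM2l ?invr_ge0 ?sqr_ge0 //.
    apply: le_powRN => //; last exact: ltW.
    rewrite /lam /=; apply: le_trans (ncD _ _) _.
    rewrite ncM nc_nat nc_int mulrDr lerD2l -natrM ler_nat; lia.
  have := ler_wpM2l (powR_ge0 (k.+1%:R * CJ) (- s)) (row_lower k).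
  set S := \sum_(_ <= _ < _) _.
  have kb : 0 < k.+1%:R * b by rewrite mulr_gt0.
  have kb' : 0 < (k.+1%:R * b)^-1 by rewrite invr_gt0.
  move=> /(ler_wpM2l (ltW kb')).
  have -> : (k.+1%:R * b)^-1 * ((k.+1%:R * CJ) `^ (- s) * (k.+1%:R * b * S)) =
    (k.+1%:R * CJ) `^ (- s) * S by field; rewrite !gt_eqF.
  apply: le_trans.
  rewrite powRM ?(ltW k0) ?(ltW CJ_gt0) // powRDp // powR_inv1 ?(ltW k0) //.
  have ks1 : k.+1%:R `^ (- s) <= 1.
    have e1 : (1 : R) `^ (- s) = 1 by rewrite powR1.
    by rewrite -[leRHS]e1; apply: le_powRN => //; [rewrite ler1n|exact: ltW].
  rewrite -subr_ge0.
  have -> : (k.+1%:R * b)^-1 * (k.+1%:R `^ (- s) * CJ `^ (- s) * ((1 - Ck / k.+1%:R) * theta)) -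
    CJ `^ (- s) * (theta / b) * (k.+1%:R^-1 * k.+1%:R `^ (- s) - Ck * (k.+1%:R ^+ 2)^-1) =
    CJ `^ (- s) * (theta / b) * (Ck * (k.+1%:R ^+ 2)^-1) * (1 - k.+1%:R `^ (- s)).
    by move: (k.+1%:R) k0 => y y0; field; rewrite !gt_eqF.
  rewrite mulr_ge0 ?subr_ge0 // mulr_ge0 // mulr_ge0 // invr_ge0 sqr_ge0 //.
rewrite -mulr_sumr [leRHS]mulrCA ler_wpM2l // sumrB mulrBr -mulr_sumr.
have sq2 := sum_inv_sqr_le N.
have := ler_wpM2l (mulr_ge0 (ltW s0) Ck_ge0) sq2.
have := sum_powR_ge N (ltW s0); lra.
Qed.
End Lower.

Lemma cvg_powRN_nat (s : R) : 0 < s ->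
  N.+1%:R `^ (- s) @[N --> \oo] --> (0 : R).
Proof.
move=> s0; apply/cvgrPdist_le => e e0; near=> N.
rewrite sub0r normrN ger0_norm ?powR_ge0 //.
have -> : e = ((e^-1) `^ (s^-1)) `^ (- s).
  by rewrite -powRrM mulrN mulVf ?gt_eqF // powR_inv1 ?invrK // invr_ge0 ltW.
apply: le_powRN; [by rewrite powR_gt0 // invr_gt0| |exact: ltW].
apply: (@le_trans _ _ N%:R); last by rewrite ler_nat.
by near: N; exact: nbhs_infty_ger.
Unshelve. all: by end_near. Qed.

Lemma cvg_powRN_right0 (y : R) : 0 < y -> y `^ (- s) @[s --> 0^'+] --> (1 : R).
Proof.
move=> y0; apply: cvg_at_right_filter.
under eq_cvg do rewrite powRE //.
have h : - s * ln y @[s --> (0 : R)] --> (0 : R).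
  have : - s * ln y @[s --> (0 : R)] --> - (0 : R) * ln y.
    by apply: cvgM; [apply: cvgN; exact: cvg_id|exact: cvg_cst].
  by rewrite oppr0 mul0r.
rewrite -expR0; apply: (cvg_comp _ _ h); exact: continuous_expR.
Qed.

Lemma theta_pi (e : R) : 0 < e -> exists J, pi - e <= theta_ J.
Proof.
move=> e0; have e2 : 0 < e / 2 by rewrite divr_gt0.
have /cvgrPdist_le /(_ _ e2) [M [_ HM]] := @cvgy_atan R.
have atM x : M < x -> pi / 2 - e / 2 <= atan x.
  by move=> /HM; rewrite ler_distlC => /andP[? _]; lra.
have [J HJ] : exists J : nat, b * (`|M| + 1) + `|a| <= J%:R.
  exists (Num.bound (b * (`|M| + 1) + `|a|)).
  by rewrite ltW // archi_boundP // addr_ge0 // mulr_ge0 ?ltW //; have := normr_ge0 M; lra.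
exists J; rewrite /theta_.
have M1 : M < `|M| + 1 by have := ler_norm M; lra.
have aa := ler_norm a; have an := ler_norm (- a); rewrite normrN in an.
have h1 : M < (a + J%:R) / b.
  by apply: lt_le_trans M1 _; rewrite ler_pdivlMr // mulrC; lra.
have h2 : M < (J%:R - a) / b.
  by apply: lt_le_trans M1 _; rewrite ler_pdivlMr // mulrC; lra.
have -> : (a - J%:R) / b = - ((J%:R - a) / b) by rewrite -mulNr opprB.
rewrite atanN; have := atM _ h1; have := atM _ h2; lra.
Qed.

(** The upper and the lower bounds tend to pi / b and to theta / b with s; theta is
    as close to pi as desired. Geometrically, pi / b is the area of the half
    disc of radius 1 over the area of a fundamental parallelogram, times 2. *)
Lemma epstein_residue (L : R -> C) :
  (forall s, 0 < s -> has_sum (fun p : nat * int =>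
     if (0 < p.1)%N then apow s (lam tau p) else 0) (L s)) ->
  s%:C * L s @[s --> 0^'+] --> (pi / b)%:C.
Proof.
move=> HL.
have HLr s : 0 < s -> has_sum (fun p => (esum_term s p)%:C) (L s).
  move=> /HL; apply: eq_has_sum => p; rewrite /esum_term /apow.
  by case: ifP.
pose l s := complex.Re (L s).
have real : s * l s @[s --> 0^'+] --> pi / b.
  have ub s : 0 < s -> s * l s <= b `^ (- s) * (pi / b) * (1 + s + 2 * Ck * s).
    move=> s0; rewrite mulrC -ler_pdivlMr //.
    apply: has_sum_real_le (HLr s s0) => A.
    by rewrite ler_pdivlMr // mulrC; exact: epstein_upper.
  have lb s J : 0 < s ->
     CJ_ J `^ (- s) * (theta_ J / b) * (1 - 2 * Ck * s) <= s * l s.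
    move=> s0; have H : CJ_ J `^ (- s) * (theta_ J / b) * (1 - N.+1%:R `^ (- s) - 2 * Ck * s)
       @[N --> \oo] --> CJ_ J `^ (- s) * (theta_ J / b) * (1 - 0 - 2 * Ck * s).
      apply: cvgM; first exact: cvg_cst.
      apply: cvgB; last exact: cvg_cst.
      by apply: cvgB; [exact: cvg_cst|exact: cvg_powRN_nat].
    rewrite subr0 in H; apply: (cvgr_to_le H); apply: nearW => N.
    apply: le_trans (epstein_lower J N s0) _; rewrite ler_wpM2l ?(ltW s0) //.
    have e0 p : 0 <= esum_term s p.
      by rewrite /esum_term; case: ifP => // _; exact: powR_ge0.
    exact: (has_sum_real_ge e0 (idx_uniq J N s0) (HLr s s0)).
  have cs (y : R) : y * s @[s --> 0^'+] --> (0 : R).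
    rewrite -[X in _ --> X](mulr0 y); apply: cvgM; first exact: cvg_cst.
    exact: cvg_at_right_filter.
  have ubc : b `^ (- s) * (pi / b) * (1 + s + 2 * Ck * s) @[s --> 0^'+] --> pi / b.
    have : b `^ (- s) * (pi / b) * (1 + s + 2 * Ck * s) @[s --> 0^'+] -->
        1 * (pi / b) * (1 + 0 + 0).
      apply: cvgM; first by apply: cvgM; [exact: cvg_powRN_right0|exact: cvg_cst].
      apply: cvgD; last exact: cs.
      by apply: cvgD; [exact: cvg_cst|exact: cvg_at_right_filter].
    by rewrite !addr0 mul1r mulr1.
  have lbc J : CJ_ J `^ (- s) * (theta_ J / b) * (1 - 2 * Ck * s) @[s --> 0^'+] -->
      theta_ J / b.
    have : CJ_ J `^ (- s) * (theta_ J / b) * (1 - 2 * Ck * s) @[s --> 0^'+] -->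
        1 * (theta_ J / b) * (1 - 0).
      apply: cvgM; first by apply: cvgM; [exact/cvg_powRN_right0/CJ_gt0|exact: cvg_cst].
      by apply: cvgB; [exact: cvg_cst|exact: cs].
    by rewrite !subr0 mul1r mulr1.
  apply/cvgrPdist_le => e e0; have e2 : 0 < e / 2 by rewrite divr_gt0.
  have [J HJ] := theta_pi (mulr_gt0 e2 tau_up).
  have HJ2 : pi / b - e / 2 <= theta_ J / b.
    by rewrite ler_pdivlMr // mulrBl divfK ?gt_eqF.
  have /cvgrPdist_le /(_ _ e2) Hu := ubc.
  have /cvgrPdist_le /(_ _ e2) Hl := lbc J.
  near=> s.
  have s0 : 0 < s by near: s; exact: nbhs_right_gt.
  have u1 : `|pi / b - b `^ (- s) * (pi / b) * (1 + s + 2 * Ck * s)| <= e / 2.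
    by near: s.
  have l1 : `|theta_ J / b - CJ_ J `^ (- s) * (theta_ J / b) * (1 - 2 * Ck * s)| <= e / 2.
    by near: s.
  move: u1 l1; rewrite !ler_distlC => /andP[_ u1] /andP[l1 _].
  have := ub s s0; have := lb s J s0.
  by move=> h1 h2; apply/andP; split; lra.
apply: cvg_trans (cvg_realC real); apply: near_eq_cvg; near=> s.
have s0 : 0 < s by near: s; exact: nbhs_right_gt.
by rewrite rmorphM /= /l -(has_sum_real (HLr s s0)).
Unshelve. all: by end_near. Qed.
End EpsteinResidue.

(** * The regularized Eisenstein series of weight two *)

Section HeckeLimit.
Variable R : realType.
Local Notation C := R[i].
Local Notation nc := ComplexField.Normc.normc.

(** The value of an absolutely summable family; the name makes limits in a
    parameter statable. *)
Definition usum (I : choiceType) (f : I -> C) : C :=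
  lim (\sum_(i <- (A : {fset I})) f i @[A --> totally]).

Lemma usumP (I : choiceType) (f : I -> C) :
  bsum (fun i => nc (f i)) -> has_sum f (usum f).
Proof.
move=> /bsum_has_sum [L fL]; suff -> : usum f = L by [].
exact: cvgC_lim.
Qed.

Lemma has_sum0 (I : choiceType) : has_sum (fun _ : I => 0 : C) 0.
Proof.
have := @has_sum_fin R I (fun=> 0) fset0; rewrite big_seq_fset0; exact.
Qed.

Lemma has_sumB (I : choiceType) (f g : I -> C) L M :
  has_sum f L -> has_sum g M -> has_sum (fun i => f i - g i) (L - M).
Proof.
move=> fL gM; rewrite -mulN1r; apply: has_sumD fL _.
apply: (eq_has_sum _ (has_sumZ (c := -1) gM)) => i; exact: mulN1r.
Qed.

Lemma cvg_powR_right0 (y : R) : 0 < y -> y `^ s @[s --> 0^'+] --> (1 : R).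
Proof.
move=> y0; have yi : 0 < y^-1 by rewrite invr_gt0.
have E s : y `^ s = y^-1 `^ (- s) by rewrite !powRE // lnV ?posrE // mulrNN.
by under eq_cvg do rewrite E; exact: cvg_powRN_right0.
Qed.

Variable tau : C.
Hypothesis tau_up : 0 < complex.Im tau.
Local Notation b := (complex.Im tau).
Local Notation lam := (lam tau).

Lemma lamS m n : lam (m, n + 1) = lam (m, n) + 1.
Proof. by rewrite /lam /= intrD addrA. Qed.

Lemma nc_ipow2 (s : R) (x : C) : x != 0 -> nc (ipow2 s x) = nc x `^ (- (2 + s)).
Proof.
rewrite -nc_gt0 => x0; rewrite /ipow2 ncV ncM ncX nc_real ger0_norm ?powR_ge0 //.
by rewrite powRN powRDp // (powR_mulrn 2) // ltW.
Qed.

Lemma nc_apow (s : R) (x : C) : nc (apow s x) = nc x `^ (- (2 + s)).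
Proof. by rewrite nc_real ger0_norm // powR_ge0. Qed.

(** The majorant is a multiple of |lambda|^(-3), summable over the half lattice and
    over each row. *)
Lemma hecke_err_dominated : exists2 g : nat * int -> R,
  (forall p, 0 <= g p) /\ bsum g &
  (forall s p, 0 <= s <= 1 ->
    nc (if (0 < p.1)%N then hecke_err s (lam p) else 0) <= g p) /\
  (forall m, (0 < m)%N -> bsum (fun n => g (m, n))).
Proof.
have [c c01 cP] := nc_lam_half tau_up.
set K := (2 / c + 6 / c ^+ 2 + 1 + 72 / c ^+ 5) / c.
have K0 : 0 <= K.
  have /andP[c0 _] := c01.
  have ci n : 0 <= (c ^+ n)^-1 by rewrite invr_ge0 exprn_ge0 // ltW.
  apply: divr_ge0; last exact: ltW.
  have := ci 1%N; have := ci 2%N; have := ci 5%N; rewrite expr1; lra.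
exists (fun p => K * (if half p then nc (lam p) `^ (- 3) else 0)).
  split; first by move=> p; rewrite mulr_ge0 //; case: ifP => // _; exact: powR_ge0.
  apply: bsumZ => //.
  have a1 : (1 : R) < 3 / 2 by lra.
  apply: bsum_le (bsum_half tau_up a1) => p; case: ifP => // _.
  by have -> : 2 * (3 / 2) = 3 :> R by field.
split.
  move=> s [m n] s01 /=; case: ifP => m0; last first.
    by rewrite nc0 mulr_ge0 //; case: ifP => // _; exact: powR_ge0.
  have hp : half (m, n) by rewrite /half /= m0.
  have hp1 : half (m, n + 1) by rewrite /half /= m0.
  rewrite hp; apply: nc_hecke_err => //; rewrite -?lamS.
  - exact: lam_neq0.
  - exact: lam_neq0.
  - exact: cP.
  - exact: cP.
move=> m m0; apply: bsumZ => //.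
have a1 : (1 : R) < 3 by lra.
apply: bsum_le (bsum_row tau_up a1 m0) => n; rewrite ifT //.
by rewrite /half m0.
Qed.

(** Symmetric partial sums telescope to a difference of two boundary terms of order
    1 / N. *)
Lemma row_ipow_telescope (s : R) (m : nat) : 0 <= s <= 1 -> (0 < m)%N ->
  has_sum (fun n : int => ipow s (lam (m, n)) - ipow s (lam (m, n) + 1)) 0.
Proof.
move=> s01 m0; have /andP[s0 s1] := s01.
have [g [g0 _] [gP grow]] := hecke_err_dominated.
have hp n : half (m, n) by rewrite /half /= m0.
have l0 n : lam (m, n) != 0 by exact: lam_neq0.
have bd : bsum (fun n : int => nc (ipow s (lam (m, n)) - ipow s (lam (m, n) + 1))).
  have a1 : 1 < 2 + s by lra.
  apply: bsum_le (bsumD (bsumZ (_ : 0 <= 1 + s / 2) (bsum_row tau_up a1 m0))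
    (bsumD (bsumZ (_ : 0 <= s / 2) (bsum_row tau_up a1 m0)) (grow m m0))) => [n||].
  - have := gP s (m, n) s01; rewrite /= m0 => Hg.
    have -> : ipow s (lam (m, n)) - ipow s (lam (m, n) + 1) =
      (1 + s / 2)%:C * ipow2 s (lam (m, n)) + ((s / 2)%:C * apow s (lam (m, n))
      - hecke_err s (lam (m, n))) by rewrite /hecke_err; ring.
    apply: le_trans (ncD _ _) _; rewrite ncM nc_real nc_ipow2 // ger0_norm; last lra.
    rewrite lerD2l; apply: le_trans (ncB _ _) _.
    by rewrite ncM nc_real nc_apow ger0_norm ?lerD2l // divr_ge0.
  - lra.
  - lra.
have [S HS] := bsum_has_sum bd; suff -> : 0 = S by [].
pose G (N : nat) := [fset n in [seq i%:Z - N%:Z | i <- index_iota 0 N.*2]]%fset.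
have us N : uniq [seq i%:Z - N%:Z | i <- index_iota 0 N.*2].
  by rewrite map_inj_uniq ?iota_uniq // => i j E; lia.
have H : \sum_(n <- G N) (ipow s (lam (m, n)) - ipow s (lam (m, n) + 1))
    @[N --> \oo] --> S.
  apply: (@has_big_sub C 0 +%R int nat \oo G _ S _ _ HS) => A.
  exists (\max_(n <- A) `|n|).+1%N => // N /= NA; apply/fsubsetP => n nA.
  have nM : (`|n| < N)%N.
    by apply: leq_ltn_trans NA; apply: leq_bigmax_seq.
  have -> : (n \in G N) = (n \in [seq i%:Z - N%:Z | i <- index_iota 0 N.*2]).
    by rewrite /G; move: [seq _ | _ <- _] => t; rewrite !inE.
  by apply/mapP; exists (absz (n + N%:Z)); [rewrite mem_index_iota /=; lia|lia].
have tel N n : \sum_(0 <= i < n) (ipow s (lam (m, i%:Z - N%:Z)) -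
     ipow s (lam (m, i%:Z - N%:Z) + 1)) =
   ipow s (lam (m, - N%:Z)) - ipow s (lam (m, n%:Z - N%:Z)).
  elim: n => [|n IH]; first by rewrite big_geq // sub0r subrr.
  rewrite big_nat_recr //= IH -lamS.
  have -> : n%:Z - N%:Z + 1 = n.+1%:Z - N%:Z by lia.
  ring.
have [c /andP[c0 c1] cP] := nc_lam_ge tau_up.
have nb (n : int) : nc (ipow s (lam (m, n))) <= c ^- 2 * (1 + `|n|%N%:R)^-1.
  have n0 : (0 : R) <= `|n|%N%:R by [].
  have n1 : (0 : R) < 1 + `|n|%N%:R by lra.
  have ln : c * (1 + `|n|%N%:R) <= nc (lam (m, n)).
    by apply: le_trans (cP (m, n)) => /=; rewrite ler_pM2l // lerD2r ler1n.
  have cl : c <= nc (lam (m, n)).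
    by apply: le_trans ln; rewrite ler_peMr ?(ltW c0) //; lra.
  rewrite /ipow ncV ncM nc_real ger0_norm ?powR_ge0 //.
  have cs : c <= nc (lam (m, n)) `^ s.
    apply: (@le_trans _ _ (c `^ s)).
      by rewrite -[leLHS]powRr1 ?(ltW c0) //; apply: ger_powR => //; rewrite c0.
    by rewrite ge0_ler_powR ?nnegrE ?nc_ge0 // ltW.
  rewrite -invfM lef_pV2 ?posrE ?mulr_gt0 ?exprn_gt0 ?nc_gt0 ?powR_gt0 ?nc_gt0 //.
  have -> : c ^+ 2 * (1 + `|n|%N%:R) = (c * (1 + `|n|%N%:R)) * c by ring.
  by apply: ler_pM => //; rewrite ?mulr_ge0 // ltW.
apply: (cvgC_unique (F := \oo) _ H).
apply: (@cvgC_squeeze _ _ _ _ _ (fun N => 2 * c ^- 2 * (@harmonic R N))).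
  apply: nearW => N; rewrite /G (big_fset_uniq _ _ (us N)) big_map subr0 tel.
  apply: le_trans (ncB _ _) _.
  have h1 := nb (- N%:Z); rewrite abszN absz_nat nat1r in h1.
  have h2 := nb (N.*2%:Z - N%:Z).
  have E : N.*2%:Z - N%:Z = N%:Z by lia.
  rewrite E absz_nat nat1r in h2; rewrite E.
  apply: le_trans (lerD h1 h2) _; rewrite /harmonic /=.
  by rewrite le_eqVlt; apply/orP; left; apply/eqP; ring.
rewrite -[X in _ --> X](mulr0 (2 * c ^- 2)); apply: cvgM; first exact: cvg_cst.
exact: cvg_harmonic.
Qed.

Let up (f : C -> C) (p : nat * int) : C := if (0 < p.1)%N then f (lam p) else 0.

Lemma hecke_err_cvg (x : C) : x != 0 -> x + 1 != 0 ->
  hecke_err s x @[s --> 0^'+] --> hecke_err 0 x.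
Proof.
move=> x0 x1.
have s2 : (s / 2)%:C @[s --> 0^'+] --> ((0 : R) / 2)%:C.
  apply: cvg_realC; apply: cvgM; last exact: cvg_cst.
  exact: cvg_at_right_filter.
have s12 : (1 + s / 2)%:C @[s --> 0^'+] --> (1 + (0 : R) / 2)%:C.
  apply: cvg_realC; apply: cvgD; first exact: cvg_cst.
  apply: cvgM; last exact: cvg_cst.
  exact: cvg_at_right_filter.
have pw (y : C) : y != 0 -> (nc y `^ s)%:C @[s --> 0^'+] --> (nc y `^ (0 : R))%:C.
  by rewrite powRr0 -nc_gt0 => y0; apply: cvg_realC; exact: cvg_powR_right0.
have pn0 (y : C) : y != 0 -> (nc y `^ (0 : R))%:C != 0.
  by move=> _; rewrite powRr0 rmorph1 oner_neq0.
have ip (y : C) : y != 0 -> ipow s y @[s --> 0^'+] --> ipow 0 y.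
  move=> y0; apply: cvgV; first by rewrite mulf_neq0 ?pn0.
  by apply: cvgM; [exact: cvg_cst|exact: pw].
have ip2 : ipow2 s x @[s --> 0^'+] --> ipow2 0 x.
  apply: cvgV; first by rewrite mulf_neq0 ?pn0 // expf_neq0.
  by apply: cvgM; [exact: cvg_cst|exact: pw].
have ap : apow s x @[s --> 0^'+] --> apow 0 x.
  have E s : nc x `^ (- (2 + s)) = nc x `^ (- 2) * nc x `^ (- s).
    by rewrite opprD powRDp // nc_gt0.
  rewrite /apow; under eq_cvg do rewrite E; rewrite E oppr0 powRr0.
  apply: cvg_realC; apply: cvgM; first exact: cvg_cst.
  by apply: cvg_powRN_right0; rewrite nc_gt0.
apply: cvgB; last by apply: cvgB; exact: ip.
exact: (cvgD (cvgM s12 ip2) (cvgM s2 ap)).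
Qed.

(** Summing the telescoping approximation over the upper half lattice kills the
    differences, row by row. The error is dominated, so its sum tends to its value
    at s = 0, which by the same telescoping is the Eisenstein series of weight two
    in its row by row order of summation. The remaining term, s/2 times the
    sum of |lambda|^(-2-s), does not vanish in the limit: it is where
    the non-holomorphic pi / (2 Im tau) comes from. *)
Lemma hecke_limit (rho : nat -> C) :
  (forall m, (0 < m)%N -> has_sum (fun n : int => (lam (m, n) ^+ 2)^-1) (rho m)) ->
  exists2 H0, has_sum (fun m : nat => if (0 < m)%N then rho m else 0) H0 &
  forall U : R -> C, (forall s, 0 < s -> has_sum (up (ipow2 s)) (U s)) ->
   U s @[s --> 0^'+] --> H0 - (pi / (2 * b))%:C.
Proof.
move=> rhoP.
have [g [g0 bg] [gP grow]] := hecke_err_dominated.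
have Hs s : 0 <= s <= 1 -> has_sum (up (hecke_err s)) (usum (up (hecke_err s))).
  by move=> s01; apply: usumP; apply: bsum_le bg => p; exact: gP.
set H0 := usum (up (hecke_err 0)).
have z01 : 0 <= (0 : R) <= 1 by rewrite lexx ler01.
exists H0.
  apply: (has_sum_fubini (Hs 0 z01)) => m /=; rewrite /up /=.
  case: ifPn => m0; last exact: has_sum0.
  have := has_sumB (rhoP m m0) (row_ipow_telescope z01 m0); rewrite subr0.
  apply: eq_has_sum => n; rewrite /hecke_err /ipow2 powRr0 mul0r addr0.
  by rewrite rmorph1 mul1r mulr1 rmorph0 mul0r addr0.
move=> U UP.
pose E s := usum (up (apow s)).
have EP s : 0 < s -> has_sum (up (apow s)) (E s).
  move=> s0; apply: usumP.
  have a1 : 1 < 1 + s / 2 by rewrite ltrDl divr_gt0.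
  apply: bsum_le (bsum_half tau_up a1) => p; rewrite /up.
  case: ifPn => m0; last by rewrite nc0; case: ifP => // _; exact: powR_ge0.
  rewrite ifT; last by rewrite /half m0.
  by rewrite nc_apow; have -> : 2 * (1 + s / 2) = 2 + s by field.
have key s : 0 < s <= 1 ->
    (1 + s / 2)%:C * U s + (s / 2)%:C * E s - usum (up (hecke_err s)) = 0.
  move=> /andP[s0 s1]; have s01 : 0 <= s <= 1 by rewrite ltW.
  have S := has_sumB (has_sumD (has_sumZ (c := (1 + s / 2)%:C) (UP s s0))
    (has_sumZ (c := (s / 2)%:C) (EP s s0))) (Hs s s01).
  have S0 := has_sum_fubini S; apply: (has_sum_unique (S0 (fun=> 0) _)); last exact: has_sum0.
  move=> m; rewrite /up /=; case: (boolP (0 < m)%N) => m0.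
    apply: (eq_has_sum _ (row_ipow_telescope s01 m0)) => n.
    by rewrite /hecke_err; ring.
  apply: (eq_has_sum _ (has_sum0 int)) => n; rewrite !mulr0 addr0 subr0 //.
have cvgH : usum (up (hecke_err s)) @[s --> 0^'+] --> H0.
  have near01 : \forall s \near (0 : R)^'+, 0 <= s <= 1.
    near=> s; apply/andP; split.
      by apply: ltW; near: s; exact: nbhs_right_gt.
    by near: s; exact: nbhs_right_le.
  apply: (tannery_sum (f := fun s => up (hecke_err s)) (f0 := up (hecke_err 0)) _ g0 bg) (Hs 0 z01).
  - move=> p; rewrite /up; case: ifPn => m0; last exact: cvg_cst.
    have hp q : half (p.1, q) by rewrite /half m0.
    apply: hecke_err_cvg; first by apply: lam_neq0 => //; case: (p) hp => ? ?; exact.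
    by case: (p) hp => m n hp; rewrite -lamS; exact: lam_neq0.
  - by apply: filterS near01 => s s01 p; exact: gP.
  - by apply: filterS near01 => s; exact: Hs.
have cvgE := epstein_residue tau_up EP.
have s12 : (1 + s / 2)%:C @[s --> 0^'+] --> (1 : C).
  have : (1 + s / 2)%:C @[s --> 0^'+] --> (1 + (0 : R) / 2)%:C.
    apply: cvg_realC; apply: cvgD; first exact: cvg_cst.
    apply: cvgM; last exact: cvg_cst.
    exact: cvg_at_right_filter.
  by rewrite mul0r addr0.
have lim : (usum (up (hecke_err s)) - (1 / 2)%:C * (s%:C * E s)) * ((1 + s / 2)%:C)^-1
    @[s --> 0^'+] --> (H0 - (1 / 2)%:C * (pi / b)%:C) * 1^-1.
  apply: cvgM; last by apply: cvgV; [exact: oner_neq0|exact: s12].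
  apply: cvgB; first exact: cvgH.
  by apply: cvgM; [exact: cvg_cst|exact: cvgE].
have -> : H0 - (pi / (2 * b))%:C = (H0 - (1 / 2)%:C * (pi / b)%:C) * 1^-1.
  rewrite invr1 mulr1 -rmorphM; congr (_ - _%:C); field; by rewrite gt_eqF.
apply: cvg_trans lim; apply: near_eq_cvg; near=> s.
have s01 : 0 < s <= 1.
  by apply/andP; split; near: s; [exact: nbhs_right_gt|exact: nbhs_right_le].
have := key s s01; have /andP[s0 _] := s01.
have d0 : (1 + s / 2)%:C != 0.
  by rewrite fmorph_eq0 gt_eqF // addr_gt0 // divr_gt0.
have -> : (s / 2)%:C = (1 / 2)%:C * s%:C by rewrite -rmorphM; congr (_%:C); ring.
move: (usum _) (E s) (U s) ((1 + s / 2)%:C) d0 => h e u d d0 K.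
have -> : h = d * u + (1 / 2)%:C * s%:C * e by apply/esym/subr0_eq.
by field.
Unshelve. all: by end_near. Qed.
End HeckeLimit.

(** * Products over one row of the lattice *)

Section ThetaProduct.
Variable R : realType.
Local Notation C := R[i].
Local Notation nc := ComplexField.Normc.normc.

Lemma pii_neq0 : pii R != 0.
Proof.
rewrite /pii mulf_neq0 //; last by rewrite eq_complex /= oner_eq0 andbF.
by rewrite fmorph_eq0 gt_eqF // pi_gt0.
Qed.

Lemma csinh_cexp (v : C) : csinh v = - (cexp (- v) * (1 - cexp (2 * v)) / 2).
Proof.
rewrite /csinh cexpMn cexpN; have := cexp_neq0 v.
by move: (cexp v) => e e0; field.
Qed.

Lemma sym_prod (f : int -> C) N :
  \prod_(0 <= i < N.*2.+1) f (i%:Z - N%:Z) =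
  f 0 * \prod_(0 <= k < N) (f k.+1%:Z * f (- k.+1%:Z)).
Proof.
elim: N => [|N IH]; first by rewrite big_nat1 big_geq // mulr1 subrr.
rewrite doubleS big_nat_recr // big_nat_recl // /=.
have -> : \prod_(0 <= i < N.*2.+1) f (i.+1%:Z - N.+1%:Z) =
   \prod_(0 <= i < N.*2.+1) f (i%:Z - N%:Z).
  by apply: eq_bigr => i _; congr f; lia.
rewrite IH [in RHS]big_nat_recr //=.
have -> : N.*2.+2%:Z - N.+1%:Z = N.+1%:Z by lia.
have -> : 0%:Z - N.+1%:Z = - N.+1%:Z by lia.
ring.
Qed.

Lemma has_prod_sym (f : int -> C) L : has_prod f L ->
  f 0 * \prod_(0 <= k < N) (f k.+1%:Z * f (- k.+1%:Z)) @[N --> \oo] --> L.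
Proof.
move=> fL.
pose s N := [seq i%:Z - N%:Z | i <- index_iota 0 N.*2.+1].
have us N : uniq (s N) by rewrite map_inj_uniq ?iota_uniq // => i j E; lia.
have E N : f 0 * \prod_(0 <= k < N) (f k.+1%:Z * f (- k.+1%:Z)) =
    \prod_(n <- [fset n in s N]%fset) f n.
  by rewrite (big_fset_uniq _ _ (us N)) big_map sym_prod.
under eq_cvg do rewrite E.
apply: (@has_big_sub C 1 *%R int nat \oo (fun N => [fset n in s N]%fset) _ _ _ _ fL) => A.
exists (\max_(n <- A) `|n|).+1%N => // N /= NA; apply/fsubsetP => n nA.
have nM : (`|n| < N)%N by apply: leq_ltn_trans NA; apply: leq_bigmax_seq.
have -> : (n \in [fset n in s N]%fset) = (n \in s N) by move: (s N) => t; rewrite !inE.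
by apply/mapP; exists (absz (n + N%:Z)); [rewrite mem_index_iota /=; lia|lia].
Qed.

(** Euler's product at x + z, x - z and x: the factors of indices n and - n on the
    left combine into those of the three sine products. *)
Lemma row_product (z x : C) (L : C) :
  (forall n : int, x + n%:~R != 0) -> csinh (pii R * x) != 0 ->
  has_prod (fun n : int => 1 - z ^+ 2 / (x + n%:~R) ^+ 2) L ->
  L = csinh (pii R * (x + z)) * csinh (pii R * (x - z)) / csinh (pii R * x) ^+ 2.
Proof.
move=> xn0 sx0 HL.
have x0 : x != 0 by have := xn0 0; rewrite addr0.
have S (y : C) : \prod_(0 <= k < N) (1 - y ^+ 2 / k.+1%:R ^+ 2) @[N --> \oo] -->
    shc (pii R * y) by exact: (@has_big_nat C 1 *%R _ _ (@has_prod_sinpi R y)).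
have Sx0 : shc (pii R * x) != 0.
  by move: sx0; rewrite csinhE mulf_eq0 negb_or => /andP[].
have lim : (1 - z ^+ 2 / x ^+ 2) *
   ((\prod_(0 <= k < N) (1 - (x + z) ^+ 2 / k.+1%:R ^+ 2) *
     \prod_(0 <= k < N) (1 - (x - z) ^+ 2 / k.+1%:R ^+ 2)) *
    (\prod_(0 <= k < N) (1 - x ^+ 2 / k.+1%:R ^+ 2) *
     \prod_(0 <= k < N) (1 - x ^+ 2 / k.+1%:R ^+ 2))^-1) @[N --> \oo] -->
   (1 - z ^+ 2 / x ^+ 2) * ((shc (pii R * (x + z)) * shc (pii R * (x - z))) *
     (shc (pii R * x) * shc (pii R * x))^-1).
  apply: cvgM; first exact: cvg_cst.
  apply: cvgM; first by exact: (cvgM (S _) (S _)).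
  apply: cvgV; first by rewrite mulf_neq0.
  exact: (cvgM (S _) (S _)).
have := has_prod_sym HL.
have E N : (1 - z ^+ 2 / (x + 0%:~R) ^+ 2) * \prod_(0 <= k < N)
    ((1 - z ^+ 2 / (x + (k.+1%:Z)%:~R) ^+ 2) *
     (1 - z ^+ 2 / (x + (- k.+1%:Z)%:~R) ^+ 2)) =
   (1 - z ^+ 2 / x ^+ 2) *
   ((\prod_(0 <= k < N) (1 - (x + z) ^+ 2 / k.+1%:R ^+ 2) *
     \prod_(0 <= k < N) (1 - (x - z) ^+ 2 / k.+1%:R ^+ 2)) *
    (\prod_(0 <= k < N) (1 - x ^+ 2 / k.+1%:R ^+ 2) *
     \prod_(0 <= k < N) (1 - x ^+ 2 / k.+1%:R ^+ 2))^-1).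
  rewrite addr0; congr (_ * _); rewrite -!big_split -prodfV -big_split /=.
  apply: eq_bigr => k _.
  have h1 := xn0 k.+1%:Z; have h2 := xn0 (- k.+1%:Z); rewrite rmorphN /= in h2 *.
  have k0 : (k.+1%:R : C) != 0 by rewrite pnatr_eq0.
  have e1 : (k.+1%:Z)%:~R = k.+1%:R :> C by [].
  rewrite e1 in h1 h2 *; move: (k.+1%:R : C) k0 h1 h2 => y y0 h1 h2.
  have h3 : y ^+ 2 - x ^+ 2 != 0.
    have -> : y ^+ 2 - x ^+ 2 = - ((x + y) * (x - y)) by ring.
    by rewrite oppr_eq0 mulf_neq0.
  have -> : 1 - x ^+ 2 / y ^+ 2 = (y ^+ 2 - x ^+ 2) / y ^+ 2 by field.
  by field; rewrite y0 h1 h2 h3.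
under eq_cvg do rewrite E.
move=> HL'; rewrite (cvgC_unique HL' lim).
rewrite !csinhE; have p0 := pii_neq0.
move: Sx0; move: (shc (pii R * (x + z))) (shc (pii R * (x - z))) (shc (pii R * x)).
by move: (pii R) p0 => p p0 s1 s2 s3 s30; field; rewrite x0 p0 s30.
Qed.

(** Puts the sine product on the row m = 0 of the half lattice. *)
Lemma has_prod_pos_int (f : C -> C) L : has_prod (fun k : nat => f k.+1%:R) L ->
  has_prod (fun n : int => if 0 < n then f n%:~R else 1) L.
Proof.
apply: (@has_big_reindex C 1 *%R nat int xpredT (fun n : int => 0 < n)
  (fun k => k.+1%:Z) (fun n => `|n|.-1)) => //.
- by move=> n n0; split => //; lia.
- by move=> n /negbTE ->.
Qed.

Variable tau : C.
Hypothesis tau_up : 0 < complex.Im tau.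
Local Notation b := (complex.Im tau).
Local Notation lam := (lam tau).
Local Notation q := (qpow tau 1).

Lemma Re_2pii (w : C) : complex.Re (2 * pii R * w) = - (2 * pi * complex.Im w).
Proof.
have -> : 2 * pii R = (2 * pi : R)%:C * 'i by rewrite /pii rmorphM rmorph_nat mulrA.
by case: w => x y /=; ring.
Qed.

Lemma qpow1E (w : C) : qpow w 1 = cexp (2 * pii R * w).
Proof. by rewrite /qpow rmorph1 mulr1. Qed.

Lemma nc_q : nc q < 1.
Proof.
rewrite qpow1E nc_cexp -expR0 ltr_expR.
by rewrite Re_2pii oppr_lt0 !mulr_gt0 // pi_gt0.
Qed.

Lemma q_neq0 : q != 0. Proof. exact: cexp_neq0. Qed.

Lemma qpow_nat (m : nat) : cexp (2 * (pii R * (m%:R * tau))) = q ^+ m.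
Proof. by rewrite qpow1E -cexpMn; congr cexp; ring. Qed.

Lemma bsum_row_sqr (z : C) m : (0 < m)%N ->
  bsum (fun n : int => nc (z ^+ 2 / lam (m, n) ^+ 2)).
Proof.
move=> m0; have a1 : (1 : R) < 2 by lra.
apply: bsum_le (bsumZ (sqr_ge0 (nc z)) (bsum_row tau_up a1 m0)) => n.
by rewrite ncM ncV !ncX powRN2 ?nc_ge0.
Qed.

(** The m-th factor of the triple product, normalized to 1 at z = 0. *)
Definition theta_row (z : C) (m : nat) : C :=
  (1 - q ^+ m * qpow z 1) * (1 - q ^+ m / qpow z 1) / (1 - q ^+ m) ^+ 2.

Lemma has_prod_theta_row (z : C) m : (0 < m)%N ->
  has_prod (fun n : int => 1 - z ^+ 2 / lam (m, n) ^+ 2) (theta_row z m).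
Proof.
move=> m0.
have l0 n : lam (m, n) != 0 by apply: lam_neq0 => //; rewrite /half /= m0.
have [L HL] : exists L, has_prod (fun n : int => 1 - z ^+ 2 / lam (m, n) ^+ 2) L.
  apply: bsum_has_prod; apply: bsum_le (bsum_row_sqr z m0) => n.
  by rewrite addrAC subrr add0r ncN.
have q1 : 1 - q ^+ m != 0.
  by rewrite -(prednK m0); apply: qfac_factor_neq0; exact: nc_q.
have sm0 : csinh (pii R * (m%:R * tau)) != 0.
  rewrite csinh_cexp qpow_nat oppr_eq0; apply: mulf_neq0.
    by apply: mulf_neq0 q1; exact: cexp_neq0.
  by rewrite invr_eq0 pnatr_eq0.
suff <- : L = theta_row z m by [].
rewrite (row_product (x := m%:R * tau) _ sm0 HL) //.
rewrite !csinh_cexp !qpow_nat /theta_row.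
have -> : cexp (2 * (pii R * (m%:R * tau + z))) = q ^+ m * qpow z 1.
  by rewrite -qpow_nat qpow1E -cexpD; congr cexp; ring.
have -> : cexp (2 * (pii R * (m%:R * tau - z))) = q ^+ m / qpow z 1.
  by rewrite -qpow_nat qpow1E -cexpN -cexpD; congr cexp; ring.
have -> : cexp (- (pii R * (m%:R * tau + z))) =
  cexp (- (pii R * (m%:R * tau))) * cexp (- (pii R * z)).
  by rewrite -cexpD; congr cexp; ring.
have -> : cexp (- (pii R * (m%:R * tau - z))) =
  cexp (- (pii R * (m%:R * tau))) / cexp (- (pii R * z)).
  by rewrite -cexpN -cexpD; congr cexp; ring.
have u0 : qpow z 1 != 0 by exact: cexp_neq0.
have := cexp_neq0 (- (pii R * (m%:R * tau))); have := cexp_neq0 (- (pii R * z)).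
move: (cexp _) (cexp _) (qpow z 1) u0 (q ^+ m) q1 => e f u u0 y y1 e0 f0.
by field; rewrite e0 f0 u0 y1.
Qed.

End ThetaProduct.

(** * The Weierstrass product of the lattice *)

Section WeierstrassProduct.
Variable R : realType.
Local Notation C := R[i].
Local Notation nc := ComplexField.Normc.normc.

Definition uprod (I : choiceType) (f : I -> C) : C :=
  lim (\prod_(i <- (A : {fset I})) f i @[A --> totally]).

Lemma uprodP (I : choiceType) (f : I -> C) :
  bsum (fun i => nc (f i - 1)) -> has_prod f (uprod f).
Proof.
move=> /bsum_has_prod [L fL]; suff -> : uprod f = L by [].
exact: cvgC_lim.
Qed.

(** Weierstrass' elementary factor of genus one. *)
Definition wfac (y : C) : C := (1 - y) * cexp y.

(** The linear terms of the two factors cancel. *)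
Lemma wfac_bound (r : R) (y : C) : nc y <= r ->
  nc (wfac y - 1) <= ((1 + r) * (4 * expR r) + 1) * nc y ^+ 2.
Proof.
move=> yr; have y0 := nc_ge0 y; have r0 := le_trans y0 yr.
have -> : wfac y - 1 = (1 - y) * (cexp y - 1 - y) - y ^+ 2 by rewrite /wfac; ring.
apply: le_trans (ncB _ _) _; rewrite ncM ncX mulrDl mul1r lerD2r.
have h1 : nc (1 - y) <= 1 + r.
  by apply: le_trans (ncB _ _) _; rewrite nc1 lerD2l.
have h2 : nc (cexp y - 1 - y) <= 4 * expR r * nc y ^+ 2.
  apply: le_trans (nc_cexpB1B_le y) _; rewrite mulrAC ler_wpM2r ?sqr_ge0 //.
  by rewrite ler_wpM2l // ler_expR.
by rewrite -mulrA; apply: ler_pM; rewrite ?nc_ge0.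
Qed.

Definition zeta2 : C := usum (fun k : nat => (k.+1%:R ^+ 2)^-1 : C).

Lemma bsum_zeta2 : bsum (fun k : nat => nc ((k.+1%:R ^+ 2)^-1 : C)).
Proof.
by apply: bsum_le (bsum_inv_sqr R) => k; rewrite ncV ncX nc_nat.
Qed.

Lemma has_sum_zeta2 : has_sum (fun k : nat => (k.+1%:R ^+ 2)^-1 : C) zeta2.
Proof. exact: usumP bsum_zeta2. Qed.

Variable tau : C.
Hypothesis tau_up : 0 < complex.Im tau.
Local Notation b := (complex.Im tau).
Local Notation lam := (lam tau).
Local Notation q := (qpow tau 1).

(** The inner sums of the Eisenstein series of weight two. *)
Definition row_sum (m : nat) : C := usum (fun n : int => (lam (m, n) ^+ 2)^-1).

Lemma has_row_sum m : (0 < m)%N ->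
  has_sum (fun n : int => (lam (m, n) ^+ 2)^-1) (row_sum m).
Proof.
move=> m0; apply: usumP; apply: bsum_le (bsum_row_sqr tau_up 1 m0) => n.
by rewrite expr1n mul1r.
Qed.

(** With y = z^2 / lambda^2 each factor accounts for lambda and - lambda, so this is
    the sigma function of the lattice divided by z. *)
Definition wprod (z : C) : C :=
  uprod (fun p => if half p then wfac (z ^+ 2 / lam p ^+ 2) else 1).

Lemma nc_lam_sqrV_le : exists2 r : R, 0 <= r & forall p, half p -> nc (lam p) ^- 2 <= r.
Proof.
have [c /andP[c0 _] cP] := nc_lam_half tau_up.
exists (c ^- 2); first by rewrite invr_ge0 sqr_ge0.
move=> p /cP cp; rewrite lef_pV2 ?posrE ?exprn_gt0 //; last exact: lt_le_trans cp.
by rewrite lerXn2r ?nnegrE ?(ltW c0) ?nc_ge0.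
Qed.

(** Factors with y = O(1 / lambda^2) deviate from 1 by O(1 / lambda^4). The majorant
    depends on the implied constant only, since [y] will vary with s. *)
Lemma wfac_bsum (M : R) : 0 <= M -> exists2 g : nat * int -> R,
  (forall p, 0 <= g p) /\ bsum g &
  forall y : nat * int -> C,
    (forall p, half p -> nc (y p) <= M * nc (lam p) ^- 2) ->
    forall p, nc ((if half p then wfac (y p) else 1) - 1) <= g p.
Proof.
move=> M0; have [r r0 rP] := nc_lam_sqrV_le.
set K := (1 + M * r) * (4 * expR (M * r)) + 1.
have K0 : 0 <= K.
  by rewrite addr_ge0 // mulr_ge0 ?mulr_ge0 ?expR_ge0 // addr_ge0 // mulr_ge0.
have KM : 0 <= K * M ^+ 2 by rewrite mulr_ge0 ?sqr_ge0.
exists (fun p => K * M ^+ 2 * (if half p then nc (lam p) `^ (- (2 * 2)) else 0)).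
  split; first by move=> p; rewrite mulr_ge0 //; case: ifP => // _; exact: powR_ge0.
  by apply: bsumZ => //; apply: bsum_half => //; lra.
move=> y yP p; case: ifPn => hp; last by rewrite subrr nc0 mulr0.
have y1 := yP p hp.
have yr : nc (y p) <= M * r by apply: (le_trans y1); rewrite ler_wpM2l // rP.
apply: le_trans (wfac_bound yr) _; rewrite -/K -mulrA ler_wpM2l //.
have -> : nc (lam p) `^ (- (2 * 2)) = (nc (lam p) ^- 2) ^+ 2.
  rewrite -mulrN mulrC powRrM powRN2 ?nc_ge0 // (powR_mulrn 2) //.
  by rewrite invr_ge0 sqr_ge0.
by rewrite -exprMn lerXn2r ?nnegrE ?nc_ge0 // mulr_ge0 // invr_ge0 sqr_ge0.
Qed.

Lemma has_wprod (z : C) :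
  has_prod (fun p => if half p then wfac (z ^+ 2 / lam p ^+ 2) else 1) (wprod z).
Proof.
have [g [_ bg] gP] := wfac_bsum (sqr_ge0 (nc z)).
apply: uprodP; apply: bsum_le bg => p; apply: (gP (fun p => z ^+ 2 / lam p ^+ 2)) => {}p _.
by rewrite ncM ncV !ncX.
Qed.

Lemma wprod_neq0 (z : C) : ~ (lattice tau `\ 0) z -> wprod z != 0.
Proof.
move=> hz; have [g [_ bg] gP] := wfac_bsum (sqr_ge0 (nc z)).
apply: (has_prod_neq0 _ _ (@has_wprod z)).
  by apply: bsum_le bg => p; apply: (gP (fun p => z ^+ 2 / lam p ^+ 2)) => {}p _; rewrite ncM ncV !ncX.
move=> p; case: ifPn => hp; last exact: oner_neq0.
rewrite mulf_neq0 ?cexp_neq0 // subr_eq0; apply/eqP => E.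
have l0 := lam_neq0 tau_up hp.
have zl : z ^+ 2 == lam p ^+ 2.
  by apply/eqP; rewrite -[RHS]mul1r E divfK // expf_neq0.
have z0 : z != 0.
  by apply/eqP => z0; move: zl; rewrite z0 expr0n /= eq_sym expf_eq0 /= (negbTE l0).
apply: hz; split; last by apply/eqP.
move: zl; rewrite eqf_sqr => /orP[] /eqP ->.
  by exists p.1%:Z, p.2.
exists (- p.1%:Z), (- p.2); rewrite /lam !rmorphN /=; ring.
Qed.

Lemma wprod_near0 : wprod w @[w --> (0 : C)] --> (1 : C).
Proof.
have [r r0 rP] := nc_lam_sqrV_le.
have a1 : (1 : R) < 2 by lra.
have [N NP] := bsum_half tau_up a1.
have N0 : 0 <= N by have := NP fset0; rewrite big_seq_fset0.
set K := (1 + r) * (4 * expR r) + 1.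
have K0 : 0 <= K.
  by rewrite addr_ge0 // mulr_ge0 ?mulr_ge0 ?expR_ge0 // addr_ge0.
have near1 : \forall w \near (0 : C), nc w <= 1.
  have /cvgCP /(_ 1 ltr01) : (fun w : C => w) @ (0 : C) --> (0 : C) by exact: cvg_id.
  by apply: filterS => w; rewrite subr0 => /ltW.
apply: (@cvgC_squeeze R C (nbhs (0 : C)) (nbhs_filter (0 : C)) wprod
    (fun w => K * N * expR (K * N) * nc w)).
  apply: filterS near1 => w w1.
  have M0 : 0 <= K * nc w * N by rewrite !mulr_ge0 ?nc_ge0.
  have H := @has_wprod w.
  have H2 : has_prod (fun p => 1 + ((if half p then wfac (w ^+ 2 / lam p ^+ 2) else 1) - 1)) (wprod w).
    by apply: (eq_has_prod _ H) => p; rewrite addrC subrK.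
  apply: le_trans (has_prod_bound (M := K * nc w * N) H2 _) _.
    move=> A; apply: le_trans (ler_wpM2l _ (NP A)); last by rewrite mulr_ge0 ?nc_ge0.
    rewrite mulr_sumr; apply: ler_sum => p _.
    case: ifPn => hp; last by rewrite subrr nc0 mulr0.
    have yr : nc (w ^+ 2 / lam p ^+ 2) <= r.
      rewrite ncM ncV !ncX; apply: le_trans (rP p hp).
      by rewrite ler_piMl ?invr_ge0 ?sqr_ge0 // exprn_ile1 ?nc_ge0.
    apply: le_trans (wfac_bound yr) _; rewrite -/K -(mulrA K) ler_wpM2l //.
    rewrite ncM ncV !ncX exprMn.
    have -> : nc (lam p) `^ (- (2 * 2)) = (nc (lam p) ^- 2) ^+ 2.
      rewrite -mulrN mulrC powRrM powRN2 ?nc_ge0 // (powR_mulrn 2) //.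
      by rewrite invr_ge0 sqr_ge0.
    rewrite ler_wpM2r ?sqr_ge0 // -exprM exprS ler_piMr ?nc_ge0 //.
    by rewrite exprn_ile1 ?nc_ge0.
  have KwN : K * nc w * N <= K * N by rewrite ler_wpM2r // ler_piMr.
  have -> : K * N * expR (K * N) * nc w = K * nc w * N * expR (K * N) by ring.
  by rewrite ler_wpM2l // ler_expR.
have nw : nc w @[w --> (0 : C)] --> (0 : R).
  exact: (@cvg_nc0 R C (nbhs (0 : C)) (nbhs_filter (0 : C)) (fun w => w) (@cvg_id C (nbhs (0 : C)))).
have : K * N * expR (K * N) * nc w @[w --> (0 : C)] --> K * N * expR (K * N) * 0.
  exact: (@cvgM _ _ _ (nbhs_filter (0 : C)) _ _ _ _ (@cvg_cst R^o _ _ _ (nbhs_filter (0 : C))) nw).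
by rewrite mulr0.
Qed.

Variable H0 : C.
Hypothesis H0P : has_sum (fun m : nat => if (0 < m)%N then row_sum m else 0) H0.

(** Row by row the exponentials of the elementary factors can be separated from the
    factors 1 - z^2 / lambda^2, because both are then convergent; over the whole
    lattice the sum of 1 / lambda^2 is only conditionally convergent. The row
    m = 0 gives the sine. *)
Lemma has_prod_rows (z : C) :
  has_prod (fun m => if (0 < m)%N then theta_row tau z m else shc (pii R * z))
    (wprod z * cexp (- (z ^+ 2 * (zeta2 + H0)))).
Proof.
pose r m := if (0 < m)%N then theta_row tau z m * cexp (z ^+ 2 * row_sum m)
  else shc (pii R * z) * cexp (z ^+ 2 * zeta2).
have rP : has_prod r (wprod z).
  apply: (has_prod_fubini (@has_wprod z)) => m; rewrite /r.
  case: (boolP (0 < m)%N) => m0.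
    have hp n : half (m, n) by rewrite /half /= m0.
    have := has_prodM (has_prod_theta_row tau_up (z := z) m0)
      (has_prod_cexp (has_sumZ (c := z ^+ 2) (has_row_sum m0))).
    by apply: eq_has_prod => n; rewrite hp.
  have {m0}-> : m = 0%N by lia.
  have := has_prodM (@has_prod_sinpi R z) (has_prod_cexp (has_sumZ (c := z ^+ 2) has_sum_zeta2)).
  move=> /(@has_prod_pos_int R (fun x => (1 - z ^+ 2 / x ^+ 2) * cexp (z ^+ 2 * (x ^+ 2)^-1))).
  apply: eq_has_prod => n; rewrite /half /= /lam /= mul0r add0r.
  by case: ifP.
have sP : has_sum (fun m => if (0 < m)%N then row_sum m else zeta2) (zeta2 + H0).
  have s1 : has_sum (fun m : nat => if (m == 0)%N then zeta2 else 0) zeta2.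
    have := @has_sum_fin R nat (fun m => if (m == 0)%N then zeta2 else 0) [fset 0%N]%fset.
    by rewrite big_seq_fset1 eqxx; apply => m; rewrite inE => /negbTE ->.
  apply: (eq_has_sum _ (has_sumD s1 H0P)) => m.
  by case: m => [|m] /=; rewrite ?addr0 ?add0r.
have := has_prodM rP (has_prod_cexp (has_sumZ (c := - z ^+ 2) sP)).
rewrite mulNr; apply: eq_has_prod => m; rewrite /r.
by case: ifP => _; rewrite mulNr cexpN mulfK // cexp_neq0.
Qed.
End WeierstrassProduct.

(** * The theta function as a Weierstrass product *)

Section ThetaIdentity.
Variable R : realType.
Local Notation C := R[i].
Local Notation nc := ComplexField.Normc.normc.
Variable tau : C.
Hypothesis tau_up : 0 < complex.Im tau.
Local Notation b := (complex.Im tau).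
Local Notation lam := (lam tau).
Local Notation q := (qpow tau 1).

Lemma cexp_pii : cexp (pii R) = -1.
Proof.
rewrite /cexp /pii /= !mul0r !mulr0 subr0 mulr1 addr0 expR0 cospi sinpi mul1r.
by apply/eqP; rewrite eq_complex /= oppr0 !eqxx.
Qed.

Lemma qpow_natr (n : nat) : qpow tau n%:R = q ^+ n.
Proof.
rewrite qpow1E -cexpMn /qpow rmorph_nat; congr cexp; ring.
Qed.

Lemma dedekind_etaE (Q : C) : has_prod (fun k : nat => 1 - q ^+ k.+1) Q ->
  dedekind_eta tau = qpow tau (24%:R^-1) * Q.
Proof.
move=> HQ; rewrite /dedekind_eta; congr (_ * _); apply: cvgC_lim.
have E N : \prod_(1 <= n < N.+1) (1 - qpow tau n%:R) = qfac q N.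
  by rewrite big_add1 /=; apply: eq_bigr => k _; rewrite qpow_natr.
by under eq_cvg do rewrite E; exact: cvg_qfac.
Qed.

Variable z : C.
Let z' : C := z + tau / 2 + 1 / 2.
(* The general term of the theta series. The shift by (tau + 1) / 2 turns it into
   (- 1)^n u^n q^(n (n + 1) / 2), the coefficients of the triple product. *)
Let t (n : int) : C := qpow z' 1 ^ n * qpow tau (n%:~R ^+ 2 / 2).

Let tE n : t n = cexp (2 * pii R * (n%:~R * z' + n%:~R ^+ 2 / 2 * tau)).
Proof.
rewrite /t qpow1E -cexpMz /qpow -cexpD; congr cexp.
have -> : (n%:~R ^+ 2 / 2 : R)%:C = n%:~R ^+ 2 / 2.
  by rewrite fmorph_div rmorphXn /= rmorph_int rmorph_nat.
ring.
Qed.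

Let t0 : t 0 = 1.
Proof. by rewrite tE mulr0z mul0r expr0n mul0r mul0r addr0 mulr0 cexp0. Qed.

Let tS n : t (n + 1) = - qpow z 1 * q ^ (n + 1) * t n.
Proof.
rewrite !tE -[- _]mulN1r -cexp_pii !qpow1E -cexpMz -!cexpD; congr cexp.
by rewrite /z' intrD; field.
Qed.

(* Completing the square in the exponent - pi b n^2 - 2 pi y n + 2 |n| gives
   |t n| <= const * exp (- 2 |n|) <= const / (1 + |n|)^2. *)
Let bsum_t : bsum (fun n => nc (t n)).
Proof.
set y := complex.Im z'.
set al := 2 * pi * `|y|; set be := pi * b.
have p0 := pi_gt0 R.
have be0 : 0 < be by rewrite mulr_gt0.
have a2 : (1 : R) < 2 by lra.
apply: bsum_le (bsumZ (expR_ge0 ((al + 2) ^+ 2 / (4 * be))) (bsum_int_powR a2)) => n.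
rewrite tE nc_cexp Re_2pii.
have Im2 : complex.Im (n%:~R * z' + n%:~R ^+ 2 / 2 * tau) = n%:~R * y + n%:~R ^+ 2 / 2 * b.
  have e1 : (n%:~R : C) = (n%:~R : R)%:C by rewrite rmorph_int.
  have e2 : (n%:~R ^+ 2 / 2 : C) = (n%:~R ^+ 2 / 2 : R)%:C.
    by rewrite fmorph_div rmorphXn /= rmorph_int rmorph_nat.
  rewrite e2 e1 raddfD /= /y.
  by case: (z') (tau) => x1 y1 [x2 y2] /=; rewrite !mul0r !addr0.
rewrite Im2.
set N : R := `|n|%N%:R; have N0 : 0 <= N by rewrite /N.
have nN : (n%:~R : R) ^+ 2 = N ^+ 2.
  by rewrite /N -[LHS]real_normK ?num_real // -intr_norm -abszE.
have ny : - (n%:~R * y) <= N * `|y|.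
  rewrite /N natr_absz intr_norm -normrM; apply: le_trans (ler_norm _) _.
  by rewrite normrN.
have N1 : 0 < 1 + N by lra.
rewrite powRN2 ?(ltW N1) //.
have e2N : (1 + N) ^+ 2 <= expR (2 * N).
  have -> : 2 * N = N + N by ring.
  by rewrite expRD expr2 ler_pM ?expR_ge1Dx // ltW.
have ineq : 2 * N - 2 * pi * (n%:~R * y + n%:~R ^+ 2 / 2 * b) <= (al + 2) ^+ 2 / (4 * be).
  rewrite nN ler_pdivlMr ?mulr_gt0 //.
  have h : (2 * N - 2 * pi * (n%:~R * y + N ^+ 2 / 2 * b)) <= (al + 2) * N - be * N ^+ 2.
    by have := ler_wpM2l (ltW p0) ny; rewrite /al /be; lra.
  have b4 : 0 <= 4 * be by rewrite mulr_ge0 // ltW.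
  have := ler_wpM2r b4 h; have := sqr_ge0 (al + 2 - 2 * be * N).
  rewrite !expr2; lra.
have e2N0 := expR_gt0 (2 * N).
apply: (@le_trans _ _ (expR ((al + 2) ^+ 2 / (4 * be)) * (expR (2 * N))^-1)).
  by rewrite -expRN -expRD ler_expR; lra.
rewrite ler_wpM2l ?expR_ge0 // lef_pV2 ?posrE // exprn_gt0 //.
Qed.

Lemma jacobi_thetaP : has_sum t (jacobi_theta z' tau).
Proof.
have [S HS] := bsum_has_sum bsum_t; suff -> : jacobi_theta z' tau = S by [].
rewrite /jacobi_theta /summability.sum; apply: cvgC_lim.
move: HS; rewrite /has_sum /has_big; apply: cvg_trans.
apply: near_eq_cvg; apply: nearW => A.
by rewrite /partial_sum big_seq_fsetE.
Qed.

Variable H0 : C.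
Hypothesis H0P : has_sum (fun m : nat => if (0 < m)%N then row_sum tau m else 0) H0.

(** Up to explicit factors both sides are limits of the same products: the triple product on the left,
    the rows of the lattice on the right. The factor 1 - u^-1 is the row m = 0,
    up to exp (- pi i z) and 2 pi i z. *)
Lemma jacobi_theta_product (Q : C) : Q != 0 ->
  has_prod (fun k : nat => 1 - q ^+ k.+1) Q -> shc (pii R * z) != 0 ->
  jacobi_theta z' tau = cexp (- (pii R * z)) * (2 * pii R * z) *
    (wprod tau z * cexp (- (z ^+ 2 * (zeta2 R + H0)))) * Q ^+ 3.
Proof.
move=> Q0 HQ s0.
set u := qpow z 1; set Phi := wprod tau z * _.
have u0 : u != 0 by exact: cexp_neq0.
pose A N := \prod_(0 <= k < N) ((1 - q ^+ k.+1 * u) * (1 - q ^+ k.+1 / u)).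
have H1 : (1 - u^-1) * A N @[N --> \oo] --> jacobi_theta z' tau / Q.
  exact: (triple_product (nc_q tau_up) (q_neq0 tau) u0 t0 tS Q0 HQ bsum_t jacobi_thetaP).
have H2 : shc (pii R * z) * (A N / qfac q N ^+ 2) @[N --> \oo] --> Phi.
  pose F N := \prod_(0 <= m < N) (if (0 < m)%N then theta_row tau z m else shc (pii R * z)).
  have HN : F N @[N --> \oo] --> Phi.
    exact: (@has_big_nat C 1 *%R _ _ (@has_prod_rows R tau tau_up H0 H0P z)).
  have HS : F N.+1 @[N --> \oo] --> Phi.
    by move=> U /HN [M _ MP]; exists M => // N MN; apply: MP; exact: leqW.
  have E N : F N.+1 = shc (pii R * z) * (A N / qfac q N ^+ 2).
    rewrite /F big_nat_recl //=; congr (_ * _).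
    by rewrite /A /qfac -prodrXl -prodfV -big_split.
  by under eq_cvg do rewrite -E.
have H3 : shc (pii R * z) * (jacobi_theta z' tau / Q) = (1 - u^-1) * Phi * Q ^+ 2.
  have Hq := cvg_qfac HQ.
  have L1 : shc (pii R * z) * ((1 - u^-1) * A N) @[N --> \oo] -->
      shc (pii R * z) * (jacobi_theta z' tau / Q).
    by apply: cvgM; [exact: cvg_cst|exact: H1].
  have L2 : (1 - u^-1) * (shc (pii R * z) * (A N / qfac q N ^+ 2)) * qfac q N ^+ 2
      @[N --> \oo] --> (1 - u^-1) * Phi * Q ^+ 2.
    apply: cvgM; last by exact: cvg_sqr Hq.
    by apply: cvgM; [exact: cvg_cst|exact: H2].
  apply: (cvgC_unique (F := \oo) L1).
  have E N : (1 - u^-1) * (shc (pii R * z) * (A N / qfac q N ^+ 2)) * qfac q N ^+ 2 =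
     shc (pii R * z) * ((1 - u^-1) * A N).
    have := qfac_neq0 (nc_q tau_up) N; move: (qfac q N) => y y0.
    by field; rewrite y0 u0.
  by under eq_cvg do rewrite -E.
have uE : 1 - u^-1 = cexp (- (pii R * z)) * (2 * (pii R * z) * shc (pii R * z)).
  rewrite -mulrA -csinhE /csinh /u qpow1E.
  have -> : 2 * pii R * z = pii R * z + pii R * z by ring.
  rewrite cexpD cexpN; have := cexp_neq0 (pii R * z).
  by move: (cexp _) => e e0; field.
move: H3; rewrite uE => H3.
apply: (mulfI s0); apply: (mulIf (invr_neq0 Q0)).
rewrite -[LHS]mulrA H3; by field.
Qed.

(** The three factors [Q] cancel against eta^3, and exp (pi z^2 / (2 Im tau)) is
    exactly the correction produced by the limit in s. *)
Lemma modified_theta_product : shc (pii R * z) != 0 ->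
  modified_theta z tau = 2 * pii R * z *
    (wprod tau z * cexp (- (z ^+ 2 * (zeta2 R + H0 - (pi / (2 * b))%:C)))).
Proof.
move=> s0; have [Q Q0 HQ] := euler_product (nc_q tau_up).
rewrite /modified_theta (jacobi_theta_product Q0 HQ s0) (dedekind_etaE HQ).
have -> : (pi / 2)%:C * (z ^+ 2 / b%:C) = z ^+ 2 * (pi / (2 * b))%:C.
  by rewrite mulrCA -fmorphV -rmorphM; congr (_ * _%:C); field; rewrite gt_eqF.
have -> : - (z ^+ 2 * (zeta2 R + H0 - (pi / (2 * b))%:C)) =
   z ^+ 2 * (pi / (2 * b))%:C + - (z ^+ 2 * (zeta2 R + H0)) by ring.
rewrite (cexpD (z ^+ 2 * _)).
have -> : qpow tau (8%:R^-1) = qpow tau (24%:R^-1) ^+ 3.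
  rewrite /qpow -cexpMn; congr cexp.
  have -> : (8%:R^-1 : R) = 3%:R * 24%:R^-1 by field.
  rewrite rmorphM rmorph_nat; ring.
rewrite cexpN; have := cexp_neq0 (pii R * z).
have : qpow tau 24%:R^-1 != 0 by exact: cexp_neq0.
move: (qpow tau _) (cexp (pii R * z)) (cexp (z ^+ 2 * _)) (cexp (- _)) => w e f g w0 e0.
by field; rewrite w0 e0 Q0.
Qed.
End ThetaIdentity.

(** * Primitive vectors *)

Section PrimitiveVectors.
Variable R : realType.
Local Notation C := R[i].
Local Notation nc := ComplexField.Normc.normc.

(** Dividing a vector of the half lattice by its content makes it primitive;
    [primpart] and [scalev] are the two directions of the resulting bijection
    between vectors and pairs of a primitive vector and a multiplier, the latter
    shifted by one to range over all naturals. *)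
Definition content (p : nat * int) : nat := gcdn p.1 `|p.2|.
Definition prim (p : nat * int) : bool := half p && (content p == 1%N).
Definition scalev (wk : (nat * int) * nat) : nat * int :=
  ((wk.2.+1 * wk.1.1)%N, wk.2.+1%:Z * wk.1.2).
Definition primpart (p : nat * int) : (nat * int) * nat :=
  (((p.1 %/ content p)%N, (p.2 %/ (content p)%:Z)%Z), (content p).-1).

Lemma content_gt0 p : half p -> (0 < content p)%N.
Proof. by rewrite /half /content gcdn_gt0; lia. Qed.

Lemma content_scalev w k : content w = 1%N -> content (scalev (w, k)) = k.+1.
Proof.
by rewrite /content /= abszM absz_nat -muln_gcdr => ->; rewrite muln1.
Qed.

Lemma half_scalev w k : half (scalev (w, k)) = half w.
Proof.
by rewrite /half /= muln_gt0 /= pmulr_rgt0.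
Qed.

Lemma primpartK p : half p -> prim (primpart p).1 /\ scalev (primpart p) = p.
Proof.
move=> hp; have d0 := content_gt0 hp.
have E1 : ((content p).-1.+1 * (p.1 %/ content p))%N = p.1.
  by rewrite prednK // mulnC divnK // dvdn_gcdl.
have E2 : (content p).-1.+1%:Z * (p.2 %/ (content p)%:Z)%Z = p.2.
  by rewrite prednK // mulrC divzK // dvdzE /= dvdn_gcdr.
have E : scalev (primpart p) = p by rewrite /scalev /= E1 E2; case: (p).
split => //; apply/andP; split.
  by rewrite -(half_scalev _ (content p).-1) -[X in half X]/(scalev (primpart p)) E.
have := congr1 content E; rewrite {1}/content /= abszM absz_nat -muln_gcdr.
rewrite -/(content (primpart p).1) prednK // => /eqP.
by rewrite -{2}[content p]muln1 eqn_pmul2l.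
Qed.

Lemma scalevK w k : prim w -> half (scalev (w, k)) /\ primpart (scalev (w, k)) = (w, k).
Proof.
move=> /andP[hw /eqP cw]; rewrite half_scalev; split => //.
rewrite /primpart content_scalev //= mulKn // mulKz //.
by case: (w).
Qed.

Lemma has_sum_prim (f : nat * int -> C) L :
  has_sum (fun p : nat * int => if half p then f p else 0) L <->
  has_sum (fun wk : (nat * int) * nat => if prim wk.1 then f (scalev wk) else 0) L.
Proof.
split.
- apply: (@has_big_reindex C 0 +%R _ _ half (fun wk => prim wk.1) primpart scalev).
  + by move=> p hp; have [? ?] := primpartK hp.
  + by move=> [w k] /= pw; have [? ?] := scalevK k pw.
  + by move=> p /negbTE ->.
  + by move=> p /negbTE ->.
  + by move=> p hp; have [-> ->] := primpartK hp; rewrite hp.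
- apply: (@has_big_reindex C 0 +%R _ _ (fun wk => prim wk.1) half scalev primpart).
  + by move=> [w k] /= pw; have [? ?] := scalevK k pw.
  + by move=> p hp; have [? ?] := primpartK hp.
  + by move=> p /negbTE ->.
  + by move=> p /negbTE ->.
  + by move=> [w k] /= pw; rewrite pw; have [-> _] := scalevK k pw.
Qed.

Lemma has_prod_prim (f : nat * int -> C) L :
  has_prod (fun p : nat * int => if half p then f p else 1) L ->
  has_prod (fun wk : (nat * int) * nat => if prim wk.1 then f (scalev wk) else 1) L.
Proof.
apply: (@has_big_reindex C 1 *%R _ _ half (fun wk => prim wk.1) primpart scalev).
- by move=> p hp; have [? ?] := primpartK hp.
- by move=> [w k] /= pw; have [? ?] := scalevK k pw.
- by move=> p /negbTE ->.
- by move=> p /negbTE ->.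
- by move=> p hp; have [-> ->] := primpartK hp; rewrite hp.
Qed.

Variable tau : C.
Hypothesis tau_up : 0 < complex.Im tau.
Local Notation b := (complex.Im tau).
Local Notation lam := (lam tau).

Lemma lam_scalev w k : lam (scalev (w, k)) = k.+1%:R * lam w.
Proof. by rewrite /lam /= natrM intrM mulrDr mulrA. Qed.

(** The factor of the product over the half lattice attached to lambda = k omega, omega
    primitive, is 1 - z^2 / (lambda^2 |omega|^s): the power |.|^s is taken at omega,
    not at lambda, because the k-th factor of the sine product attached to omega
    is 1 - zeta^2 / k^2. *)
Definition ypow (s : R) (p : nat * int) : C :=
  (lam p ^+ 2 * ((nc (lam p) / (content p)%:R) `^ s)%:C)^-1.

Lemma ipow2_scale (s : R) (k : nat) (x : C) :
  ipow2 s (k.+1%:R * x) = ipow2 s x * ipow2 s k.+1%:R.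
Proof.
rewrite /ipow2 ncM powRM ?nc_ge0 // rmorphM -invfM; congr _^-1; ring.
Qed.

Lemma natr_mulK (k : nat) (x : R) : k.+1%:R * x / k.+1%:R = x.
Proof. by rewrite mulrAC divff ?pnatr_eq0 // mul1r. Qed.

Lemma ypow_scalev (s : R) w k : prim w ->
  ypow s (scalev (w, k)) = ipow2 s (lam w) * (k.+1%:R ^+ 2)^-1.
Proof.
move=> /andP[_ /eqP cw]; rewrite /ypow content_scalev // lam_scalev ncM nc_nat.
rewrite natr_mulK /ipow2 -invfM; congr _^-1; ring.
Qed.

(** Uniform in s because |omega|^s is at least the constant [c], wherever s lies in
    [0, 1]. *)
Lemma ypow_bound : exists2 M : R, 0 <= M &
  forall (s : R) p, 0 <= s <= 1 -> half p -> nc (ypow s p) <= M * nc (lam p) ^- 2.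
Proof.
have [c /andP[c0 c1] cP] := nc_lam_half tau_up.
exists c^-1; first by rewrite invr_ge0 ltW.
move=> s p /andP[s0 s1] hp; have [pw E] := primpartK hp.
move: pw E; case: (primpart p) => w k /= pw <-.
have /andP[hw /eqP cw] := pw.
rewrite /ypow content_scalev // lam_scalev !ncM ncV ncM nc_nat ncX ncM nc_nat.
rewrite natr_mulK nc_real ger0_norm ?powR_ge0 //.
rewrite invfM [leRHS]mulrC ler_wpM2l ?invr_ge0 ?sqr_ge0 //.
have lc := cP w hw.
have cs : c <= nc (lam w) `^ s.
  apply: (@le_trans _ _ (c `^ s)).
    by rewrite -[leLHS]powRr1 ?(ltW c0) //; apply: ger_powR => //; rewrite c0.
  by rewrite ge0_ler_powR ?nnegrE ?nc_ge0 // ltW.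
by rewrite lef_pV2 ?posrE // (lt_le_trans c0).
Qed.

Lemma ypow_cvg p : half p -> ypow s p @[s --> 0^'+] --> (lam p ^+ 2)^-1.
Proof.
move=> hp; have l0 := lam_neq0 tau_up hp.
have y0 : 0 < nc (lam p) / (content p)%:R.
  by rewrite divr_gt0 ?nc_gt0 // ltr0n content_gt0.
have : ypow s p @[s --> 0^'+] --> (lam p ^+ 2 * 1)^-1.
  apply: cvgV; first by rewrite mulr1 expf_neq0.
  apply: cvgM; first exact: cvg_cst.
  by apply: cvg_realC; exact: cvg_powR_right0.
by rewrite mulr1.
Qed.

Lemma near_right01 : \forall s \near (0 : R)^'+, 0 < s <= 1.
Proof.
near=> s; apply/andP; split; near: s; [exact: nbhs_right_gt|exact: nbhs_right_le].
Unshelve. all: by end_near. Qed.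

Definition zetas (s : R) : C := usum (fun k : nat => ipow2 s (k.+1%:R : C)).

Lemma nc_ipow2_nat (s : R) (k : nat) : nc (ipow2 s (k.+1%:R : C)) = k.+1%:R `^ (- (2 + s)).
Proof. by rewrite nc_ipow2 ?pnatr_eq0 // nc_nat. Qed.

Lemma bsum_zetas (s : R) : 0 < s -> bsum (fun k : nat => nc (ipow2 s (k.+1%:R : C))).
Proof.
move=> s0; have a1 : 1 < 2 + s by lra.
by apply: bsum_le (bsum_powR a1) => k; rewrite nc_ipow2_nat.
Qed.

Lemma zetas_cvg : zetas s @[s --> 0^'+] --> zeta2 R.
Proof.
have a2 : (1 : R) < 2 by lra.
apply: (tannery_sum (f := fun s k => ipow2 s (k.+1%:R : C))
  (g := fun k => k.+1%:R `^ (- 2)) _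
  (fun k => powR_ge0 k.+1%:R (- 2)) (bsum_powR a2) _ _ (@has_sum_zeta2 R)).
- move=> k.
  have : ipow2 s (k.+1%:R : C) @[s --> 0^'+] --> ((k.+1%:R : C) ^+ 2 * 1)^-1.
    apply: cvgV; first by rewrite mulr1 expf_neq0 // pnatr_eq0.
    apply: cvgM; first exact: cvg_cst.
    by apply: cvg_realC; apply: cvg_powR_right0; rewrite nc_nat.
  by rewrite mulr1.
- apply: filterS near_right01 => s /andP[s0 _] k; rewrite nc_ipow2_nat.
  by rewrite ler_powR ?ler1n //; lra.
- apply: filterS near_right01 => s /andP[s0 _].
  exact: usumP (bsum_zetas s0).
Qed.

Lemma zeta2_neq0 : zeta2 R != 0.
Proof.
apply/eqP => z0.
have H : has_sum (fun k : nat => (((k.+1%:R : R) ^+ 2)^-1)%:C) (zeta2 R).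
  apply: (eq_has_sum _ (@has_sum_zeta2 R)) => k.
  by rewrite fmorphV rmorphXn /= rmorph_nat.
have g0 (k : nat) : 0 <= (k.+1%:R ^+ 2)^-1 :> R by rewrite invr_ge0 sqr_ge0.
have := has_sum_real_ge (t := [:: 0%N]) g0 isT H.
by rewrite big_seq1 z0 /= expr1n invr1 ler10.
Qed.

Definition wsum (s : R) : C := usum (fun w => if prim w then ipow2 s (lam w) else 0).

Lemma bsum_half_ipow2 (s : R) (P : pred (nat * int)) : 0 < s -> (forall p, P p -> half p) ->
  bsum (fun p => nc (if P p then ipow2 s (lam p) else 0)).
Proof.
move=> s0 Ph; have a1 : 1 < 1 + s / 2 by rewrite ltrDl divr_gt0.
apply: bsum_le (bsum_half tau_up a1) => p.
case: ifPn => Pp; last by rewrite nc0; case: ifP => // _; exact: powR_ge0.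
rewrite (Ph p Pp) nc_ipow2; last exact: lam_neq0 (Ph p Pp).
by have -> : 2 * (1 + s / 2) = 2 + s by field.
Qed.

Lemma has_wsum (s : R) : 0 < s ->
  has_sum (fun w => if prim w then ipow2 s (lam w) else 0) (wsum s).
Proof.
by move=> s0; apply: usumP; apply: bsum_half_ipow2 => // p /andP[].
Qed.

Lemma prim_half w : prim w -> half w. Proof. by case/andP. Qed.

Lemma has_sum_prim_mul (s : R) (g : nat -> C) L : 0 < s ->
  bsum (fun k => nc (g k)) -> has_sum g L ->
  has_sum (fun wk : (nat * int) * nat =>
     if prim wk.1 then ipow2 s (lam wk.1) * g wk.2 else 0) (wsum s * L).
Proof.
move=> s0 bg gL.
have bw := bsum_half_ipow2 s0 prim_half.
apply: (eq_has_sum _ (has_sum_mul bw bg (has_wsum s0) gL)) => -[w k] /=.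
by case: ifP => _ //; rewrite mul0r.
Qed.

(** Each primitive vector contributes its multiples k omega, hence the factor
    zeta(2) where the full Eisenstein series has zeta(2 + s). *)
Lemma has_sum_ypow (s : R) : 0 < s ->
  has_sum (fun p => if half p then ypow s p else 0) (wsum s * zeta2 R).
Proof.
move=> s0; apply/has_sum_prim.
apply: (eq_has_sum _ (has_sum_prim_mul s0 (bsum_zeta2 R) (@has_sum_zeta2 R))) => -[w k] /=.
by case: ifPn => // pw; rewrite ypow_scalev.
Qed.

Lemma has_sum_half_ipow2 (s : R) : 0 < s ->
  has_sum (fun p => if half p then ipow2 s (lam p) else 0) (wsum s * zetas s).
Proof.
move=> s0; apply/has_sum_prim.
have bz := bsum_zetas s0.
apply: (eq_has_sum _ (has_sum_prim_mul s0 bz (usumP bz))) => -[w k] /=.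
by case: ifPn => // pw; rewrite lam_scalev ipow2_scale.
Qed.

Definition upsum (s : R) : C :=
  usum (fun p : nat * int => if (0 < p.1)%N then ipow2 s (lam p) else 0).

Lemma has_upsum (s : R) : 0 < s ->
  has_sum (fun p : nat * int => if (0 < p.1)%N then ipow2 s (lam p) else 0) (upsum s).
Proof.
move=> s0; apply: usumP; apply: (bsum_half_ipow2 (P := fun p => (0 < p.1)%N)) => // p.
by rewrite /half => ->.
Qed.

(** Summing over all multiples of primitive vectors gives the whole half lattice, and
    the row m = 0 of the latter is the zeta value once more. *)
Lemma wsum_zetas (s : R) : 0 < s -> wsum s * zetas s = upsum s + zetas s.
Proof.
move=> s0; apply: (has_sum_unique (has_sum_half_ipow2 s0)).
have H0 : has_sum (fun p : nat * int => if (p.1 == 0)%N && (0 < p.2) then ipow2 s (lam p) else 0)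
    (zetas s).
  apply: (@has_big_reindex C 0 +%R nat (nat * int)%type xpredT
    (fun p : nat * int => (p.1 == 0)%N && (0 < p.2))
    (fun k => (0%N, k.+1%:Z)) (fun p => `|p.2|.-1)) (usumP (bsum_zetas s0)) => //.
  - by move=> [m n] /= /andP[/eqP -> n0]; split => //; congr (_, _); lia.
  - by move=> p /negbTE ->.
  - by move=> k _ /=; rewrite /lam /= mul0r add0r.
apply: (eq_has_sum _ (has_sumD (has_upsum s0) H0)) => -[m n] /=.
by rewrite /half /=; case: m => [|m] /=; rewrite ?add0r ?addr0.
Qed.

Definition pprod (z : C) (s : R) : C :=
  uprod (fun p => if half p then 1 - z ^+ 2 * ypow s p else 1).

Lemma bsum_half_ypow (s : R) : 0 < s ->
  bsum (fun p => nc (if half p then ypow s p else 0)).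
Proof.
move=> s0.
have bw := bsum_half_ipow2 s0 prim_half.
have bp := bsum_prod (fun w => nc_ge0 _) (fun k => nc_ge0 _) bw (bsum_zeta2 R).
apply: (bsum_reindex (b := half) (e := primpart)) bp.
- move=> p p' hp hp' E.
  by rewrite -(primpartK hp).2 E (primpartK hp').2.
- by move=> p /negbTE ->; rewrite nc0.
- move=> p hp; rewrite hp; have [pw E] := primpartK hp.
  by rewrite pw -{1}E; case: (primpart p) pw => w k pw; rewrite ypow_scalev // ncM.
Qed.

Lemma bsum_pprod (z : C) (s : R) : 0 < s ->
  bsum (fun p => nc ((if half p then 1 - z ^+ 2 * ypow s p else 1) - 1)).
Proof.
move=> s0; apply: bsum_le (bsumZ (nc_ge0 (z ^+ 2)) (bsum_half_ypow s0)) => p.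
case: ifP => _; last by rewrite subrr nc0 mulr0.
by rewrite addrAC subrr add0r ncN ncM.
Qed.

Lemma has_pprod (z : C) (s : R) : 0 < s ->
  has_prod (fun p => if half p then 1 - z ^+ 2 * ypow s p else 1) (pprod z s).
Proof. by move=> s0; apply: uprodP; exact: bsum_pprod. Qed.

(** Write the product as that of the elementary factors times the exponential of
    minus the sum. The former converges by domination. In the latter the sum over
    primitive vectors is (E + zeta(2 + s)) / zeta(2 + s), with E the sum over the
    rows m > 0, and its limit times zeta(2) is lim E + zeta(2). *)
Lemma pprod_cvg (z : C) (H0 : C) :
  has_sum (fun m : nat => if (0 < m)%N then row_sum tau m else 0) H0 ->
  upsum s @[s --> 0^'+] --> H0 - (pi / (2 * b))%:C ->
  pprod z s @[s --> 0^'+] -->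
    wprod tau z * cexp (- (z ^+ 2 * (zeta2 R + H0 - (pi / (2 * b))%:C))).
Proof.
move=> H0P upc.
pose wp s := uprod (fun p => if half p then wfac (z ^+ 2 * ypow s p) else 1).
have [M M0 MP] := ypow_bound.
have [g [g0 bg] gP] := wfac_bsum tau_up (mulr_ge0 (sqr_ge0 (nc z)) M0).
have yb s : 0 < s <= 1 -> forall p, half p ->
   nc (z ^+ 2 * ypow s p) <= nc z ^+ 2 * M * nc (lam p) ^- 2.
  move=> /andP[s0 s1] p hp; rewrite ncM ncX -mulrA ler_wpM2l ?sqr_ge0 //.
  by apply: MP => //; rewrite (ltW s0).
have wpP s : 0 < s <= 1 ->
    has_prod (fun p => if half p then wfac (z ^+ 2 * ypow s p) else 1) (wp s).
  move=> s01; apply: uprodP; apply: bsum_le bg.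
  exact: (gP (fun p => z ^+ 2 * ypow s p) (yb s s01)).
have wpc : wp s @[s --> 0^'+] --> wprod tau z.
  apply: (tannery_prod (f := fun s p => if half p then wfac (z ^+ 2 * ypow s p) else 1)
    _ g0 bg _ _ (@has_wprod R tau tau_up z)).
  - move=> p; case: ifPn => hp; last exact: cvg_cst.
    have yc : z ^+ 2 * ypow s p @[s --> 0^'+] --> z ^+ 2 / lam p ^+ 2.
      by apply: cvgM; [exact: cvg_cst|exact: ypow_cvg].
    apply: cvgM; last exact: cvg_cexp.
    by apply: cvgB; [exact: cvg_cst|exact: yc].
  - apply: filterS near_right01 => s s01.
    exact: (gP (fun p => z ^+ 2 * ypow s p) (yb s s01)).
  - by apply: filterS near_right01 => s; exact: wpP.
have wc : wsum s @[s --> 0^'+] --> (H0 - (pi / (2 * b))%:C + zeta2 R) / zeta2 R.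
  have zc := zetas_cvg.
  have L : (upsum s + zetas s) / zetas s @[s --> 0^'+] -->
     (H0 - (pi / (2 * b))%:C + zeta2 R) / zeta2 R.
    apply: cvgM; first by apply: cvgD; [exact: upc|exact: zc].
    by apply: cvgV; [exact: zeta2_neq0|exact: zc].
  apply: cvg_trans L; apply: near_eq_cvg; near=> s.
  have s0 : 0 < s by near: s; exact: nbhs_right_gt.
  have zs0 : zetas s != 0 by near: s; exact: cvgC_neq0 zeta2_neq0 zc.
  by rewrite -wsum_zetas // mulfK.
have Ep s : 0 < s <= 1 -> pprod z s = wp s * cexp (- (z ^+ 2 * (wsum s * zeta2 R))).
  move=> s01; have /andP[s0 _] := s01.
  apply: (has_prod_unique (has_pprod (z := z) s0)).
  have := has_prodM (wpP s s01) (has_prod_cexp (has_sumZ (c := - z ^+ 2) (has_sum_ypow s0))).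
  rewrite mulNr; apply: eq_has_prod => p; case: ifP => _.
    by rewrite /wfac mulNr cexpN mulfK // cexp_neq0.
  by rewrite mulr0 cexp0 mulr1.
have L : wp s * cexp (- (z ^+ 2 * (wsum s * zeta2 R))) @[s --> 0^'+] -->
   wprod tau z * cexp (- (z ^+ 2 * ((H0 - (pi / (2 * b))%:C + zeta2 R) / zeta2 R * zeta2 R))).
  apply: cvgM; first exact: wpc.
  apply: cvg_cexp; apply: cvgN; apply: cvgM; first exact: cvg_cst.
  by apply: cvgM; [exact: wc|exact: cvg_cst].
have -> : zeta2 R + H0 - (pi / (2 * b))%:C =
   (H0 - (pi / (2 * b))%:C + zeta2 R) / zeta2 R * zeta2 R.
  by rewrite divfK ?zeta2_neq0 //; ring.
apply: cvg_trans L; apply: near_eq_cvg; apply: filterS near_right01 => s s01.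
by rewrite Ep.
Unshelve. all: by end_near. Qed.
End PrimitiveVectors.

(** * The product of characteristic power series *)

Section AhatProduct.
Variable R : realType.
Local Notation C := R[i].
Local Notation nc := ComplexField.Normc.normc.
Variable tau : C.
Hypothesis tau_up : 0 < complex.Im tau.
Local Notation b := (complex.Im tau).
Local Notation lam := (lam tau).

(** Which of the two roots is taken does not matter below: v / sinh v is even. *)
Lemma sqrtc4 (v : C) : sqrtc (4 * v ^+ 2) / 2 = v \/ sqrtc (4 * v ^+ 2) / 2 = - v.
Proof.
have : (sqrtc (4 * v ^+ 2) / 2) ^+ 2 == v ^+ 2.
  by rewrite expr_div_n sqr_sqrtc; apply/eqP; field.
by rewrite eqf_sqr => /orP[] /eqP ->; [left|right].
Qed.

Lemma QA_sqr (v : C) : QA (4 * v ^+ 2) = (shc v)^-1.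
Proof.
rewrite /QA; have [E|n0] := eqVneq.
  have -> : v = 0.
    by move/eqP: E; rewrite mulf_eq0 pnatr_eq0 expf_eq0 /= => /eqP.
  by rewrite /shc eqxx invr1.
have v0 : v != 0 by apply: contraNneq n0 => ->; rewrite expr0n mulr0.
have [->|->] := sqrtc4 v; rewrite ?csinhN ?invrN ?mulrNN /shc (negbTE v0);
  by move: (csinh v) => c; rewrite invf_div.
Qed.

Lemma QA_pole_sqr (v : C) : v != 0 -> shc v = 0 -> QA_pole (4 * v ^+ 2).
Proof.
move=> v0 s0; split; first by rewrite mulf_neq0 ?pnatr_eq0 ?expf_neq0.
by have [->|->] := sqrtc4 v; rewrite ?csinhN csinhE s0 mulr0 ?oppr0.
Qed.

(** The zeros of the sine can be read off from its product. *)
Lemma shc_neq0 (z : C) : (forall k : nat, z ^+ 2 != k.+1%:R ^+ 2) -> shc (pii R * z) != 0.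
Proof.
move=> zk; apply: (has_prod_neq0 _ _ (@has_prod_sinpi R z)).
  apply: bsum_le (bsumZ (nc_ge0 (z ^+ 2)) (bsum_zeta2 R)) => k.
  by rewrite addrAC subrr add0r ncN ncM.
move=> k; have k0 : (k.+1%:R ^+ 2 : C) != 0 by rewrite expf_neq0 // pnatr_eq0.
rewrite subr_eq0; apply: contra (zk k) => /eqP E.
by rewrite -{1}(divfK k0 (z ^+ 2)) -E mul1r.
Qed.

Section FixedExponent.
Variables (z : C) (s : R).
Hypothesis s0 : 0 < s.

(** The argument zeta for which the factor attached to the primitive vector w is
    1 / shc (pi i zeta). *)
Definition prim_arg (w : nat * int) : C :=
  z / (lam w * (nc (lam w) `^ (s / 2))%:C).

Lemma sqr_prim_arg w : half w -> prim_arg w ^+ 2 = z ^+ 2 * ipow2 s (lam w).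
Proof.
move=> hw; rewrite /prim_arg expr_div_n; congr (_ / _).
rewrite exprMn -rmorphXn; congr (_ * _%:C).
by rewrite -(powR_mulrn 2) ?powR_ge0 // -powRrM; congr (_ `^ _); field.
Qed.

(** Group the factors of the product over the half lattice by primitive vector; each
    group is the sine product at [prim_arg]. *)
Lemma has_prod_prim_shc :
  has_prod (fun w => if prim w then shc (pii R * prim_arg w) else 1)
    (pprod tau z s).
Proof.
have H : has_prod (fun wk : (nat * int) * nat =>
    if prim wk.1 then 1 - z ^+ 2 * ypow tau s (scalev wk) else 1) (pprod tau z s).
  apply: (@has_prod_prim R (fun p => 1 - z ^+ 2 * ypow tau s p)).
  exact: has_pprod.
apply: (has_prod_fubini H) => w /=.
case: (boolP (prim w)) => pw; last first.
  exact: (@has_prod_one R nat (fun=> 1)).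
apply: (eq_has_prod _ (@has_prod_sinpi R (prim_arg w))) => k.
by rewrite sqr_prim_arg ?prim_half // ypow_scalev // mulrA.
Qed.

Lemma lam_neg w w' : half w -> half w' -> lam w != - lam w'.
Proof.
move=> hw hw'; apply/eqP => E.
have := congr1 (@complex.Im R) E; have := congr1 (@complex.Re R) E.
rewrite !raddfN /= !Im_lam !Re_lam => Er Ei.
have : (w.1%:R + w'.1%:R) * b = 0 by rewrite mulrDl Ei addNr.
move=> /eqP; rewrite mulf_eq0 (gt_eqF tau_up) orbF -natrD pnatr_eq0 addn_eq0.
move=> /andP[/eqP m0 /eqP m0']; move: Er hw hw'.
rewrite /half m0 m0' !mul0r !add0r -rmorphN => /(mulrIz (@oner_neq0 R)) /=.
lia.
Qed.

Lemma lam_inj : injective lam.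
Proof.
move=> [m n] [m' n'] E.
have := congr1 (@complex.Im R) E; have := congr1 (@complex.Re R) E.
rewrite !Im_lam !Re_lam /= => Er /(mulIf (lt0r_neq0 tau_up)) /eqP.
rewrite eqr_nat => /eqP mm; move: Er; rewrite mm => /addrI.
by move=> /(mulrIz (@oner_neq0 R)) ->.
Qed.

(** Moduli determine |lambda|, hence lambda^2, hence lambda up to sign, and the half
    lattice contains only one of lambda and - lambda. Without this, distinct
    primitive vectors could give the same element of the set. *)
Lemma ipow2_lam_inj w w' : half w -> half w' ->
  ipow2 s (lam w) = ipow2 s (lam w') -> w = w'.
Proof.
move=> hw hw' E; have l0 := lam_neq0 tau_up hw; have l0' := lam_neq0 tau_up hw'.
have nE : nc (lam w) = nc (lam w').
  have := congr1 (@nc R) E; rewrite !nc_ipow2 // !powRN => /invr_inj.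
  have s2 : 0 < 2 + s by rewrite addr_gt0.
  by apply: (powR_injective s2); rewrite nnegrE nc_ge0.
move: E; rewrite /ipow2 nE => /invr_inj /mulIf.
have p0 : (nc (lam w') `^ s)%:C != 0 by rewrite fmorph_eq0 gt_eqF //; apply: powR_gt0; rewrite nc_gt0.
move=> /(_ p0) /eqP; rewrite eqf_sqr (negbTE (lam_neg hw hw')) orbF => /eqP.
exact: lam_inj.
Qed.

Lemma ipow2N (x : C) : ipow2 s (- x) = ipow2 s x.
Proof. by rewrite /ipow2 sqrrN ncN. Qed.

(** A coprime pair (m, n) is replaced by its opposite when it lies in the wrong half. *)
Lemma Xset_prim (x : C) : Xset tau s x -> exists2 w, prim w & x = ipow2 s (lam w).
Proof.
move=> [m [n [cop ->]]].
rewrite -[X in exists2 w, _ & X = _]/(ipow2 s (m%:~R * tau + n%:~R)).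
have cmn : gcdn `|m| `|n| = 1%N by move: cop; rewrite /coprimez /gcdz => /eqP [].
pose neg := (m < 0) || (m == 0) && (n < 0).
pose w : nat * int := (`|m|%N, if neg then - n else n).
have pw : prim w.
  apply/andP; split; last by rewrite /content /w /=; case: ifP => _; rewrite ?abszN cmn.
  rewrite /half /w /neg /=; case: (ltgtP m 0) => m0 /=; [by lia|by lia|].
  move: cmn; rewrite m0 gcd0n; case: ifP; lia.
exists w => //; rewrite -[lam w]/(`|m|%N%:R * tau + (if neg then - n else n)%:~R).
have [mneg|mpos] := ltrP m 0.
  rewrite /neg mneg orTb -ipow2N opprD -mulNr -!rmorphN; congr (ipow2 s (_ * _ + _)).
  by rewrite -[RHS]/((`|m|%N%:Z)%:~R) ltz0_abs.
have mabs : (`|m|%N%:R : C) = m%:~R by rewrite -{2}(gez0_abs mpos).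
rewrite mabs /neg ltNge mpos orFb; case: ifP => // /andP[/eqP -> _].
by rewrite mulr0z mul0r !add0r mulrNz ipow2N.
Qed.

Lemma prim_Xset w : prim w -> Xset tau s (ipow2 s (lam w)).
Proof.
move=> /andP[_ /eqP cw]; exists w.1%:Z, w.2; split => //.
by rewrite /coprimez /gcdz /= -[gcdn _ _]/(content w) cw.
Qed.

Lemma Ahat_term w : prim w ->
  QA (ipow2 s (lam w) * (2 * pii R * z) ^+ 2) = (shc (pii R * prim_arg w))^-1.
Proof.
move=> pw; rewrite -QA_sqr; congr QA.
rewrite [(pii R * _) ^+ 2]exprMn sqr_prim_arg ?prim_half //; ring.
Qed.

(** Distinct primitive vectors in the half lattice give distinct elements of the set
    and all of it, so the product over the set is a product over primitive
    vectors. *)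
Lemma has_prod_Ahat : pprod tau z s != 0 ->
  has_prod (fun x : set_type (Xset tau s) => QA (val x * (2 * pii R * z) ^+ 2))
    (pprod tau z s)^-1.
Proof.
move=> P0; have H := has_prodV P0 has_prod_prim_shc.
have ex (x : set_type (Xset tau s)) : exists w, prim w /\ val x = ipow2 s (lam w).
  by have [w pw E] := Xset_prim (set_mem (valP x)); exists w.
have [e' e'P] := choice ex.
have p10 : prim (0%N, 1) by [].
pose x0 : set_type (Xset tau s) := SigSub (mem_set (prim_Xset p10)).
have ew w : exists x : set_type (Xset tau s), prim w -> val x = ipow2 s (lam w).
  have [pw|pw] := boolP (prim w); last by exists x0.
  by exists (SigSub (mem_set (prim_Xset pw))).
have [e eP] := choice ew.
apply: (@has_big_reindex C 1 *%R _ _ prim xpredT e e') H => //.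
- move=> w pw; split => //; have [pw' E] := e'P (e w).
  by apply: ipow2_lam_inj; rewrite ?prim_half // -E eP.
- by move=> x _; have [pw' E] := e'P x; split => //; apply: val_inj; rewrite eP.
- by move=> w /negbTE ->; rewrite invr1.
- by move=> w pw; rewrite pw eP // Ahat_term.
Qed.

(** A zero of the product is a zero of one factor, hence of one sine, which is a pole
    of the characteristic power series at an element of the set. *)
Lemma pprod_neq0 :
  (forall x, Xset tau s x -> ~ QA_pole (x * (2 * pii R * z) ^+ 2)) ->
  pprod tau z s != 0.
Proof.
move=> np; apply: (has_prod_neq0 _ _ (has_pprod tau_up (z := z) s0)).
  exact: bsum_pprod.
move=> p; case: ifPn => hp; last exact: oner_neq0.
apply/eqP => E; have [pw Ep] := primpartK hp.
move: pw Ep; case: (primpart p) => w k /= pw Ep.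
have hw := prim_half pw.
apply: (np _ (prim_Xset pw)).
have -> : ipow2 s (lam w) * (2 * pii R * z) ^+ 2 = 4 * (pii R * prim_arg w) ^+ 2.
  rewrite [(pii R * prim_arg w) ^+ 2]exprMn sqr_prim_arg //; ring.
have E2 : 1 - prim_arg w ^+ 2 / k.+1%:R ^+ 2 = 0.
  by rewrite -E -Ep ypow_scalev // sqr_prim_arg // mulrA.
apply: QA_pole_sqr; last first.
  by apply: (@has_prod_zero R _ _ _ k _ (@has_prod_sinpi R (prim_arg w))); exact: E2.
rewrite mulf_neq0 ?pii_neq0 //; apply/eqP => a0; move: E2.
by rewrite a0 expr0n mul0r subr0 => /eqP; rewrite oner_eq0.
Qed.
End FixedExponent.

Lemma theta_quotientE (z H0 : C) :
  has_sum (fun m : nat => if (0 < m)%N then row_sum tau m else 0) H0 ->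
  z != 0 -> shc (pii R * z) != 0 ->
  theta_quotient z tau =
   (wprod tau z * cexp (- (z ^+ 2 * (zeta2 R + H0 - (pi / (2 * b))%:C))))^-1.
Proof.
move=> H0P z0 sz; rewrite /theta_quotient (modified_theta_product tau_up H0P sz).
have p0 := pii_neq0 R.
have c0 : 2 * pii R * z != 0.
  by apply: mulf_neq0 => //; apply: mulf_neq0; rewrite ?pnatr_eq0 // p0.
by rewrite invfM mulrA divff ?mul1r.
Qed.

Lemma wprod0 : wprod tau 0 = 1.
Proof.
apply: (has_prod_unique (@has_wprod R tau tau_up 0)).
apply: (@has_prod_one R (nat * int)%type) => p; case: ifP => // _.
by rewrite expr0n mul0r /wfac subr0 mul1r cexp0.
Qed.

(** Off 0 this is the theta identity. At 0 the right-hand side is continuous with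
    value 1, and near 0 it is the theta quotient. *)
Lemma theta_quotient_extE (z H0 : C) :
  has_sum (fun m : nat => if (0 < m)%N then row_sum tau m else 0) H0 ->
  ~ (lattice tau `\ 0) z ->
  theta_quotient_ext z tau =
   (wprod tau z * cexp (- (z ^+ 2 * (zeta2 R + H0 - (pi / (2 * b))%:C))))^-1.
Proof.
move=> H0P hz; rewrite /theta_quotient_ext; case: eqVneq => [->|z0]; last first.
  apply: theta_quotientE => //; apply: shc_neq0 => k.
  rewrite eqf_sqr; apply/negP => /orP[] /eqP E; apply: hz; (split; last exact/eqP).
    by exists 0, k.+1%:Z; rewrite mul0r add0r.
  by exists 0, (- k.+1%:Z); rewrite mul0r add0r rmorphN.
rewrite expr0n mul0r oppr0 cexp0 mulr1 wprod0 invr1.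
apply: cvgC_lim.
pose G := zeta2 R + H0 - (pi / (2 * b))%:C.
have lim1 : (wprod tau w * cexp (- (w ^+ 2 * G)))^-1 @[w --> (0 : C)] --> (1 : C).
  have : (wprod tau w * cexp (- (w ^+ 2 * G)))^-1 @[w --> (0 : C)] -->
      (1 * cexp (- ((0 : C) ^+ 2 * G)))^-1.
    have FF := nbhs_filter (0 : C).
    apply: (@cvgV _ _ _ FF); first by rewrite mul1r cexp_neq0.
    apply: (@cvgM _ _ _ FF); first exact: wprod_near0.
    apply: (@cvg_cexp _ _ _ FF); apply: (@cvgN _ _ _ _ FF).
    apply: (@cvgM _ _ _ FF); last exact: (@cvg_cst C _ _ _ FF).
    by apply: (@cvg_sqr _ _ _ FF); exact: (@cvg_id C (nbhs (0 : C))).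
  by rewrite expr0n mul0r oppr0 cexp0 mul1r invr1.
have lim2 : (wprod tau w * cexp (- (w ^+ 2 * G)))^-1 @[w --> (0 : C)^'] --> (1 : C).
  by apply: cvg_trans lim1; apply: cvg_app; exact: cvg_within.
apply: cvg_trans lim2; apply: near_eq_cvg; rewrite near_withinE.
have near1 : \forall w \near (0 : C), nc w < 1.
  have /cvgCP /(_ 1 ltr01) := @cvg_id C (nbhs (0 : C)).
  by apply: filterS => w; rewrite subr0.
apply: filterS near1 => w w1 w0; rewrite (theta_quotientE H0P w0) //.
apply: shc_neq0 => k; rewrite eqf_sqr; apply/negP => /orP[] /eqP E; move: w1.
  by rewrite E nc_nat ltrn1.
by rewrite E ncN nc_nat ltrn1.
Qed.
End AhatProduct.

Theorem theorem1p1 (R : realType) (tau : R[i]) (htau : 0 < complex.Im tau)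
    (z : R[i]) (hz : ~ (lattice tau `\ 0) z) :
  (forall s : R, 0 < s ->
     (forall x : R[i], Xset tau s x -> ~ QA_pole (x * (2 * pii R * z) ^+ 2)) ->
     Ahat_converges (Xset tau s) ((2 * pii R * z) ^+ 2)) /\
  Ahat (Xset tau s) ((2 * pii R * z) ^+ 2) @[s --> 0^'+]
    --> theta_quotient_ext z tau.
Proof.
split=> [s s0 np|].
  have H := has_prod_Ahat htau s0 (pprod_neq0 htau s0 np).
  by apply/cvg_ex; eexists; exact: H.
have [H0 H0P HU] := hecke_limit htau (has_row_sum htau).
have P := pprod_cvg htau (z := z) H0P (HU (upsum tau) (has_upsum htau)).
set L := (X in _ --> X) in P.
have L0 : L != 0 by rewrite mulf_neq0 ?cexp_neq0 //; exact: wprod_neq0.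
rewrite (theta_quotient_extE htau H0P hz) -/L.
apply: cvg_trans (cvgV L0 P); apply: near_eq_cvg; near=> s.
have s0 : 0 < s by near: s; exact: nbhs_right_gt.
have P0 : pprod tau z s != 0 by near: s; exact: cvgC_neq0 L0 P.
apply/esym/cvgC_lim; exact: has_prod_Ahat.
Unshelve. all: by end_near.
Qed.
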